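(* Let $(X,\omega)$ be a hyperelliptic translation surface with affine involution $\sigma$ such that $\mathrm{Aff}(X,\omega)$ is generated by torsion (finite-order elements, which may reverse orientation). Then the Weierstra{\ss} points of $X$ are periodic points of $(X,\omega)$.
   Context: A translation surface $(X,\omega)$ is a closed (compact connected) Riemann surface $X$ with a nonzero holomorphic $1$-form $\omega$; integrating $\omega$ gives local coordinates in $\mathbb{C}=\mathbb{R}^2$ on $X$ minus the zero set $Z(\omega)$, with transition maps translations. An affine map of $(X,\omega)$ is a homeomorphism $\phi:X\to X$ (possibly orientation-reversing), mapping $Z(\omega)$ to itself, which on $X\setminus Z(\omega)$ has the form $v\mapsto Lv+c$ with $L\in GL_2(\mathbb{R})$ in these coordinates. The group of all affine maps (including orientation-reversing ones) is $\mathrm{Aff}(X,\omega)$. A point of $X$ is periodic if its orbit under $\mathrm{Aff}(X,\omega)$ is finite. $(X,\omega)$ is hyperelliptic with affine involution $\sigma$ if $\sigma$ is a holomorphic involution of $X$ that acts affinely on $(X,\omega)$ and $X/\langle\sigma\rangle$ is a Riemann sphere. A point $x\in X$ is a Weierstra{\ss} point if there is a meromorphic function on $X$ whose only pole is at $x$, of order at most the genus of $X$. *)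

(* Defs.v *)
From HB Require Import structures.
From mathcomp Require Import all_boot all_order all_algebra.
From mathcomp Require Import complex.
From mathcomp Require Import all_classical all_reals all_analysis.

Set Implicit Arguments.
Unset Strict Implicit.
Unset Printing Implicit Defensive.

Import Order.TTheory GRing.Theory Num.Theory numFieldNormedType.Exports.
Local Open Scope classical_set_scope.
Local Open Scope ring_scope.

(* [derivable f z 1], for a function on the normed field [R[i]^o], is complex
   differentiability at [z]; on an open set this is holomorphy. *)

Section Curves.
Variable R : realType.
Local Notation C := (R[i]^o).

(* [chart_map] and [chart_inv] are total functions, relevant only on
   [chart_dom] and on its image. *)
Record chart (T : topologicalType) := Chart {
  chart_dom : set T;
  chart_map :> T -> C;
  chart_inv : C -> T;
  chart_dom_open : open chart_dom;
  chart_img_open : open (chart_map @` chart_dom);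
  chart_mapK : forall x, chart_dom x -> chart_inv (chart_map x) = x;
  chart_map_continuous :
    forall x, chart_dom x -> {for x, continuous chart_map};
  chart_inv_continuous :
    forall x, chart_dom x -> {for chart_map x, continuous chart_inv} }.

(* One-dimensional complex manifolds, neither connected nor Hausdorff by
   definition; see [closed_riemann_surface]. *)
Record complex_curve := ComplexCurve {
  curve_space :> topologicalType;
  curve_index : Type;
  curve_chart : curve_index -> chart curve_space;
  curve_cover : forall x, exists i, chart_dom (curve_chart i) x;
  curve_compat : forall i j x,
    chart_dom (curve_chart i) x -> chart_dom (curve_chart j) x ->
    derivable (curve_chart j \o chart_inv (curve_chart i))
              (curve_chart i x) 1 }.

Definition closed_riemann_surface (X : complex_curve) : Prop :=
  [/\ hausdorff_space X, compact [set: X] & connected [set: X]].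

(* Holomorphy at every point of [U]; used for open [U] only. *)
Definition holomorphic_on (X : complex_curve) (U : set X) (f : X -> C) : Prop :=
  forall i x, U x -> chart_dom (curve_chart i) x ->
    derivable (f \o chart_inv (curve_chart i)) (curve_chart i x) 1.

Definition holomorphic_map (X Y : complex_curve) (f : X -> Y) : Prop :=
  continuous f /\
  forall i j x, chart_dom (curve_chart i) x -> chart_dom (curve_chart j) (f x) ->
    derivable (curve_chart j \o f \o chart_inv (curve_chart i))
              (curve_chart i x) 1.

(* A holomorphic 1-form, written [w i z * dz] in the chart [i]. *)
Record one_form (X : complex_curve) := OneForm {
  form_coef :> curve_index X -> C -> C;
  form_holomorphic : forall i x, chart_dom (curve_chart i) x ->
    derivable (form_coef i) (curve_chart i x) 1;
  form_compat : forall i j x,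
    chart_dom (curve_chart i) x -> chart_dom (curve_chart j) x ->
    form_coef i (curve_chart i x) =
    form_coef j (curve_chart j x) *
      derive1 (curve_chart j \o chart_inv (curve_chart i)) (curve_chart i x) }.

Definition form_zeros (X : complex_curve) (w : one_form X) : set X :=
  [set x | exists2 i, chart_dom (curve_chart i) x & w i (curve_chart i x) = 0].

Definition nonzero_form (X : complex_curve) (w : one_form X) : Prop :=
  exists x, ~ form_zeros w x.

(* The genus is the dimension of the space of holomorphic 1-forms: here [b] is
   a basis of that space. *)
Definition has_genus (X : complex_curve) (g : nat) : Prop :=
  exists b : 'I_g -> one_form X, forall w : one_form X,
    exists! c : {ffun 'I_g -> C}, forall i x, chart_dom (curve_chart i) x ->
      w i (curve_chart i x) = \sum_(k < g) c k * b k i (curve_chart i x).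

(* [f] has a pole of order exactly [n] at [x]; the value [f x] is irrelevant. *)
Definition pole_of_order (X : complex_curve) (f : X -> C) (x : X) (n : nat) :
    Prop :=
  (0 < n)%N /\
  forall i, chart_dom (curve_chart i) x ->
    let z0 := curve_chart i x in
    exists h : C -> C,
      [/\ h z0 != 0,
          \forall z \near z0, derivable h z 1 &
          \forall z \near z0^',
            f (chart_inv (curve_chart i) z) = h z / (z - z0) ^+ n].

Definition weierstrass_point (X : complex_curve) (x : X) : Prop :=
  exists (g : nat) (f : X -> C) (n : nat),
    [/\ has_genus X g, (n <= g)%N, pole_of_order f x n &
        holomorphic_on [set~ x] f].

Local Notation S2 := (one_point_compactification C).

(* The two charts of the Riemann sphere: [z], off infinity, and [1/z], off [0].
   The values of [sphere_fin] at [None] and of [sphere_inf] at [Some 0] are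
   irrelevant. *)
Definition sphere_fin (o : S2) : C := if o is Some z then z else 0.

Definition sphere_inf (o : S2) : C := if o is Some z then z^-1 else 0.

Definition sphere_inf_inv (w : C) : S2 := if w == 0 then None else Some w^-1.

Lemma sphere_fin_dom_open : open [set o : S2 | o <> None].
Proof.
rewrite (_ : mkset _ = Some @` [set: C]).
  exact/one_point_compactification_open_some/openT.
by apply/seteqP; split=> [[z|]//= _|_ [z _ <-]//]; exists z.
Qed.

Lemma sphere_fin_img_open : open (sphere_fin @` [set o | o <> None]).
Proof.
rewrite (_ : _ @` _ = setT); first exact: openT.
by apply/seteqP; split=> // z _; exists (Some z).
Qed.

Lemma sphere_finK (o : S2) : o <> None -> Some (sphere_fin o) = o.
Proof. by case: o. Qed.

Lemma sphere_fin_continuous (o : S2) :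
  o <> None -> {for o, continuous sphere_fin}.
Proof. by case: o => [z|//] _ A /=; apply. Qed.

Lemma sphere_fin_inv_continuous (o : S2) :
  o <> None -> {for sphere_fin o, continuous (Some : C -> S2)}.
Proof. by move=> _; exact: one_point_compactification_some_continuous. Qed.

Definition sphere_fin_chart : chart S2 :=
  Chart sphere_fin_dom_open sphere_fin_img_open sphere_finK
    sphere_fin_continuous sphere_fin_inv_continuous.

Lemma sphere_inf_dom_open : open [set o : S2 | o <> Some 0].
Proof.
rewrite openE => -[z|] /= oN0.
  have z0 : z != 0 by apply/eqP => z0; apply: oN0; rewrite z0.
  have : nbhs z [set~ (0 : C)].
    apply: open_nbhs_nbhs; split; last by apply/eqP.
    apply: closed_openC.
    exact/accessible_closed_set1/hausdorff_accessible/norm_hausdorff.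
  by apply: (@filterS _ (nbhs z)) => y /= y0 [].
exists [set (0 : C)].
  by split; [exact: compact_set1|exact/accessible_closed_set1/hausdorff_accessible/norm_hausdorff].
by move=> o [[y /= y0 <-] []//|-> //].
Qed.

Lemma sphere_infK (o : S2) : o <> Some 0 -> sphere_inf_inv (sphere_inf o) = o.
Proof.
case: o => [z|] oN0; rewrite /sphere_inf_inv /sphere_inf ?eqxx //.
have /negPf z0 : z != 0 by apply/eqP => z0; apply: oN0; rewrite z0.
by rewrite invr_eq0 z0 invrK.
Qed.

Lemma sphere_inf_img_open : open (sphere_inf @` [set o | o <> Some 0]).
Proof.
rewrite (_ : _ @` _ = setT); first exact: openT.
apply/seteqP; split=> // w _; exists (sphere_inf_inv w).
  rewrite /sphere_inf_inv /=; case: eqP => // /eqP w0 [] /eqP.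
  by rewrite invr_eq0 (negPf w0).
rewrite /sphere_inf_inv; case: eqP => [->//|_] /=; exact: invrK.
Qed.

Lemma complex_pos (e : R[i]) : 0 < e -> exists2 r : R, 0 < r & e = r%:C%C.
Proof.
case: e => a b; rewrite ltcE /= => /andP[/eqP -> a0].
by exists a.
Qed.

Lemma normc_real (z : C) : exists2 r : R, 0 <= r & `|z| = r%:C%C :> R[i].
Proof.
have := normr_ge0 (z : R[i]); case E : (`|z : R[i]|) => [a b].
rewrite lecE /= => /andP[/eqP b0 a0].
by exists a => //; rewrite b0.
Qed.

Lemma complex_compact_box (M : R) : exists2 W : set C, compact W &
  forall z : C, ~ W z -> (M%:C%C < `|z|)%R.
Proof.
pose p (u : R * R) : C := (u.1 +i* u.2)%C.
exists (p @` (`[- M, M] `*` `[- M, M])).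
  apply: continuous_compact; last by apply: compact_setX; exact: segment_compact.
  apply: continuous_subspaceT => u.
  apply/cvgrPdist_lt => e /complex_pos[r r0 ->].
  have cv1 : (fun v : R * R => v.1) @ nbhs u --> u.1 by exact: cvg_fst.
  have cv2 : (fun v : R * R => v.2) @ nbhs u --> u.2 by exact: cvg_snd.
  near=> v.
  rewrite /p.
  have -> : (u.1 +i* u.2)%C - (v.1 +i* v.2)%C
     = ((u.1 - v.1)%:C + 'i * (u.2 - v.2)%:C)%C :> R[i].
    by rewrite [RHS]complexE !raddfD /= ; simpc.
  apply: le_lt_trans (ler_normD _ _) _.
  rewrite normrM !normc_def /= !expr0n expr1n /= !addr0 !add0r sqrtr1 mul1r.
  rewrite !sqrtr_sqr.
  rewrite -raddfD /= ltcR.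
  have -> : r = r / 2 + r / 2 by rewrite -splitr.
  apply: ltrD.
    by near: v; move/cvgrPdist_lt : cv1; apply; rewrite divr_gt0.
  by near: v; move/cvgrPdist_lt : cv2; apply; rewrite divr_gt0.
move=> z nW; have [r r0 zr] := normc_real z.
rewrite zr ltcR ltNge; apply/negP => rM; apply: nW.
have rE : r = Num.sqrt (complex.Re z ^+ 2 + complex.Im z ^+ 2).
  by have := zr; rewrite [`|z|]normc_def => -[].
have zle (t : R) : t ^+ 2 <= complex.Re z ^+ 2 + complex.Im z ^+ 2 -> - M <= t <= M.
  move=> tz; rewrite -ler_norml; apply: le_trans rM; rewrite rE.
  by rewrite -sqrtr_sqr ler_sqrt // addr_ge0 // sqr_ge0.
exists (complex.Re z, complex.Im z); last by case: (z).
by split; rewrite /= in_itv /=; apply: zle; rewrite ?lerDl ?lerDr sqr_ge0.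
Unshelve. all: by end_near. Qed.

Lemma complex_compact_bounded (W : set C) : compact W ->
  exists2 M : R, 0 < M & forall z, W z -> (`|z| < M%:C%C)%R.
Proof.
move=> /compact_near_coveringP/(_ R (pinfty_nbhs R) (fun M z => (`|z| < M%:C%C)%R)).
case.
  move=> z _; have [r r0 zr] := normc_real z.
  have cvz : (fun u : C => u) @ nbhs z --> z by [].
  exists ([set u : C | (`|u - z| < 1)%R], [set M : R | r + 1 <= M]).
    split=> /=; last by apply: nbhs_pinfty_ge; exact: num_real.
    by move/cvgrPdistC_lt : cvz; apply; exact: ltr01.
  move=> [u M] [/= uz rM].
  have -> : u = z + (u - z) by rewrite addrC subrK.
  apply: le_lt_trans (ler_normD _ _) _.
  apply: (@lt_le_trans _ _ (r + 1)%:C%C); last by rewrite lecR.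
  by rewrite zr raddfD /= ltrD2l.
move=> M [Mr MW].
exists (Num.max 1 (M + 1)); first by rewrite lt_max ltr01.
move=> z Wz; apply: MW => //.
by rewrite lt_max ltrDl ltr01 orbT.
Qed.

Lemma sphere_inf_continuous (o : S2) :
  o <> Some 0 -> {for o, continuous sphere_inf}.
Proof.
case: o => [z|] oN0.
  have z0 : z != 0 by apply/eqP => z0; apply: oN0; rewrite z0.
  by move=> A; exact: (inv_continuous z0).
move=> A /nbhs_ballP[_ /= /complex_pos[r r0 ->] rA].
have [W cW WP] := complex_compact_box r^-1.
exists W.
  by split=> //; apply: compact_closed => //; exact: norm_hausdorff.
move=> o oW; apply: rA; rewrite -ball_normE /=.
case: oW => [[z /= /WP nWz <-]|->] /=; last by rewrite subrr normr0 ltcR.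
rewrite sub0r normrN normfV.
have z0 : 0 < `|z : R[i]| by apply: le_lt_trans nWz; rewrite lecR invr_ge0 ltW.
rewrite invf_plt ?posrE //; last by rewrite ltcR.
by move: nWz; rewrite (fmorphV (real_complex R)).
Qed.

Lemma sphere_inf_inv_continuous (o : S2) :
  o <> Some 0 -> {for sphere_inf o, continuous sphere_inf_inv}.
Proof.
move=> _; move: (sphere_inf o) => w.
have [->|w0] := eqVneq w 0.
  rewrite /prop_for /continuous_at {2}/sphere_inf_inv eqxx => A [W [cW _] WA].
  have [M M0 MP] := complex_compact_bounded cW.
  have cv0 : (fun u : C => u) @ nbhs (0 : C) --> (0 : C) by [].
  have e0 : (0 : R[i]) < (M^-1)%:C%C by rewrite ltcR invr_gt0.
  move/cvgrPdistC_lt : cv0 => /(_ _ e0).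
  apply: filterS => u /=; rewrite subr0 => uM; apply: WA.
  rewrite /sphere_inf_inv; case: eqP => [_|/eqP u0]; first by right.
  left; exists u^-1 => // /MP; rewrite normfV; apply/negP/negbT/le_gtF.
  have nu0 : 0 < `|u : R[i]| by rewrite normr_gt0.
  rewrite invf_pge ?posrE //; last by rewrite ltcR.
  by move/ltW : uM; rewrite (fmorphV (real_complex R)).
rewrite /prop_for /continuous_at {2}/sphere_inf_inv (negPf w0).
have nw0 : \forall u \near w, u != 0.
  by apply: (@cvgr_neq0 _ _ _ (nbhs w) _ id w); first exact: cvg_id.
move=> A wA; have cA : nbhs w [set u : C | A (Some u^-1)].
  exact: (inv_continuous w0 wA).
change (\forall u \near w, A (sphere_inf_inv u)).
near=> u; rewrite /= /sphere_inf_inv ifN; last by near: u.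
by near: u.
Unshelve. all: by end_near. Qed.

Definition sphere_inf_chart : chart S2 :=
  Chart sphere_inf_dom_open sphere_inf_img_open sphere_infK
    sphere_inf_continuous sphere_inf_inv_continuous.

Definition sphere_chart (b : bool) : chart S2 :=
  if b then sphere_inf_chart else sphere_fin_chart.

Lemma sphere_cover (o : S2) : exists b, chart_dom (sphere_chart b) o.
Proof. by case: o => [z|]; [exists false|exists true]. Qed.

Lemma sphere_compat (i j : bool) (o : S2) :
  chart_dom (sphere_chart i) o -> chart_dom (sphere_chart j) o ->
  derivable (sphere_chart j \o chart_inv (sphere_chart i))
            (sphere_chart i o) 1.
Proof.
have invE : sphere_inf \o sphere_inf_inv = (@id C).
  apply/funext => z; rewrite /sphere_inf_inv /=.
  by case: eqP => [->//|_] /=; rewrite invrK.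
have invE' : sphere_fin \o sphere_inf_inv = (fun z : C => z^-1 : C).
  apply/funext => z; rewrite /sphere_inf_inv /=.
  by case: eqP => [->/=|//]; rewrite invr0.
have dV (z : C) : z != 0 -> derivable (fun u : C => u^-1 : C) z 1.
  by move=> z0; apply: (@derivableV _ _ id) => //; exact: derivable_id.
case: i j => -[] /=; rewrite /chart_inv /chart_map /chart_dom /= => oi oj.
- by rewrite invE; exact: derivable_id.
- rewrite invE'; apply: dV; case: o oi oj => [z|] //= oi _.
  by rewrite invr_eq0; apply/eqP => z0; apply: oi; rewrite z0.
- apply: (dV (sphere_fin o)); case: o oi oj => [z|] //= _ oj.
  by apply/eqP => z0; apply: oj; rewrite z0.
- exact: (@derivable_id _ _ (sphere_fin o)).
Qed.

Definition riemann_sphere : complex_curve :=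
  ComplexCurve sphere_cover sphere_compat.

(* [p : X -> Y] presents [Y] as the quotient Riemann surface [X / <s>], [s]
   being an involution: [Y] is the space of [s]-orbits, with the quotient
   topology, and its holomorphic functions are those that pull back to
   holomorphic functions on [X]. *)
Definition is_involution_quotient (X Y : complex_curve) (s : X -> X)
    (p : X -> Y) : Prop :=
  [/\ forall y, exists x, p x = y,
      forall x x', p x = p x' <-> x' = x \/ x' = s x,
      forall U : set Y, open (p @^-1` U) <-> open U &
      forall (U : set Y) (h : Y -> C), open U ->
        (holomorphic_on U h <-> holomorphic_on (p @^-1` U) (h \o p))].

Definition translation_surface (X : complex_curve) (w : one_form X) : Prop :=
  closed_riemann_surface X /\ nonzero_form w.

(* The coordinates obtained by integrating [w]: injective local primitives of
   [w] off its zeros. *)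
Definition flat_coordinate (X : complex_curve) (w : one_form X)
    (U : set X) (zeta : X -> C) : Prop :=
  [/\ open U, U `<=` ~` form_zeros w,
      forall x y, U x -> U y -> zeta x = zeta y -> x = y &
      forall i x, U x -> chart_dom (curve_chart i) x ->
        is_derive (curve_chart i x) (1 : C)
          (zeta \o chart_inv (curve_chart i)) (w i (curve_chart i x))].

(* The action of a real matrix on the plane, identified with [C]. *)
Definition plane_action (L : 'M[R]_2) (z : C) : C :=
  ((L 0 0 * complex.Re z + L 0 1 * complex.Im z) +i*
   (L 1 0 * complex.Re z + L 1 1 * complex.Im z))%C.

Definition homeomorphism (T : topologicalType) (f : T -> T) : Prop :=
  continuous f /\ exists g : T -> T, [/\ continuous g, cancel f g & cancel g f].

(* The linear part [L] is global; the translation part [c] depends on the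
   coordinates, and is only locally constant since the intersection of [U] with
   the preimage of [V] may be disconnected. *)
Definition affine_map (X : complex_curve) (w : one_form X) (f : X -> X) :
    Prop :=
  [/\ homeomorphism f,
      f @` form_zeros w = form_zeros w &
      exists2 L : 'M[R]_2, L \in unitmx &
        forall (U V : set X) (zeta xi : X -> C),
          flat_coordinate w U zeta -> flat_coordinate w V xi ->
          forall x, U x -> V (f x) ->
            exists c : C, \forall y \near x,
              xi (f y) = plane_action L (zeta y) + c].

Definition periodic_point (X : complex_curve) (w : one_form X) (x : X) : Prop :=
  finite_set [set y | exists2 f, affine_map w f & y = f x].

Definition hyperelliptic_involution (X : complex_curve) (w : one_form X)
    (s : X -> X) : Prop :=
  [/\ holomorphic_map s,
      s \o s = id,
      s <> id,
      affine_map w s &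
      exists p : X -> riemann_sphere, is_involution_quotient s p].

Definition finite_order (T : Type) (f : T -> T) : Prop :=
  exists2 n : nat, (0 < n)%N & forall x, iter n f x = x.

(* The group of bijections of [T] generated by a set [S] of bijections. *)
Inductive generated_group (T : Type) (S : set (T -> T)) : (T -> T) -> Prop :=
| gen_in f : S f -> generated_group S f
| gen_id : generated_group S id
| gen_comp f g :
    generated_group S f -> generated_group S g -> generated_group S (f \o g)
| gen_inv f g : generated_group S f -> cancel f g -> cancel g f ->
    generated_group S g.

Definition generated_by_torsion (X : complex_curve) (w : one_form X) : Prop :=
  forall f, affine_map w f ->
    generated_group [set g | affine_map w g /\ finite_order g] f.

End Curves.

(* Main.v *)
(* The involution [s] acts on holomorphic 1-forms by [-1]: for a form [eta] and
   the quotient map [p], the function [eta / dp + (eta / dp) o s] has removable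
   singularities on [X] and vanishes over infinity, hence is zero.

   If [f] has a pole of order [n <= g] at [x] and no other, choose [eta <> 0]
   vanishing at [x] to order at least [g - 1]. Then
   [(p - p x) (f - f o s) (eta / dp)] has removable singularities and vanishes
   over infinity, so [f = f o s] and [x] is fixed by [s]. If [w] has no zero,
   then [g = 1], [n = 1], and [f = f o s] contradicts [s' x = -1]; so [w] has a
   zero [c].

   The conjugates [tau] of [s] by affine maps are holomorphic involutions with
   [tau^* w = - w]. Such a [tau] is determined by the zero [tau c] of [w] and the
   derivative of [tau] at [c], which is one of finitely many roots. Hence there
   are finitely many conjugates, each has finitely many fixed points, and the
   orbit of [x] consists of such points. *)

Require Import Defs.
From mathcomp Require Import all_boot all_order all_algebra.
From mathcomp Require Import complex ring lra.
From mathcomp Require Import all_classical all_reals all_analysis.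

Set Implicit Arguments.
Unset Strict Implicit.
Unset Printing Implicit Defensive.

Import Order.TTheory GRing.Theory Num.Theory numFieldNormedType.Exports.
Local Open Scope classical_set_scope.
Local Open Scope ring_scope.

(** * Complex differentiability *)

Section Modulus.
Variable R : realType.
Local Notation C := (R[i]^o).

(** The only global tool is Liouville's theorem: on a closed surface, a function that is bounded
    near every point and differentiable off isolated points is constant. It stands in for degrees of
    divisors and Riemann-Roch. It rests on the maximum principle, and so does the removability of
    singularities; Cauchy's formula does not occur. Functions are total, so a meromorphic function
    is described by what holds near each point, this point excluded.

    The order [g - 1] comes from linear algebra: that many Taylor coefficients at [x] impose [g - 1]
    linear conditions on a space of dimension [g]. It suffices because the quotient of [p - p x] by
    [dp] vanishes at [x], which gains the missing order.

    The relation [tau^* w = - w] holds for all conjugates because [-1] is central in [GL_2(R)]: an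
    affine map with linear part [L], holomorphic or not, turns the linear part [-1] of [s] into
    [L (-1) L^-1 = -1]. The roots come from the primitives of [w] at [c] and at [tau c]: [tau] pulls
    the second back to minus the first, and the leading coefficients determine a power of its
    derivative. *)

Definition cabs (z : C) : R := complex.Re (`|z : R[i]|).

Implicit Types (f g : C -> C) (y z a b c d : C).

(** The norm on [R[i]] takes values in [R[i]], where the order is partial; through [cabs] every
    estimate becomes an inequality in [R], within reach of [lra]. *)
Lemma cabsE (z : C) : `|z : R[i]| = (cabs z)%:C%C.
Proof. by have [r _ E] := normc_real z; rewrite /cabs E. Qed.

Lemma cabs_sqrt (z : C) :
  cabs z = Num.sqrt (complex.Re z ^+ 2 + complex.Im z ^+ 2).
Proof. by rewrite /cabs normc_def. Qed.

Lemma cabs_ge0 z : 0 <= cabs z.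
Proof. by rewrite cabs_sqrt sqrtr_ge0. Qed.

Lemma cabsD y z : cabs (y + z) <= cabs y + cabs z.
Proof. by rewrite -lecR rmorphD /= -!cabsE ler_normD. Qed.

Lemma cabsN z : cabs (- z) = cabs z.
Proof. by rewrite /cabs normrN. Qed.

Lemma cabsB y z : cabs (y - z) <= cabs y + cabs z.
Proof. by rewrite -(cabsN z) cabsD. Qed.

Lemma cabs_distC y z : cabs (y - z) = cabs (z - y).
Proof. by rewrite -cabsN opprB. Qed.

Lemma cabsM (y z : C) : cabs (y * z) = cabs y * cabs z.
Proof. by rewrite [LHS]/cabs normrM !cabsE -rmorphM. Qed.

Lemma cabs0 : cabs 0 = 0.
Proof. by rewrite /cabs normr0. Qed.

Lemma cabs1 : cabs 1 = 1.
Proof. by rewrite /cabs normr1. Qed.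

Lemma cabsX (z : C) n : cabs (z ^+ n) = cabs z ^+ n.
Proof. by elim: n => [|n IH]; rewrite ?expr0 ?cabs1 // !exprS cabsM IH. Qed.

Lemma cabs_eq0 (z : C) : (cabs z == 0) = (z == 0).
Proof.
apply/eqP/eqP => [z0|->]; last exact: cabs0.
by apply/normr0_eq0; rewrite cabsE z0.
Qed.

Lemma cabs_gt0 (z : C) : (0 < cabs z) = (z != 0).
Proof. by rewrite lt0r cabs_ge0 andbT cabs_eq0. Qed.

Lemma cabsV (z : C) : cabs z^-1 = (cabs z)^-1.
Proof.
have [->|z0] := eqVneq z 0; first by rewrite invr0 cabs0 invr0.
have c0 : cabs z != 0 by rewrite cabs_eq0.
by apply: (mulfI c0); rewrite -cabsM !divff // cabs1.
Qed.

Lemma cabs_real (r : R) : cabs r%:C%C = `|r|.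
Proof. by rewrite cabs_sqrt /= expr0n addr0 sqrtr_sqr. Qed.

Lemma cabs_Re (z : C) : `|complex.Re z| <= cabs z.
Proof. by rewrite -lecR -cabsE normc_ge_Re. Qed.

Lemma cabs_Im (z : C) : `|complex.Im z| <= cabs z.
Proof.
rewrite cabs_sqrt -sqrtr_sqr ler_sqrt ?lerDr ?sqr_ge0 //.
by rewrite addr_ge0 ?sqr_ge0.
Qed.

Lemma cabs_leReIm (z : C) : cabs z <= `|complex.Re z| + `|complex.Im z|.
Proof.
case: z => a b; rewrite cabs_sqrt /= -(ger0_norm (_ : 0 <= `|a| + `|b|)) ?addr_ge0 //.
rewrite -sqrtr_sqr ler_sqrt ?sqr_ge0 // sqrrD !real_normK ?num_real //.
by rewrite -addrA [_ *+ 2 + _]addrC addrA lerDl mulrn_wge0 ?mulr_ge0.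
Qed.

Lemma cabs_dist a b : cabs a - cabs b <= cabs (a - b).
Proof. by rewrite lerBlDr (le_trans _ (cabsD _ _)) // subrK. Qed.

Lemma cabs_triangle a b c : cabs (a - c) <= cabs (a - b) + cabs (b - c).
Proof. by rewrite (le_trans _ (cabsD _ _)) // addrA subrK. Qed.

Lemma nbhsCP (z : C) (A : set C) :
  nbhs z A <-> exists2 r : R, 0 < r & forall y, cabs (y - z) < r -> A y.
Proof.
split=> [/nbhs_ballP[e /= /complex_pos[r r0 ->]] rA|[r r0 rA]].
  exists r => // y yz; apply: rA; rewrite -ball_normE /= distrC.
  by rewrite cabsE ltcR.
apply/nbhs_ballP; exists r%:C%C; first by rewrite /= ltcR.
by move=> y; rewrite -ball_normE /= distrC cabsE ltcR; exact: rA.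
Qed.

Lemma nearCP (z : C) (P : C -> Prop) :
  (\forall y \near z, P y) <->
  exists2 r : R, 0 < r & forall y, cabs (y - z) < r -> P y.
Proof. exact: nbhsCP. Qed.

Lemma near_cabs (z : C) (r : R) : 0 < r -> \forall y \near z, cabs (y - z) < r.
Proof. by move=> r0; apply/nearCP; exists r. Qed.

Definition ccont (f : C -> C) (z : C) : Prop :=
  forall e : R, 0 < e ->
    exists2 r : R, 0 < r & forall y, cabs (y - z) < r -> cabs (f y - f z) < e.

Lemma continuousCP (f : C -> C) (z : C) : {for z, continuous f} <-> ccont f z.
Proof.
split=> [cf e e0|H A /nbhsCP[e e0 eA]].
  by have /nearCP[r r0 rP] := cf _ (near_cabs (f z) e0); exists r.
have [r r0 rP] := H e e0.
by apply/nbhsCP; exists r => // y /rP; exact: eA.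
Qed.

Lemma ccont_near f g z : (\forall y \near z, f y = g y) -> ccont f z -> ccont g z.
Proof.
move=> fg cf e /cf[r r0 rP]; have fgz := nbhs_singleton fg.
have /nearCP[k k0 kP] := fg.
exists (Num.min r k) => [|y]; first by rewrite lt_min r0.
by rewrite lt_min => /andP[/rP yr /kP <-]; rewrite -fgz.
Qed.

Lemma ccont_cst c z : ccont (fun=> c) z.
Proof. by move=> e e0; exists 1 => // y _; rewrite subrr cabs0. Qed.

Lemma ccont_id z : ccont id z.
Proof. by move=> e e0; exists e. Qed.

Lemma ccontD f g z : ccont f z -> ccont g z -> ccont (fun y => f y + g y) z.
Proof.
move=> cf cg e e0; have e2 : 0 < e / 2 by rewrite divr_gt0.
have [r r0 rP] := cf _ e2; have [k k0 kP] := cg _ e2.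
exists (Num.min r k) => [|y]; first by rewrite lt_min r0.
rewrite lt_min => /andP[/rP yr /kP yk].
by rewrite opprD addrACA (le_lt_trans (cabsD _ _)) //; lra.
Qed.

Lemma ccontM f g z : ccont f z -> ccont g z -> ccont (fun y => f y * g y) z.
Proof.
(* The [+ 1] in [K] pays for the product of the two increments, which is at most [d * 1] because
   [d <= 1]. *)
move=> cf cg e e0; pose K := cabs (f z) + cabs (g z) + 1.
have K0 : 0 < K by rewrite ltr_wpDl ?addr_ge0 ?cabs_ge0.
have d0 : 0 < Num.min 1 (e / (2 * K)).
  by rewrite lt_min ltr01 divr_gt0 ?mulr_gt0.
set d := Num.min _ _ in d0.
have d1 : d <= 1 by rewrite /d ge_min lexx.
have dK : d * K <= e / 2.
  have -> : e / 2 = e / (2 * K) * K by field; rewrite gt_eqF.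
  by rewrite ler_pM2r // /d ge_min lexx orbT.
have [r r0 rP] := cf _ d0; have [k k0 kP] := cg _ d0.
exists (Num.min r k) => [|y]; first by rewrite lt_min r0.
rewrite lt_min => /andP[/rP yr /kP yk].
have -> : f y * g y - f z * g z =
  (f y - f z) * (g y - g z) + (f y - f z) * g z + f z * (g y - g z) by ring.
have fz := cabs_ge0 (f z); have gz := cabs_ge0 (g z).
have fy := cabs_ge0 (f y - f z); have gy := cabs_ge0 (g y - g z).
apply: le_lt_trans (cabsD _ _) _; rewrite cabsM.
apply: (@le_lt_trans _ _ (d * 1 + d * cabs (g z) + cabs (f z) * d)); last first.
  by move: dK; rewrite /K !mulrDr [_ * d]mulrC; lra.
apply: lerD; last by rewrite ler_wpM2l // ltW.
apply: le_trans (cabsD _ _) _; rewrite !cabsM.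
apply: lerD; first by apply: ler_pM => //; [exact: ltW|lra].
by rewrite ler_wpM2r // ltW.
Qed.

Lemma ccont_neq0 f z : ccont f z -> f z != 0 ->
  exists2 r : R, 0 < r &
    forall y, cabs (y - z) < r -> cabs (f z) / 2 < cabs (f y).
Proof.
rewrite -cabs_gt0 => cf f0; have f2 : 0 < cabs (f z) / 2 by rewrite divr_gt0.
have [r r0 rP] := cf _ f2; exists r => // y /rP.
by rewrite cabs_distC; have := cabs_dist (f z) (f y); lra.
Qed.

Lemma near_neq0 f z : ccont f z -> f z != 0 -> \forall y \near z, f y != 0.
Proof.
move=> cf f0; have [r r0 rP] := ccont_neq0 cf f0.
apply/nearCP; exists r => // y /rP; rewrite -cabs_gt0 in f0.
by rewrite -cabs_gt0; lra.
Qed.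

Lemma ccontV f z : ccont f z -> f z != 0 -> ccont (fun y => (f y)^-1) z.
Proof.
move=> cf f0 e e0; have [r r0 rP] := ccont_neq0 cf f0.
have fz : 0 < cabs (f z) by rewrite cabs_gt0.
have d0 : 0 < e * (cabs (f z) ^+ 2 / 2) by rewrite mulr_gt0 ?divr_gt0 ?exprn_gt0.
have [k k0 kP] := cf _ d0.
exists (Num.min r k) => [|y]; first by rewrite lt_min r0.
rewrite lt_min => /andP[/rP yr /kP yk].
have fy : 0 < cabs (f y) by lra.
have fy0 : f y != 0 by rewrite -cabs_gt0.
have -> : (f y)^-1 - (f z)^-1 = - (f y - f z) / (f y * f z).
  by field; rewrite fy0 f0.
rewrite cabsM cabsN cabsV cabsM ltr_pdivrMr ?mulr_gt0 //.
apply: lt_trans yk _; rewrite ltr_pM2l // expr2 mulrAC.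
by rewrite ltr_pM2r.
Qed.

Lemma ccont_comp f g z : ccont g z -> ccont f (g z) -> ccont (fun y => f (g y)) z.
Proof.
move=> cg cf e /cf[d d0 dP]; have [r r0 rP] := cg _ d0.
by exists r => // y /rP/dP.
Qed.

Lemma cabs_continuous : continuous cabs.
Proof.
move=> z A /nbhs_ballP[e /= e0 eA].
apply/nbhsCP; exists e => // y yz; apply: eA; rewrite -ball_normE /=.
have := cabs_dist y z; have := cabs_dist z y.
by rewrite ltr_norml (cabs_distC z y); lra.
Qed.

End Modulus.

(** * Derivatives in Caratheodory's form: rules of computation *)

Section Derivative.
Variable R : realType.
Local Notation C := (R[i]^o).

Implicit Types (f g : C -> C) (z a b c d : C).

(* Caratheodory's form of complex differentiability. *)
Definition cder (f : C -> C) (z d : C) : Prop :=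
  exists phi : C -> C,
    [/\ ccont phi z, phi z = d &
        forall y, f y = f z + phi y * (y - z)].

Lemma cder_derive f z d : cder f z d -> is_derive z 1 f d.
Proof.
move=> [phi [cphi phiz E]].
suff H : (fun h : C => h^-1 *: (f (h *: 1 + z) - f z)) @ 0^' --> d.
  by apply: DeriveDef; [apply/cvg_ex; exists d|exact/cvg_lim].
rewrite -phiz; apply/(@cvgrPdist_lt _ (C : normedModType R[i])) => e /complex_pos[r r0 ->].
have [k k0 kP] := cphi r r0.
apply/nearCP; exists k => // h; rewrite subr0 => hk h0.
rewrite E scaler1 [X in X *: _]/= addrK [f z + _]addrC addrK.
rewrite /GRing.scale /= mulrC mulfK // distrC cabsE ltcR.
by apply: kP; rewrite addrK.
Qed.

Lemma cder_quotient f z d :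
  ccont (fun y => if y == z then d else (f y - f z) / (y - z)) z -> cder f z d.
Proof.
exists (fun y => if y == z then d else (f y - f z) / (y - z)).
rewrite eqxx; split=> // y.
case: eqP => [->|/eqP yz]; first by rewrite subrr mulr0 addr0.
by rewrite mulfVK ?subr_eq0 // addrC subrK.
Qed.

Lemma derivable_cder f z : derivable f z 1 -> cder f z (derive1 f z).
Proof.
move=> df.
apply: cder_quotient => e e0; rewrite eqxx.
move: df => /(@cvgrPdist_lt _ (C : normedModType R[i]))/(_ e%:C%C).
rewrite ltcR => /(_ e0)/nearCP[r r0 rP].
exists r => // y yr; case: eqP => [_|/eqP yz]; first by rewrite subrr cabs0.
have := rP (y - z); rewrite subr0 => /(_ yr); rewrite subr_eq0 => /(_ yz) /=.
rewrite scaler1 subrK distrC cabsE ltcR derive1E /derive /GRing.scale /=.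
by rewrite mulrC.
Qed.

Lemma cderP f z d : cder f z d <-> is_derive z 1 f d.
Proof.
split=> [|df]; first exact: cder_derive.
by have := derivable_cder (@ex_derive _ _ _ _ _ _ _ df); rewrite derive1E derive_val.
Qed.

Lemma cder_derivable f z d : cder f z d -> derivable f z 1.
Proof. by move/cder_derive/(@ex_derive _ _ _ _ _ _ _). Qed.

Lemma cder_derive1 f z d : cder f z d -> derive1 f z = d.
Proof. by move/cder_derive => df; rewrite derive1E derive_val. Qed.

(* [derive1], opaque: unfolding the limit that defines it makes conversion
   diverge. *)
Fact dz_subproof : {dz : (C -> C) -> C -> C | dz = @derive1 R[i] C}.
Proof. by exists (@derive1 R[i] C). Qed.

Definition dz : (C -> C) -> C -> C := sval dz_subproof.

Lemma dzE f z : dz f z = derive1 f z.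
Proof. by rewrite /dz (svalP dz_subproof). Qed.

Lemma derivable_dz f z : derivable f z 1 -> cder f z (dz f z).
Proof. by rewrite dzE; exact: derivable_cder. Qed.

Lemma cder_dz f z d : cder f z d -> dz f z = d.
Proof. by rewrite dzE; exact: cder_derive1. Qed.

Lemma cder_uniq f z d d' : cder f z d -> cder f z d' -> d = d'.
Proof. by move=> /cder_derive1 <- /cder_derive1. Qed.

Lemma cderCP f z d : cder f z d <->
  forall e : R, 0 < e -> exists2 r : R, 0 < r &
    forall y, cabs (y - z) < r ->
      cabs (f y - f z - d * (y - z)) <= e * cabs (y - z).
Proof.
split=> [[phi [cphi <- E]] e e0|H].
  have [r r0 rP] := cphi e e0; exists r => // y yr.
  rewrite {1}E [f z + _]addrC addrK -mulrBl cabsM ler_wpM2r ?cabs_ge0 //.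
  exact/ltW/rP.
apply: cder_quotient => e e0; rewrite eqxx.
have [|r r0 rP] := H (e / 2); first by rewrite divr_gt0.
exists r => // y yr; case: eqP => [_|/eqP yz]; first by rewrite subrr cabs0.
have yz0 : y - z != 0 by rewrite subr_eq0.
have yz1 : 0 < cabs (y - z) by rewrite cabs_gt0.
rewrite -(ltr_pM2r yz1) -cabsM mulrBl mulfVK //.
apply: le_lt_trans (rP _ yr) _; rewrite ltr_pM2r //; lra.
Qed.

Lemma cder_cont f z d : cder f z d -> ccont f z.
Proof.
move=> [phi [cphi _ E]].
rewrite (_ : f = fun y => f z + phi y * (y - z)); last by apply/funext.
apply: ccontD; first exact: ccont_cst.
apply: ccontM => //.
by apply: ccontD; [exact: ccont_id|exact: ccont_cst].
Qed.

Lemma near_cder f g z d :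
  (\forall y \near z, f y = g y) -> cder f z d -> cder g z d.
Proof.
move=> fg /cderCP H; apply/cderCP => e /H[r r0 rP].
have fgz : f z = g z := nbhs_singleton fg.
have /nearCP[k k0 kP] := fg.
exists (Num.min r k) => [|y]; first by rewrite lt_min r0.
by rewrite lt_min => /andP[/rP yr /kP <-]; rewrite -fgz.
Qed.

Lemma cder_cst (c z : C) : cder (fun=> c) z 0.
Proof.
exists (fun=> 0); split => //; first exact: ccont_cst.
by move=> y; rewrite mul0r addr0.
Qed.

Lemma cder_id z : cder id z 1.
Proof.
exists (fun=> 1); split => //; first exact: ccont_cst.
by move=> y; rewrite mul1r addrC subrK.
Qed.

Lemma cderD f g z a b : cder f z a -> cder g z b -> cder (fun y => f y + g y) z (a + b).
Proof.
move=> [p [cp <- fE]] [q [cq <- gE]]; exists (fun y => p y + q y); split=> //.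
  exact: ccontD.
by move=> y; rewrite (fE y) (gE y); ring.
Qed.

Lemma cderM f g z a b : cder f z a -> cder g z b ->
  cder (fun y => f y * g y) z (a * g z + f z * b).
Proof.
move=> df dg; have cg := cder_cont dg.
move: df dg => [p [cp <- fE]] [q [cq <- gE]].
exists (fun y => p y * g y + f z * q y); split=> //.
  by apply: ccontD; apply: ccontM => //; exact: ccont_cst.
by move=> y; rewrite (fE y) (gE y); ring.
Qed.

Lemma cderZ c f z a : cder f z a -> cder (fun y => c * f y) z (c * a).
Proof.
by move=> df; have := cderM (cder_cst c z) df; rewrite mul0r add0r.
Qed.

Lemma cderN f z a : cder f z a -> cder (fun y => - f y) z (- a).
Proof.
move=> /(cderZ (-1)); rewrite mulN1r; apply: near_cder.
by near=> y; rewrite mulN1r.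
Unshelve. all: by end_near. Qed.

Lemma cderB f g z a b : cder f z a -> cder g z b -> cder (fun y => f y - g y) z (a - b).
Proof. by move=> df /cderN; exact: cderD. Qed.

Lemma cderV f z a : f z != 0 -> cder f z a ->
  cder (fun y => (f y)^-1) z (- a / f z ^+ 2).
Proof.
move=> f0 df; have cf := cder_cont df; move: df => [p [cp <- fE]].
have nf0 := near_neq0 cf f0.
(* Caratheodory's identity is required at every [y], also where [f] vanishes. There the inverse is
   replaced by the value that the identity prescribes. *)
apply: (@near_cder (fun y => if f y == 0 then (f z)^-1 - p y / f z ^+ 2 * (y - z) else (f y)^-1)).
  by apply: filterS nf0 => y /negPf ->.
exists (fun y => if f y == 0 then - p y / f z ^+ 2 else - p y / (f y * f z)).
rewrite (negPf f0); split => [||y] //; last first.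
  case: ifPn => [_|fy0]; first by field.
  have fE' : f y - f z = p y * (y - z) by rewrite (fE y) [f z + _]addrC addrK.
  have -> : (f y)^-1 = (f z)^-1 - (f y - f z) / (f y * f z) by field; rewrite fy0 f0.
  by rewrite fE'; field; rewrite fy0 f0.
have H : ccont (fun y => - p y / (f y * f z)) z.
  apply: ccontM; last first.
    apply: ccontV; last by rewrite mulf_neq0.
    by apply: ccontM => //; exact: ccont_cst.
  apply: ccont_near (ccontM (ccont_cst (-1) z) cp).
  by near=> y; rewrite mulN1r.
move=> e /H[r r0 rP]; have /nearCP[k k0 kP] := nf0.
exists (Num.min r k) => [|y]; first by rewrite lt_min r0.
by rewrite lt_min => /andP[/rP yr /kP/negPf ->]; rewrite (negPf f0).
Unshelve. all: by end_near. Qed.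

Lemma cder_comp f g z a b : cder g z b -> cder f (g z) a ->
  cder (fun y => f (g y)) z (a * b).
Proof.
move=> dg df; have cg := cder_cont dg.
move: df dg => [p [cp <- fE]] [q [cq <- gE]].
exists (fun y => p (g y) * q y); split=> // [|y].
  by apply: ccontM => //; exact: ccont_comp.
have gE' : g y - g z = q y * (y - z) by rewrite (gE y) [g z + _]addrC addrK.
by rewrite (fE (g y)) gE' mulrA.
Qed.

Lemma cderX f z a n : cder f z a ->
  cder (fun y => f y ^+ n) z (n%:R * f z ^+ n.-1 * a).
Proof.
move=> df; elim: n => [|n IH].
  by rewrite !mul0r; apply: near_cder (cder_cst 1 z); near=> y; rewrite expr0.
apply: (@near_cder (fun y => f y * f y ^+ n)).
  by near=> y; rewrite exprS.
have := cderM df IH; congr cder.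
case: n {IH} => [|n]; first by rewrite expr0 !mul0r mulr0; ring.
by rewrite /= exprS -[n.+2]addn1 natrD; ring.
Unshelve. all: by end_near. Qed.

(* No derivative of [g] is assumed: this yields the differentiability of
   continuous solutions of [f (g y) = h y]. *)
Lemma cder_lift f g z a b : ccont g z -> cder f (g z) a -> a != 0 ->
  cder (fun y => f (g y)) z b -> cder g z (b / a).
Proof.
move=> cg [p [cp pa fE]] a0 [q [cq qb hE]].
have cpg : ccont (fun y => p (g y)) z by exact: ccont_comp.
have pgz : p (g z) != 0 by rewrite pa.
have npg := near_neq0 cpg pgz.
have H : ccont (fun y => q y / p (g y)) z by apply: ccontM => //; exact: ccontV.
apply: (@near_cder (fun y => g z + q y / p (g y) * (y - z))).
  apply: filterS npg => y pg0.
  have := hE y; rewrite (fE (g y)) => /addrI E.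
  by rewrite mulrAC -E mulrAC divff // mul1r addrC subrK.
exists (fun y => q y / p (g y)); split => //=; first by rewrite pa qb.
by move=> y; rewrite subrr mulr0 addr0.
Qed.

End Derivative.

(** * Integration along segments and Goursat's theorem *)

Section Paths.
Variable R : realType.
Local Notation C := (R[i]^o).
Implicit Types (f g : C -> C) (y z a b c d : C) (p q : R -> C) (s t : R).

Lemma cReB a b : complex.Re (a - b) = complex.Re a - complex.Re b.
Proof. by case: a b => [? ?] [? ?]. Qed.

Lemma cReD a b : complex.Re (a + b) = complex.Re a + complex.Re b.
Proof. by case: a b => [? ?] [? ?]. Qed.

Lemma cImB a b : complex.Im (a - b) = complex.Im a - complex.Im b.
Proof. by case: a b => [? ?] [? ?]. Qed.

Lemma cReMr a (r : R) : complex.Re (a * r%:C%C) = complex.Re a * r.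
Proof. by case: a => u v; rewrite /= mulr0 subr0. Qed.

Lemma cImMr a (r : R) : complex.Im (a * r%:C%C) = complex.Im a * r.
Proof. by case: a => u v; rewrite /= mulr0 add0r. Qed.

Lemma real_derive (f : R -> R) (t d : R) :
  is_derive t 1 f d <->
  forall e : R, 0 < e -> exists2 r : R, 0 < r &
    forall h, `|h| < r -> `|f (t + h) - f t - d * h| <= e * `|h|.
Proof.
split=> [[df Ed] e e0|H].
  move: df => /cvg_ex[l fl]; have ld : l = d by rewrite -Ed; apply/esym/cvg_lim.
  move/cvgrPdist_lt : fl => /(_ e e0); rewrite ld => -[r /= r0 rP].
  exists r => // h hr; have [->|h0] := eqVneq h 0.
    by rewrite addr0 mulr0 subrr subr0 normr0 mulr0.
  have := rP h; rewrite /= sub0r normrN => /(_ hr h0).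
  rewrite /GRing.scale /= mulr1 => /ltW.
  rewrite -(ler_pM2r (_ : 0 < `|h|)) ?normr_gt0 // -normrM => H; apply: le_trans H.
  by rewrite mulrBl mulrAC mulVf // mul1r distrC [h + t]addrC.
suff fl : (fun h : R => h^-1 *: (f (h *: 1 + t) - f t)) @ 0^' --> d.
  by apply: DeriveDef; [apply/cvg_ex; exists d|exact/cvg_lim].
apply/cvgrPdist_lt => e e0; have e2 : 0 < e / 2 by rewrite divr_gt0.
have [r r0 rP] := H _ e2; exists r => //= h; rewrite /ball_ /= sub0r normrN => hr h0.
have nh : 0 < `|h| by rewrite normr_gt0.
rewrite /GRing.scale /= mulr1 -(ltr_pM2r nh) -normrM mulrBl mulrAC mulVf // mul1r.
rewrite distrC [h + t]addrC; apply: le_lt_trans (rP _ hr) _.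
by rewrite ltr_pM2r //; lra.
Qed.

(** The derivative of a path, spelled out as an estimate: the normed space [R[i]^o] has complex
    scalars, while the variable is real. *)
Definition rder p t d : Prop :=
  forall e : R, 0 < e -> exists2 r : R, 0 < r &
    forall h : R, `|h| < r -> cabs (p (t + h) - p t - d * h%:C%C) <= e * `|h|.

Lemma rder_Re p t d : rder p t d -> is_derive t 1 (fun s => complex.Re (p s)) (complex.Re d).
Proof.
move=> H; apply/real_derive => e /H[r r0 rP]; exists r => // h /rP; apply: le_trans.
by apply: le_trans (cabs_Re _); rewrite !cReB cReMr.
Qed.

Lemma rderP p t d : is_derive t 1 (fun s => complex.Re (p s)) (complex.Re d) ->
  is_derive t 1 (fun s => complex.Im (p s)) (complex.Im d) -> rder p t d.
Proof.
move=> /real_derive H1 /real_derive H2 e e0; have e2 : 0 < e / 2 by rewrite divr_gt0.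
have [r r0 rP] := H1 _ e2; have [k k0 kP] := H2 _ e2.
exists (Num.min r k) => [|h]; first by rewrite lt_min r0.
rewrite lt_min => /andP[/rP hr /kP hk]; apply: le_trans (cabs_leReIm _) _.
have -> : e * `|h| = e / 2 * `|h| + e / 2 * `|h| by lra.
apply: lerD; [move: hr|move: hk]; apply: le_trans.
  by rewrite !cReB cReMr.
by rewrite !cImB cImMr.
Qed.

Lemma rderZ c p t d : rder p t d -> rder (fun s => c * p s) t (c * d).
Proof.
move=> H e e0; have c1 : 0 < cabs c + 1 by rewrite ltr_wpDl ?cabs_ge0.
have [|r r0 rP] := H (e / (cabs c + 1)); first by rewrite divr_gt0.
exists r => // h /rP H1; rewrite -mulrA -!mulrBr cabsM.
apply: le_trans (ler_wpM2l (cabs_ge0 _) H1) _; rewrite mulrA ler_wpM2r //.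
by rewrite mulrCA ler_piMr ?(ltW e0) // ler_pdivrMr // mul1r lerDl.
Qed.

Lemma rderB p q t c d : rder p t c -> rder q t d -> rder (fun s => p s - q s) t (c - d).
Proof.
move=> H1 H2 e e0; have e2 : 0 < e / 2 by rewrite divr_gt0.
have [r r0 rP] := H1 _ e2; have [k k0 kP] := H2 _ e2.
exists (Num.min r k) => [|h]; first by rewrite lt_min r0.
rewrite lt_min => /andP[/rP hr /kP hk].
have -> : p (t + h) - q (t + h) - (p t - q t) - (c - d) * h%:C%C =
   (p (t + h) - p t - c * h%:C%C) - (q (t + h) - q t - d * h%:C%C) by ring.
by apply: le_trans (cabsB _ _) _; lra.
Qed.

Lemma rder_affine p (u v : R) t d : rder p (u + v * t) d ->
  rder (fun s => p (u + v * s)) t (v%:C%C * d).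
Proof.
move=> H e e0; have v1 : 0 < `|v| + 1 by rewrite ltr_wpDl.
have [|r r0 rP] := H (e / (`|v| + 1)); first by rewrite divr_gt0.
exists (r / (`|v| + 1)) => [|h hr]; first by rewrite divr_gt0.
have vh : `|v * h| < r.
  move: hr; rewrite ltr_pdivlMr // normrM; apply: le_lt_trans.
  by rewrite mulrC ler_wpM2l // lerDl.
have := rP _ vh; rewrite rmorphM /= => H'.
rewrite mulrDr addrA [v%:C%C * d]mulrC -mulrA; apply: le_trans H' _.
rewrite normrM mulrA ler_wpM2r //.
by rewrite mulrAC -mulrA ler_piMr ?(ltW e0) // ler_pdivrMr // mul1r lerDl.
Qed.

Lemma rder_comp f p t d c : rder p t d -> cder f (p t) c ->
  rder (fun s => f (p s)) t (c * d).
Proof.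
move=> H /cderCP Hf e e0; pose K := cabs d + cabs c + 1.
have K0 : 0 < K by rewrite ltr_wpDl ?addr_ge0 ?cabs_ge0.
have d0 := cabs_ge0 d; have c0 := cabs_ge0 c.
pose e1 := Num.min 1 (e / (2 * K)).
have e10 : 0 < e1 by rewrite lt_min ltr01 divr_gt0 ?mulr_gt0.
have e11 : e1 <= 1 by rewrite ge_min lexx.
have e1K : e1 * K <= e / 2.
  have -> : e / 2 = e / (2 * K) * K by field; rewrite gt_eqF.
  by rewrite ler_pM2r // /e1 ge_min lexx orbT.
have [r r0 rP] := H _ e10; have [k k0 kP] := Hf _ e10.
exists (Num.min r (k / (K + 1))) => [|h].
  by rewrite lt_min r0 divr_gt0 // addr_gt0.
rewrite lt_min => /andP[/rP hr hk].
have pK : cabs (p (t + h) - p t) <= K * `|h|.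
  rewrite -(subrK (d * h%:C%C) (p (t + h) - p t)).
  apply: le_trans (cabsD _ _) _; rewrite cabsM cabs_real.
  have : e1 * `|h| <= 1 * `|h| by rewrite ler_wpM2r.
  rewrite /K !mulrDl; have : 0 <= cabs c * `|h| by rewrite mulr_ge0.
  lra.
have pk : cabs (p (t + h) - p t) < k.
  have K1 : 0 < K + 1 by rewrite addr_gt0.
  apply: le_lt_trans pK _; move: hk; rewrite ltr_pdivlMr //.
  by apply: le_lt_trans; rewrite mulrC ler_wpM2l // lerDl.
have -> : f (p (t + h)) - f (p t) - c * d * h%:C%C =
  (f (p (t + h)) - f (p t) - c * (p (t + h) - p t)) +
  c * (p (t + h) - p t - d * h%:C%C) by ring.
apply: le_trans (cabsD _ _) _; rewrite cabsM.
apply: (@le_trans _ _ (e1 * (K * `|h|) + K * (e1 * `|h|))).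
  apply: lerD; first by apply: le_trans (kP _ pk) _; rewrite ler_wpM2l // ltW.
  by apply: ler_pM; rewrite ?cabs_ge0 // /K; lra.
rewrite mulrA [K * _]mulrA [K * e1]mulrC -mulrDl ler_wpM2r //; lra.
Qed.

Lemma rder_line a b t : rder (fun s => a + s%:C%C * b) t b.
Proof.
move=> e e0; exists 1 => // h _.
rewrite rmorphD /=.
have -> : a + (t%:C%C + h%:C%C) * b - (a + t%:C%C * b) - b * h%:C%C = 0 by ring.
by rewrite cabs0 mulr_ge0 // ltW.
Qed.

Lemma Re_conj_mul (z : C) : complex.Re (z^*%C * z : C) = cabs z ^+ 2.
Proof.
rewrite cabs_sqrt sqr_sqrtr ?addr_ge0 ?sqr_ge0 //.
by case: z => u v; simpc => /=; rewrite !expr2.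
Qed.

Lemma cabsJ (z : C) : cabs (z^*%C) = cabs z.
Proof. by rewrite /cabs normcJ. Qed.

(** The mean value theorem with equality holds for real functions only. It is applied to
    [Re (v^* p)] with [v = p 1 - p 0], whose increment is [|v|^2] and whose derivative is at most
    [|v| M]. *)
Lemma mean_value p (dp : R -> C) (M : R) :
  (forall t, 0 <= t <= 1 -> rder p t (dp t)) ->
  (forall t, 0 <= t <= 1 -> cabs (dp t) <= M) ->
  cabs (p 1 - p 0) <= M.
Proof.
move=> dpP dpM; have M0 : 0 <= M.
  by apply: le_trans (cabs_ge0 (dp 0)) _; apply: dpM; rewrite lexx ler01.
pose v := p 1 - p 0.
have D t : 0 <= t <= 1 -> is_derive t 1 (fun s => complex.Re (v^*%C * p s : C))
    (complex.Re (v^*%C * dp t : C)).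
  by move=> /dpP H; apply: rder_Re; exact: rderZ.
have [||c c01 E] := @MVT_segment R (fun s => complex.Re (v^*%C * p s : C)) (fun t => complex.Re (v^*%C * dp t : C)) 0 1 ler01.
- by move=> t; rewrite in_itv /= => /andP[t0 t1]; apply: D; rewrite !ltW.
- apply: derivable_within_continuous => t; rewrite in_itv /= => t01.
  by have := D t t01 => /(@ex_derive _ _ _ _ _ _ _).
rewrite -/v; have [->|v0] := eqVneq v 0; first by rewrite cabs0.
have v1 : 0 < cabs v by rewrite cabs_gt0.
rewrite -(ler_pM2l v1) -expr2 -Re_conj_mul {2}/v mulrBr cReB E subr0 mulr1.
apply: le_trans (ler_norm _) _; apply: le_trans (cabs_Re _) _.
by rewrite cabsM cabsJ ler_wpM2l ?cabs_ge0 // dpM //; move: c01; rewrite in_itv.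
Qed.

Lemma real_primitive (f : R -> R) : continuous f ->
  exists F : R -> R, forall t : R, 0 <= t <= 1 -> is_derive t 1 F (f t).
Proof.
(* The integral starts at [-1], so that [0] is an interior point and the derivative is two-sided on
   the whole of [[0, 1]]. *)
move=> cf; exists (fun x => \int[lebesgue_measure]_(t in `[-1, x]) f t)%R => t t01.
have [||||df E] := @continuous_FTC1 R f (BLeft (-1)) t 2.
- lra.
- apply: continuous_compact_integrable; first exact: segment_compact.
  by apply: continuous_subspaceT => x; exact: cf.
- by rewrite lte_fin; lra.
- exact: cf.
apply: (DeriveDef df); rewrite -derive1E; exact: E.
Qed.

End Paths.

(** * Integrals along segments as increments of primitives *)

Section SegmentIntegral.
Variable R : realType.
Local Notation C := (R[i]^o).
Implicit Types (f g : C -> C) (x y z a b c d : C) (p q : R -> C) (s t : R).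

Definition pt a b t : C := a + t%:C%C * (b - a).

Lemma pt0 a b : pt a b 0 = a.
Proof. by rewrite /pt mul0r addr0. Qed.

Lemma pt1 a b : pt a b 1 = b.
Proof. by rewrite /pt mul1r addrC subrK. Qed.

Lemma rder_pt a b t : rder (pt a b) t (b - a).
Proof. exact: rder_line. Qed.

(** The integral over the segment is the increment of any primitive of the pulled-back integrand.
    This avoids complex-valued integration: uniqueness is the mean value inequality, and existence
    comes from the real and imaginary parts. *)
Definition segint f a b (v : C) : Prop :=
  exists2 p, forall t, 0 <= t <= 1 -> rder p t ((b - a) * f (pt a b t)) &
    v = p 1 - p 0.

Definition J f a b : C := xget 0 [set v | segint f a b v].

Lemma segint_uniq f a b v v' : segint f a b v -> segint f a b v' -> v = v'.
Proof.
move=> [p dp ->] [q dq ->]; apply/eqP; rewrite -subr_eq0 -cabs_eq0.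
rewrite eq_le cabs_ge0 andbT.
have -> : p 1 - p 0 - (q 1 - q 0) = (p 1 - q 1) - (p 0 - q 0) by ring.
apply: (@mean_value R (fun s => p s - q s)
  (fun t => (b - a) * f (pt a b t) - (b - a) * f (pt a b t))).
  by move=> t t01; apply: rderB; [exact: dp|exact: dq].
by move=> t _; rewrite subrr cabs0.
Qed.

Lemma segint_J f a b v : segint f a b v -> J f a b = v.
Proof.
move=> H; apply: (@segint_uniq f a b) => //.
exact: (@xgetPex _ 0 [set v | segint f a b v]) (ex_intro _ v H).
Qed.

Definition segcont f a b := forall t, 0 <= t <= 1 -> ccont f (pt a b t).

Lemma real_continuous (h : R -> R) :
  (forall t e, 0 < e -> exists2 r : R, 0 < r &
    forall s, `|s - t| < r -> `|h s - h t| < e) -> continuous h.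
Proof.
move=> H t A /nbhs_ballP[e /= e0 eA]; have [r r0 rP] := H t e e0.
apply/nbhs_ballP; exists r => // s; rewrite /ball /= => st; apply: eA.
by rewrite /ball /= distrC; apply: rP; rewrite distrC.
Qed.

Lemma segint_ex f a b : segcont f a b -> segint f a b (J f a b).
Proof.
move=> cf; suff [v vP] : exists v, segint f a b v.
  exact: (@xgetPex _ 0 [set v | segint f a b v]) (ex_intro _ v vP).
(* [k] clamps the parameter to [[0, 1]]: [real_primitive] asks for an integrand that is continuous
   on all of [R], while [f] is controlled on the segment only. *)
pose k t : R := Num.max 0 (Num.min 1 t).
have k01 t : 0 <= k t <= 1.
  by rewrite /k le_max lexx /= ge_max ler01 /= ge_min lexx.
have kE t : 0 <= t <= 1 -> k t = t.
  by move=> /andP[t0 t1]; rewrite /k (min_idPr t1) (max_idPr t0).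
have kL s t : `|k s - k t| <= `|s - t|.
  rewrite ler_norml; have := ler_norm (s - t); have := ler_norm (- (s - t)).
  rewrite normrN /k; move: `|s - t| => n; rewrite !maxEle !minEle.
  by do !case: ifPn; rewrite -?ltNge; lra.
pose g t : C := (b - a) * f (pt a b (k t)).
have cg t e : 0 < e -> exists2 r : R, 0 < r & forall s, `|s - t| < r -> cabs (g s - g t) < e.
  move=> e0; have cg' : ccont (fun z => (b - a) * f z) (pt a b (k t)).
    by apply: ccontM; [exact: ccont_cst|exact: cf].
  have [r r0 rP] := cg' _ e0.
  have K0 : 0 < cabs (b - a) + 1 by rewrite ltr_wpDl ?cabs_ge0.
  exists (r / (cabs (b - a) + 1)) => [|s st]; first by rewrite divr_gt0.
  apply: rP; have -> : pt a b (k s) - pt a b (k t) = (k s - k t)%:C%C * (b - a).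
    by rewrite /pt rmorphB /=; ring.
  rewrite cabsM cabs_real; move: st; rewrite ltr_pdivlMr //; apply: le_lt_trans.
  by apply: ler_pM; rewrite ?cabs_ge0 // lerDl.
have [|F dF] := @real_primitive R (fun t => complex.Re (g t)).
  apply: real_continuous => t e /(cg t)[r r0 rP]; exists r => // s /rP.
  by apply: le_lt_trans; rewrite -cReB cabs_Re.
have [|G dG] := @real_primitive R (fun t => complex.Im (g t)).
  apply: real_continuous => t e /(cg t)[r r0 rP]; exists r => // s /rP.
  by apply: le_lt_trans; rewrite -cImB cabs_Im.
exists ((F 1 +i* G 1)%C - (F 0 +i* G 0)%C); exists (fun t => (F t +i* G t)%C) => // t t01.
by apply: rderP => /=; rewrite -{2}(kE t t01); [exact: dF|exact: dG].
Qed.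

(** If [l] is close to [f], the integral of [f] is close to the increment of a primitive [L] of [l].
    Such increments cancel around a triangle, so that only the error term survives in [goursat]. *)
Lemma J_approx f (L l : C -> C) a b (M : R) : segcont f a b ->
  (forall t, 0 <= t <= 1 -> cder L (pt a b t) (l (pt a b t))) ->
  (forall t, 0 <= t <= 1 -> cabs (f (pt a b t) - l (pt a b t)) <= M) ->
  cabs (J f a b - (L b - L a)) <= M * cabs (b - a).
Proof.
move=> /segint_ex[p dp ->] dL fM.
have -> : p 1 - p 0 - (L b - L a) = (p 1 - L (pt a b 1)) - (p 0 - L (pt a b 0)).
  by rewrite pt0 pt1; ring.
apply: (@mean_value R (fun s => p s - L (pt a b s))
  (fun t => (b - a) * f (pt a b t) - l (pt a b t) * (b - a))).
  by move=> t t01; apply: rderB; [exact: dp|apply: rder_comp; [exact: rder_pt|exact: dL]].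
move=> t t01; rewrite [(b - a) * _]mulrC -mulrBl cabsM.
by rewrite ler_wpM2r ?cabs_ge0 // fM.
Qed.

Lemma J_bound f a b (M : R) : segcont f a b ->
  (forall t, 0 <= t <= 1 -> cabs (f (pt a b t)) <= M) ->
  cabs (J f a b) <= M * cabs (b - a).
Proof.
move=> cf fM.
have := @J_approx f (fun=> 0) (fun=> 0) a b M cf (fun t _ => @cder_cst R 0 _).
by rewrite subrr subr0; apply => t /fM; rewrite subr0.
Qed.

Lemma J_split f a b s : segcont f a b -> 0 <= s <= 1 ->
  J f a b = J f a (pt a b s) + J f (pt a b s) b.
Proof.
move=> /segint_ex[p dp ->] s01.
have -> : J f a (pt a b s) = p s - p 0.
  apply: segint_J; exists (fun t => p (0 + s * t)) => [t t01|]; last by rewrite mulr1 mulr0 !add0r.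
  have st : 0 <= 0 + s * t <= 1.
    rewrite add0r; case/andP: s01 => s0 s1; case/andP: t01 => t0 t1.
    by rewrite mulr_ge0 // mulr_ile1.
  have E : pt a (pt a b s) t = pt a b (0 + s * t).
    by rewrite /pt add0r rmorphM /=; ring.
  have -> : pt a b s - a = s%:C%C * (b - a) by rewrite /pt; ring.
  by rewrite E -mulrA; apply: rder_affine; exact: dp.
have -> : J f (pt a b s) b = p 1 - p s.
  apply: segint_J; exists (fun t => p (s + (1 - s) * t)) => [t t01|]; last first.
    by rewrite mulr1 mulr0 addr0 [s + _]addrC subrK.
  have st : 0 <= s + (1 - s) * t <= 1.
    case/andP: s01 => s0 s1; case/andP: t01 => t0 t1.
    rewrite addr_ge0 ?mulr_ge0 ?subr_ge0 //=.
    have : (1 - s) * t <= 1 - s by rewrite ler_piMr ?subr_ge0.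
    by lra.
  have E : pt (pt a b s) b t = pt a b (s + (1 - s) * t).
    by rewrite /pt rmorphD rmorphM rmorphB /=; ring.
  have -> : b - pt a b s = (1 - s)%:C%C * (b - a) by rewrite /pt rmorphB /=; ring.
  by rewrite E -mulrA; apply: rder_affine; exact: dp.
ring.
Qed.

Lemma J_rev f a b : segcont f a b -> J f b a = - J f a b.
Proof.
move=> /segint_ex[p dp ->]; apply: segint_J.
exists (fun t => p (1 + (-1) * t)) => [t t01|]; last first.
  by rewrite mulr1 mulr0 addr0 subrr opprB.
have st : 0 <= 1 + (-1) * t <= 1 by move: t01; lra.
have E : pt b a t = pt a b (1 + (-1) * t).
  by rewrite /pt rmorphD rmorphM rmorphN /=; ring.
have -> : a - b = (-1)%:C%C * (b - a) by rewrite rmorphN /=; ring.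
by rewrite E -mulrA; apply: rder_affine; exact: dp.
Qed.

Lemma pt_le x y z0 (m : R) t : cabs (x - z0) <= m -> cabs (y - z0) <= m ->
  0 <= t <= 1 -> cabs (pt x y t - z0) <= m.
Proof.
move=> xm ym /andP[t0 t1].
have -> : pt x y t - z0 = (1 - t)%:C%C * (x - z0) + t%:C%C * (y - z0).
  by rewrite /pt rmorphB /=; ring.
apply: le_trans (cabsD _ _) _; rewrite !cabsM !cabs_real !ger0_norm ?subr_ge0 //.
have -> : m = (1 - t) * m + t * m by ring.
by apply: lerD; apply: ler_wpM2l; rewrite ?subr_ge0.
Qed.

Lemma pt_lt x y z0 (m : R) t : cabs (x - z0) < m -> cabs (y - z0) < m ->
  0 <= t <= 1 -> cabs (pt x y t - z0) < m.
Proof.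
move=> xm ym t01; apply: (@le_lt_trans _ _ (Num.max (cabs (x - z0)) (cabs (y - z0)))).
  by apply: pt_le; rewrite // le_max lexx ?orbT.
by rewrite gt_max xm.
Qed.

End SegmentIntegral.

(** * Goursat's theorem by subdivision of triangles *)

Section Goursat.
Variable R : realType.
Local Notation C := (R[i]^o).
Implicit Types (f g : C -> C) (y z a b c d : C) (s t : R).

(** The increments from index [n] on sum to at most [2 * K * 2^-1 ^+ n]. Moving [u n] down and up by
    this amount gives nested intervals, and the limit is the supremum of their left ends. *)
Lemma geometric_cauchy (u : nat -> R) (K : R) :
  (forall n, `|u n.+1 - u n| <= K * 2^-1 ^+ n) ->
  exists l, forall n, `|u n - l| <= 2 * K * 2^-1 ^+ n.
Proof.
move=> uK; pose w n := u n - 2 * K * 2^-1 ^+ n; pose v n := u n + 2 * K * 2^-1 ^+ n.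
have uK' n : - (K * 2^-1 ^+ n) <= u n.+1 - u n <= K * 2^-1 ^+ n by rewrite -ler_norml.
have w1 n : w n <= w n.+1 by rewrite /w exprS; have := uK' n; lra.
have v1 n : v n.+1 <= v n by rewrite /v exprS; have := uK' n; lra.
have wm n k : w n <= w (n + k)%N.
  by elim: k => [|k IH]; rewrite ?addn0 // addnS (le_trans IH).
have vm n k : v (n + k)%N <= v n.
  by elim: k => [|k IH]; rewrite ?addn0 // addnS (le_trans _ IH).
have wv0 n : w n <= v n.
  have K0 : 0 <= K * 2^-1 ^+ n by apply: le_trans (uK n).
  by rewrite /w /v; lra.
have wv n m : w n <= v m.
  by apply: le_trans (wm n m) _; apply: le_trans (wv0 _) _; rewrite addnC; exact: vm.
have hs : has_sup (range w).
  by split; [exists (w 0%N), 0%N|exists (v 0%N) => _ [n _ <-]].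
exists (sup (range w)) => n.
have l1 : w n <= sup (range w) by apply: sup_upper_bound => //; exists n.
have l2 : sup (range w) <= v n.
  by apply: ge_sup; [exists (w 0%N), 0%N|move=> _ [m _ <-]].
by move: l1 l2; rewrite ler_norml /w /v; lra.
Qed.

Lemma geometric_ccauchy (u : nat -> C) (K : R) :
  (forall n, cabs (u n.+1 - u n) <= K * 2^-1 ^+ n) ->
  exists l, forall n, cabs (u n - l) <= 4 * K * 2^-1 ^+ n.
Proof.
move=> uK.
have [|l1 H1] := @geometric_cauchy (fun n => complex.Re (u n)) K.
  by move=> n; rewrite -cReB (le_trans (cabs_Re _)).
have [|l2 H2] := @geometric_cauchy (fun n => complex.Im (u n)) K.
  by move=> n; rewrite -cImB (le_trans (cabs_Im _)).
exists (l1 +i* l2)%C => n; apply: le_trans (cabs_leReIm _) _.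
by rewrite cReB cImB /=; have := H1 n; have := H2 n; lra.
Qed.

Lemma expr_small (K q e : R) : 0 <= q < 1 -> 0 < e -> exists n, K * q ^+ n < e.
Proof.
move=> /andP[q0 q1] e0; have [K0|K0] := leP K 0.
  by exists 0%N; rewrite expr0 mulr1 (le_lt_trans K0).
have /cvgrPdist_lt/(_ (e / K)) : q ^+ n @[n --> \oo] --> 0.
  by apply: cvg_expr; rewrite ger0_norm.
rewrite divr_gt0 // => /(_ isT)[n _ /(_ n (leqnn n))] /=.
rewrite sub0r normrN ger0_norm ?exprn_ge0 // ltr_pdivlMr // => H.
by exists n; rewrite mulrC.
Qed.

Lemma half_expr_small (K e : R) : 0 < e -> exists n, K * 2^-1 ^+ n < e.
Proof. by apply: expr_small; lra. Qed.

(** [Dconv] keeps the subdivided triangles in [D], and [Dlim], closedness along geometric sequences,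
    keeps their common limit point in [D], where [f] must be differentiable. *)
Variables (D : set C) (f : C -> C).
Hypothesis Dconv : forall a b t, D a -> D b -> 0 <= t <= 1 -> D (pt a b t).
Hypothesis Dlim : forall (u : nat -> C) (l : C) (K : R), (forall n, D (u n)) ->
  (forall n, cabs (u n - l) <= K * 2^-1 ^+ n) -> D l.
Hypothesis fD : forall z, D z -> exists d, cder f z d.

Let seg a b : D a -> D b -> segcont f a b.
Proof.
by move=> Da Db t t01; have [d /cder_cont] := fD (Dconv Da Db t01).
Qed.

Let tri (x : C * C * C) : C := J f x.1.1 x.1.2 + J f x.1.2 x.2 + J f x.2 x.1.1.
Let per (x : C * C * C) : R :=
  cabs (x.1.1 - x.1.2) + cabs (x.1.2 - x.2) + cabs (x.2 - x.1.1).
Let inD (x : C * C * C) := [/\ D x.1.1, D x.1.2 & D x.2].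

(** The midpoints cut out four triangles whose integrals add up to that of [x], hence one of them
    has at least a quarter of its modulus. The middle triangle is the default choice, justified by
    [tri_step]. *)
Let step (x : C * C * C) : C * C * C :=
  let a := x.1.1 in let b := x.1.2 in let c := x.2 in
  let u := pt a b 2^-1 in let v := pt b c 2^-1 in let w := pt a c 2^-1 in
  if cabs (tri x) <= 4 * cabs (tri (a, u, w)) then (a, u, w) else
  if cabs (tri x) <= 4 * cabs (tri (u, b, v)) then (u, b, v) else
  if cabs (tri x) <= 4 * cabs (tri (w, v, c)) then (w, v, c) else (v, w, u).

Let half01 : 0 <= (2^-1 : R) <= 1.
Proof. by lra. Qed.

Let stepD x : inD x -> inD (step x).
Proof.
case=> Da Db Dc; have Du := Dconv Da Db half01; have Dv := Dconv Db Dc half01.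
by have Dw := Dconv Da Dc half01; rewrite /step; do !case: ifP => _; split.
Qed.

Let half2 : (2^-1 : R)%:C%C = 2^-1 :> C.
Proof. by rewrite fmorphV rmorph_nat. Qed.

Let cabs_half z : cabs (2^-1 * z) = 2^-1 * cabs z.
Proof. by rewrite cabsM -half2 cabs_real ger0_norm // invr_ge0. Qed.

Let per_step x : per (step x) = 2^-1 * per x.
Proof.
case: x => [[a b] c]; rewrite /step /per /=.
have E z y : 2^-1 * cabs (z - y) = cabs (2^-1 * (z - y)) by rewrite cabs_half.
rewrite !mulrDr !E /pt !half2.
case: ifP => _ /=; [|case: ifP => _ /=; [|case: ifP => _ /=]].
- by congr (_ + _ + _); [| |]; congr cabs; field.
- by congr (_ + _ + _); [| |]; congr cabs; field.
- by congr (_ + _ + _); [| |]; congr cabs; field.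
- rewrite (cabs_distC _ (a + _)) [in X in _ + X + _](cabs_distC (a + _)).
  rewrite [in X in _ + _ + X](cabs_distC (a + _)).
  by congr (_ + _ + _); [| |]; congr cabs; field.
Qed.

Let tri_step x : inD x -> cabs (tri x) <= 4 * cabs (tri (step x)).
Proof.
case: x => [[a b] c]; rewrite /inD /= => -[Da Db Dc]; rewrite /step /=.
set u := pt a b _; set v := pt b c _; set w := pt a c _.
have Du : D u := Dconv Da Db half01.
have Dv : D v := Dconv Db Dc half01.
have Dw : D w := Dconv Da Dc half01.
case: ifPn => //; rewrite -ltNge => H1.
case: ifPn => //; rewrite -ltNge => H2.
case: ifPn => //; rewrite -ltNge => H3.
have E : tri (a, b, c) = tri (a, u, w) + tri (u, b, v) + tri (w, v, c) + tri (v, w, u).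
  rewrite /tri /= (J_split (seg Da Db) half01) (J_split (seg Db Dc) half01) -/u -/v.
  rewrite (J_rev (seg Da Dc)) (J_split (seg Da Dc) half01) -/w.
  rewrite (J_rev (seg Da Dw)) (J_rev (seg Dw Dc)) (J_rev (seg Dv Du)) (J_rev (seg Dw Dv)).
  by rewrite (J_rev (seg Dw Du)); ring.
have T : cabs (tri (a, b, c)) <= cabs (tri (a, u, w)) + cabs (tri (u, b, v)) +
    cabs (tri (w, v, c)) + cabs (tri (v, w, u)).
  rewrite E; do 3 ![apply: le_trans (cabsD _ _) _; rewrite lerD2r].
  by [].
lra.
Qed.

Let fst_step x : cabs ((step x).1.1 - x.1.1) <= per x.
Proof.
case: x => [[a b] c]; rewrite /step /per /=.
have h0 := cabs_ge0 (a - b); have h1 := cabs_ge0 (b - c); have h2 := cabs_ge0 (c - a).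
have E1 : cabs (pt a b 2^-1 - a) = 2^-1 * cabs (a - b).
  by rewrite -cabs_half -cabsN; congr cabs; rewrite /pt half2; field.
have E2 : cabs (pt a c 2^-1 - a) = 2^-1 * cabs (c - a).
  by rewrite -cabs_half; congr cabs; rewrite /pt half2; field.
have E3 : cabs (pt b c 2^-1 - a) <= 2^-1 * cabs (a - b) + 2^-1 * cabs (c - a).
  have -> : pt b c 2^-1 - a = 2^-1 * (c - a) - 2^-1 * (a - b) by rewrite /pt half2; field.
  by apply: le_trans (cabsB _ _) _; rewrite !cabs_half addrC.
do !case: ifP => _ /=; rewrite ?subrr ?cabs0 ?E1 ?E2; lra.
Qed.

Lemma goursat a b c : D a -> D b -> D c -> J f a b + J f b c + J f c a = 0.
Proof.
move=> Da Db Dc; pose u n := iter n step (a, b, c).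
have uD n : inD (u n) by elim: n => [|n IH] //=; exact: stepD.
have uP n : per (u n) = per (a, b, c) * 2^-1 ^+ n.
  elim: n => [|n IH]; first by rewrite expr0 mulr1.
  by rewrite /= per_step IH exprS; ring.
have uT n : cabs (tri (a, b, c)) <= 4 ^+ n * cabs (tri (u n)).
  elim: n => [|n IH]; first by rewrite expr0 mul1r.
  apply: le_trans IH _; rewrite exprSr -mulrA ler_wpM2l ?exprn_ge0 //.
  exact: tri_step.
set P := per (a, b, c) in uP.
have P0 : 0 <= P by rewrite /P /per !addr_ge0 ?cabs_ge0.
have [|l lP] := @geometric_ccauchy (fun n => (u n).1.1) P.
  by move=> n; apply: le_trans (fst_step _) _; rewrite uP.
have Dl : D l by apply: (Dlim _ lP) => n; have [] := uD n.
have [d /cderCP df] := fD Dl.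
apply/eqP; rewrite -cabs_eq0 eq_le cabs_ge0 andbT.
change (cabs (tri (a, b, c)) <= 0); rewrite leNgt; apply/negP => T0.
(* The subdivision will give [|tri (a, b, c)| <= e * (5 * P ^+ 2)]; this [e] makes the right side
   smaller than the left one. The [+ 1] avoids a zero denominator. *)
pose e := cabs (tri (a, b, c)) / (5 * P ^+ 2 + 1) / 2.
have Q0 : 0 < 5 * P ^+ 2 + 1 by rewrite ltr_wpDl ?mulr_ge0 ?exprn_ge0.
have e0 : 0 < e by rewrite !divr_gt0.
have [r r0 rP] := df e e0.
(* The vertices are within [P * h] of [a'], and [a'] is within [4 * P * h] of [l]: the whole
   triangle lies within [5 * P * h < r] of [l]. *)
have [n nr] := half_expr_small (5 * P) r0.
set h := 2^-1 ^+ n in nr; have h0 : 0 < h by rewrite exprn_gt0.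
have {}uP : per (u n) = P * h by exact: uP.
have {}lP : cabs ((u n).1.1 - l) <= 4 * P * h by exact: lP.
have {}uT := uT n.
case E : (u n) (uD n) => [[a' b'] c'] [/= Da' Db' Dc'].
rewrite E /= in lP uT uP; rewrite /per /= in uP.
have k1 := cabs_ge0 (a' - b'); have k2 := cabs_ge0 (b' - c'); have k3 := cabs_ge0 (c' - a').
(* A primitive of the affine map tangent to [f] at [l], for use in [J_approx]; its three increments
   cancel. *)
pose L z : C := f l * z + d / 2 * ((z - l) * (z - l)).
have dL z : cder L z (f l + d * (z - l)).
  have zl := cderB (cder_id z) (cder_cst l z).
  have := cderD (cderZ (f l) (cder_id z)) (cderZ (d / 2) (cderM zl zl)).
  by congr cder; rewrite /=; field.
have near_l x : D x -> cabs (x - a') <= P * h ->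
    cabs (f x - (f l + d * (x - l))) <= e * (5 * P * h).
  move=> Dx xa; have xl : cabs (x - l) <= 5 * P * h.
    by have := cabs_triangle x a' l; lra.
  rewrite opprD addrA; apply: le_trans (rP _ (le_lt_trans xl nr)) _.
  by rewrite ler_wpM2l // ltW.
have Jseg x y : D x -> D y -> cabs (x - a') <= P * h -> cabs (y - a') <= P * h ->
    cabs (J f x y - (L y - L x)) <= e * (5 * P * h) * cabs (y - x).
  move=> Dx Dy xa ya; apply: (@J_approx R f L (fun z => f l + d * (z - l))).
  - exact: seg.
  - by move=> t _; exact: dL.
  move=> t t01; apply: near_l; first exact: Dconv.
  exact: pt_le.
have a0 : cabs (a' - a') <= P * h by rewrite subrr cabs0 mulr_ge0 // ltW.
have b0 : cabs (b' - a') <= P * h by rewrite cabs_distC; lra.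
have c0 : cabs (c' - a') <= P * h by lra.
have T : cabs (tri (a', b', c')) <= e * (5 * P * h) * (P * h).
  have -> : tri (a', b', c') = (J f a' b' - (L b' - L a')) +
     (J f b' c' - (L c' - L b')) + (J f c' a' - (L a' - L c')) by rewrite /tri /=; ring.
  have J1 := Jseg _ _ Da' Db' a0 b0; have J2 := Jseg _ _ Db' Dc' b0 c0.
  have J3 := Jseg _ _ Dc' Da' c0 a0.
  rewrite (cabs_distC b' a') in J1; rewrite (cabs_distC c' b') in J2.
  rewrite (cabs_distC a' c') in J3.
  move: J1 J2 J3; set M := e * (5 * P * h); rewrite -uP !mulrDr => J1 J2 J3.
  apply: le_trans (cabsD _ _) _; apply: lerD => //.
  by apply: le_trans (cabsD _ _) _; apply: lerD.
have : cabs (tri (a, b, c)) <= e * (5 * P ^+ 2).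
  apply: le_trans uT _; apply: le_trans (ler_wpM2l (exprn_ge0 _ _) T) _ => //.
  have : 4 ^+ n * h ^+ 2 = 1 :> R.
    rewrite /h -exprM mulnC exprM -exprMn (_ : 4 * 2^-1 ^+ 2 = 1) ?expr1n //.
    by field.
  move: (4 ^+ n) => q qh; rewrite le_eqVlt; apply/orP; left; apply/eqP.
  by transitivity (e * (5 * P ^+ 2) * (q * h ^+ 2)); [ring|rewrite qh mulr1].
rewrite leNgt => /negP; apply.
apply: (@lt_trans _ _ (e * (5 * P ^+ 2 + 1))); first by rewrite ltr_pM2l // ltrDl.
by rewrite /e mulrAC divfK ?gt_eqF //; lra.
Qed.

Lemma primitive_J a z : D a -> (\forall y \near z, D y) -> cder (J f a) z (f z).
Proof.
move=> Da /nearCP[r r0 rP]; apply/cderCP => e e0.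
have Dz : D z by apply: rP; rewrite subrr cabs0.
have [d /cder_cont cf] := fD Dz; have [k k0 kP] := cf e e0.
exists (Num.min r k) => [|y]; first by rewrite lt_min r0.
rewrite lt_min => /andP[yr yk]; have Dy := rP _ yr.
have := goursat Da Dz Dy; rewrite (J_rev (seg Da Dy)) => /eqP.
rewrite subr_eq0 => /eqP <-; rewrite [J f a z + _]addrC addrK.
have -> : f z * (y - z) = f z * y - f z * z by ring.
apply: (@J_approx R f (fun x => f z * x) (fun=> f z)).
- exact: seg.
- by move=> t _; have := cderZ (f z) (cder_id (pt z y t)); rewrite mulr1.
move=> t t01; apply/ltW/kP; apply: le_lt_trans yk.
have -> : pt z y t - z = t%:C%C * (y - z) by rewrite /pt; ring.
case/andP: t01 => t0 t1; rewrite cabsM cabs_real ger0_norm //.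
by rewrite ler_piMl ?cabs_ge0.
Qed.

End Goursat.

(** * Maximum principle and removable singularities *)

Section Maximum.
Variable R : realType.
Local Notation C := (R[i]^o).
Implicit Types (f g : C -> C) (y z a b c d : C) (s t : R).

Lemma ler_addgt0P (x y : R) : (forall e, 0 < e -> x <= y + e) -> x <= y.
Proof. by move=> H; apply/ler_addgt0Pr => e e0; exact: H. Qed.

Lemma nonincreasing (k dk : R -> R) (u v : R) : u <= v ->
  (forall t, u <= t <= v -> is_derive t 1 k (dk t)) ->
  (forall t, u <= t <= v -> dk t <= 0) -> k v <= k u.
Proof.
move=> uv dkP dk0; have [||c] := @MVT_segment R k dk u v uv.
- by move=> t; rewrite in_itv /= => /andP[t0 t1]; apply: dkP; rewrite !ltW.
- apply: derivable_within_continuous => t; rewrite in_itv /= => /dkP.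
  by move/(@ex_derive _ _ _ _ _ _ _).
rewrite in_itv /= => /dk0 c0 E; rewrite -subr_le0 E.
by rewrite mulr_le0_ge0 // subr_ge0.
Qed.

Definition cis t : C := (cos t +i* sin t)%C.

Lemma cabs_cis t : cabs (cis t) = 1.
Proof. by rewrite cabs_sqrt /= cos2Dsin2 sqrtr1. Qed.

Lemma rder_cis t : rder cis t ('i%C * cis t).
Proof.
apply: rderP; rewrite /cis /=.
  by rewrite mul0r mul1r sub0r; exact: is_derive_cos.
by rewrite mul0r mul1r add0r; exact: is_derive_sin.
Qed.

(* The quotient [(f z - f z0) / (z - z0)] is only known to be continuous at
   [z0]: Goursat's theorem is applied to triangles truncated near [z0]. *)
Lemma primitive_quotient f (phi : C -> C) z0 (r : R) a :
  (forall y, cabs (y - z0) < r -> exists d, cder f y d) ->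
  ccont phi z0 -> (forall y, f y = f z0 + phi y * (y - z0)) ->
  cabs (a - z0) < r -> a != z0 -> cder (J phi z0) a (phi a).
Proof.
move=> df cphi fE ar az0.
have dphi y : cabs (y - z0) < r -> y != z0 -> exists d, cder phi y d.
  move=> yr yz0; have [d fd] := df y yr.
  have yz : y - z0 != 0 by rewrite subr_eq0.
  have dy : cder (fun x => x - z0) y (1 - 0) := cderB (cder_id y) (cder_cst z0 y).
  have dfy := cderB fd (cder_cst (f z0) y).
  have := cderM dfy (cderV (f := fun x => x - z0) yz dy).
  move=> H; eexists; apply: near_cder H.
  have : \forall x \near y, x - z0 != 0 := near_neq0 (f := fun x => x - z0) (cder_cont dy) yz.
  by apply: filterS => x xz; rewrite (fE x) [f z0 + _]addrC addrK mulfK.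
have cphi' y : cabs (y - z0) < r -> ccont phi y.
  move=> yr; have [->//|yz0] := eqVneq y z0.
  by have [d /cder_cont] := dphi y yr yz0.
have seg x y : cabs (x - z0) < r -> cabs (y - z0) < r -> segcont phi x y.
  by move=> xr yr t t01; apply: cphi'; exact: pt_lt.
have z0r : cabs (z0 - z0) < r.
  by rewrite subrr cabs0; apply: le_lt_trans ar; exact: cabs_ge0.
have [k k0 kP] := cphi _ ltr01.
pose N := cabs (phi z0) + 1.
have phiN y : cabs (y - z0) < k -> cabs (phi y) <= N.
  by move=> /kP yk; have := cabs_dist (phi y) (phi z0); rewrite /N; lra.
have N0 : 0 < N by rewrite ltr_wpDl ?cabs_ge0.
pose u := a - z0; have u0 : 0 < cabs u by rewrite cabs_gt0 subr_eq0.
have tri y : cabs (y - a) < Num.min (r - cabs u) (cabs u / 2) ->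
    J phi z0 y = J phi z0 a + J phi a y.
  rewrite lt_min => /andP[ya1 ya2].
  have yr : cabs (y - z0) < r by have := cabs_triangle y a z0; rewrite -/u; lra.
  (* The scalar product of [u] with [a - z0] is [2 * m], and within [|u| / 2] of [a] it stays at
     least [m]. So the half-plane at level [s * m > 0] contains [a], [y] and their contractions
     towards [z0] by the factor [s], but not [z0]. *)
  have [m mE] : exists m, m = cabs u ^+ 2 / 2 by eexists.
  have m0 : 0 < m by rewrite mE divr_gt0 ?exprn_gt0.
  have re_a : complex.Re (u^*%C * (a - z0) : C) = 2 * m.
    by rewrite Re_conj_mul mE; field.
  have re_y : m <= complex.Re (u^*%C * (y - z0) : C).
    have -> : y - z0 = (a - z0) - (a - y) by ring.
    rewrite mulrBr cReB re_a.
    have : complex.Re (u^*%C * (a - y) : C) <= m.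
      apply: le_trans (ler_norm _) _; apply: le_trans (cabs_Re _) _.
      rewrite cabsM cabsJ cabs_distC mE expr2 -mulrA ler_pM2l //.
      exact: ltW.
    lra.
  (* Cutting off the corner at [z0] by the factor [s] leaves a quadrilateral, to whose two triangles
     [goursat] applies. The corner contributes at most [N] times its perimeter, which is
     proportional to [s]. *)
  have key s : 0 < s <= 1 -> s * (cabs u + cabs (y - z0)) < k ->
      cabs (J phi z0 a + J phi a y - J phi z0 y) <=
      s * (N * (cabs u + cabs (y - z0) + cabs (a - y))).
    move=> /andP[s0 s1] sk; have s01 : 0 <= s <= 1 by rewrite ltW.
    pose rho := Num.max (cabs u) (cabs (y - z0)).
    have rhor : rho < r by rewrite gt_max ar.
    have ur : cabs (a - z0) <= rho by rewrite le_max lexx.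
    have yrho : cabs (y - z0) <= rho by rewrite le_max lexx orbT.
    pose D := [set z : C | cabs (z - z0) <= rho /\
       s * m <= complex.Re (u^*%C * (z - z0) : C)].
    have Dconv x x' t : D x -> D x' -> 0 <= t <= 1 -> D (pt x x' t).
      move=> [x1 x2] [x1' x2'] /andP[t0 t1].
      have E : pt x x' t - z0 = (x - z0) * (1 - t)%:C%C + (x' - z0) * t%:C%C.
        by rewrite /pt rmorphB /=; ring.
      have t1' : 0 <= 1 - t by rewrite subr_ge0.
      split; first by apply: pt_le => //; rewrite t0.
      rewrite E mulrDr !mulrA.
      have -> : complex.Re (u^*%C * (x - z0) * (1 - t)%:C%C + u^*%C * (x' - z0) * t%:C%C : C) =
          complex.Re (u^*%C * (x - z0) : C) * (1 - t) +
          complex.Re (u^*%C * (x' - z0) : C) * t.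
        by rewrite cReD !cReMr.
      have -> : s * m = s * m * (1 - t) + s * m * t by ring.
      by apply: lerD; apply: ler_wpM2r.
    have Dlim (w : nat -> C) l (K : R) : (forall n, D (w n)) ->
        (forall n, cabs (w n - l) <= K * 2^-1 ^+ n) -> D l.
      move=> Dw wl; split; apply: ler_addgt0P => e e0.
        have [n ne] := half_expr_small K e0.
        have [w1 _] := Dw n; have := cabs_triangle l (w n) z0.
        by rewrite (cabs_distC l (w n)); have := wl n; lra.
      have [n ne] := half_expr_small (cabs u * K) e0.
      have [_ w2] := Dw n; apply: le_trans w2 _; rewrite -lerBlDl -cReB -mulrBr.
      have -> : w n - z0 - (l - z0) = w n - l by ring.
      apply: le_trans (ler_norm _) _; apply: le_trans (cabs_Re _) _.
      rewrite cabsM cabsJ; apply: le_trans (ltW ne).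
      by rewrite -mulrA ler_pM2l.
    have Dphi z : D z -> exists d, cder phi z d.
      move=> [zr zs]; apply: dphi; first exact: le_lt_trans rhor.
      apply/eqP => zz0; move: zs; rewrite zz0 subrr mulr0 /=.
      by apply/negP; rewrite -ltNge mulr_gt0.
    have pts z : pt z0 z s - z0 = (z - z0) * s%:C%C by rewrite /pt; ring.
    have Ds z : D z -> m <= complex.Re (u^*%C * (z - z0) : C) -> D (pt z0 z s).
      move=> [zr zs] zm; split; rewrite pts.
        rewrite cabsM cabs_real ger0_norm ?(ltW s0) //; apply: le_trans zr.
        by rewrite ler_piMr ?cabs_ge0.
      by rewrite mulrA cReMr mulrC ler_pM2r.
    have sm : s * m <= m by rewrite ler_piMl // ltW.
    have m2 : m <= complex.Re (u^*%C * (a - z0) : C) by rewrite re_a; lra.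
    have Da : D a by split=> //; apply: le_trans m2.
    have Dy : D y by split=> //; apply: le_trans re_y.
    have Das := Ds a Da m2; have Dys := Ds y Dy re_y.
    have T1 := goursat Dconv Dlim Dphi Das Da Dy.
    have T2 := goursat Dconv Dlim Dphi Das Dy Dys.
    have inr z : D z -> cabs (z - z0) < r by move=> [zr _]; exact: le_lt_trans rhor.
    rewrite (J_split (seg _ _ z0r (inr _ Da)) s01) (J_split (seg _ _ z0r (inr _ Dy)) s01).
    set as_ := pt z0 a s; set ys := pt z0 y s.
    rewrite -/as_ -/ys in T1 T2 Das Dys.
    rewrite (J_rev (seg _ _ (inr _ Das) (inr _ Dy))) in T1.
    rewrite (J_rev (seg _ _ (inr _ Dys) (inr _ Dy))) in T2.
    have -> : J phi z0 as_ + J phi as_ a + J phi a y - (J phi z0 ys + J phi ys y) =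
       J phi z0 as_ - J phi z0 ys - J phi ys as_.
      apply/eqP; rewrite -subr_eq0 -[X in _ == X](addr0 0) -{1}T1 -T2; apply/eqP; ring.
    have bnd x x' : cabs (x - z0) < k -> cabs (x' - z0) < k ->
       cabs (x - z0) < r -> cabs (x' - z0) < r -> cabs (J phi x x') <= N * cabs (x' - x).
      move=> xk xk' xr xr'; apply: J_bound; first exact: seg.
      move=> t /andP[t0 t1]; apply: phiN.
      by apply: pt_lt => //; rewrite t0.
    have zk : cabs (z0 - z0) < k by rewrite subrr cabs0.
    have as_E : cabs (as_ - z0) = s * cabs u.
      by rewrite /as_ pts cabsM cabs_real ger0_norm ?(ltW s0) // mulrC.
    have ys_E : cabs (ys - z0) = s * cabs (y - z0).
      by rewrite /ys pts cabsM cabs_real ger0_norm ?(ltW s0) // mulrC.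
    have asys : cabs (as_ - ys) = s * cabs (a - y).
      have -> : as_ - ys = (a - y) * s%:C%C by rewrite /as_ /ys /pt; ring.
      by rewrite cabsM cabs_real ger0_norm ?(ltW s0) // mulrC.
    have su : 0 <= s * cabs u by rewrite mulr_ge0 ?cabs_ge0 // ltW.
    have sy : 0 <= s * cabs (y - z0) by rewrite mulr_ge0 ?cabs_ge0 // ltW.
    have ak : cabs (as_ - z0) < k by rewrite as_E; move: sk; rewrite mulrDr; lra.
    have yk : cabs (ys - z0) < k by rewrite ys_E; move: sk; rewrite mulrDr; lra.
    have B1 := bnd z0 as_ zk ak z0r (inr _ Das).
    have B2 := bnd z0 ys zk yk z0r (inr _ Dys).
    have B3 := bnd ys as_ yk ak (inr _ Dys) (inr _ Das).
    rewrite as_E in B1; rewrite ys_E in B2; rewrite asys in B3.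
    apply: le_trans (cabsB _ _) _; apply: le_trans (lerD (cabsB _ _) (lexx _)) _.
    have -> : s * (N * (cabs u + cabs (y - z0) + cabs (a - y))) =
       N * (s * cabs u) + N * (s * cabs (y - z0)) + N * (s * cabs (a - y)) by ring.
    by rewrite !lerD.
  suff : cabs (J phi z0 a + J phi a y - J phi z0 y) <= 0.
    move=> H; apply/esym/eqP; rewrite -subr_eq0 -cabs_eq0 eq_le H.
    exact: cabs_ge0.
  apply: ler_addgt0P => e e0; rewrite add0r.
  pose Q := N * (cabs u + cabs (y - z0) + cabs (a - y)).
  pose P := cabs u + cabs (y - z0).
  have P0 : 0 < P by rewrite ltr_pwDl ?cabs_ge0.
  have Q0 : 0 < Q by rewrite mulr_gt0 // ltr_pwDl ?cabs_ge0.
  pose s := Num.min 1 (Num.min (k / 2 / P) (e / Q)).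
  have s0 : 0 < s by rewrite !lt_min ltr01 !divr_gt0.
  have sP : s <= k / 2 / P by rewrite /s !ge_min lexx orbT.
  have sQ : s <= e / Q by rewrite /s !ge_min lexx !orbT.
  rewrite ler_pdivlMr // in sP; rewrite ler_pdivlMr // in sQ.
  apply: le_trans sQ; apply: key; last by rewrite -/P; lra.
  by rewrite s0 /s ge_min lexx.
apply/cderCP => e e0.
have cpa := cphi' a ar.
have [l l0 lP] := cpa e e0.
exists (Num.min l (Num.min (r - cabs u) (cabs u / 2))) => [|y].
  by rewrite !lt_min l0 subr_gt0 ar divr_gt0.
rewrite lt_min => /andP[yl ym]; rewrite (tri _ ym) [J phi z0 a + _]addrC addrK.
have yr : cabs (y - z0) < r.
  by move: ym; rewrite lt_min => /andP[ym _]; have := cabs_triangle y a z0; rewrite -/u; lra.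
have -> : phi a * (y - a) = phi a * y - phi a * a by ring.
apply: (@J_approx R phi (fun x => phi a * x) (fun=> phi a)).
- exact: seg.
- by move=> t _; have := cderZ (phi a) (cder_id (pt a y t)); rewrite mulr1.
move=> t t01; apply/ltW/lP; apply: le_lt_trans yl.
have -> : pt a y t - a = t%:C%C * (y - a) by rewrite /pt; ring.
case/andP: t01 => t0 t1; rewrite cabsM cabs_real ger0_norm //.
by rewrite ler_piMl ?cabs_ge0.
Qed.

End Maximum.

(** * Maximum principle on discs; removable singularities *)

Section Removable.
Variable R : realType.
Local Notation C := (R[i]^o).
Implicit Types (f g : C -> C) (x y z a b c d : C) (s t : R).

(** On the circle about [z0] through [a], [dz = i (z - z0) dt], so the primitive of the difference
    quotient, divided by [f z0], has derivative [i * h] in [t], with [h = f / f z0 - 1]. Its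
    imaginary part [k] has derivative [Re h <= 0] and equal values at [- pi] and [pi], as the
    primitive is single-valued; hence [k] is constant and [Re h = 0]. At [a] the quotient [f / f z0]
    then has real part 1 and modulus at most 1, so it is 1. *)
Lemma strong_max f z0 (r : R) :
  (forall y, cabs (y - z0) < r -> exists d, cder f y d) ->
  (forall y, cabs (y - z0) < r -> cabs (f y) <= cabs (f z0)) ->
  forall y, cabs (y - z0) < r -> f y = f z0.
Proof.
move=> df fM a ar; have [->//|az0] := eqVneq a z0.
have [F0|F0] := eqVneq (f z0) 0.
  apply/eqP; rewrite F0 -cabs_eq0 eq_le cabs_ge0 andbT.
  by have := fM _ ar; rewrite F0 cabs0.
have z0r : cabs (z0 - z0) < r.
  by rewrite subrr cabs0; apply: le_lt_trans ar; exact: cabs_ge0.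
have [d [phi [cphi _ fE]]] := df _ z0r.
pose z t := z0 + (a - z0) * cis t.
have zE t : cabs (z t - z0) = cabs (a - z0).
  by rewrite /z [z0 + _]addrC addrK cabsM cabs_cis mulr1.
have zz0 t : z t != z0.
  by rewrite -subr_eq0 -cabs_eq0 zE cabs_eq0 subr_eq0.
have zr t : cabs (z t - z0) < r by rewrite zE.
pose h t : C := f (z t) / f z0 - 1.
pose G t : C := (f z0)^-1 * J phi z0 (z t).
have dG t : rder G t ('i%C * h t).
  have dz : rder z t ((a - z0) * ('i%C * cis t)).
    move=> e /(rderZ (a - z0) (rder_cis t))[l l0 lP]; exists l => // u /lP.
    by congr (cabs (_ - _) <= _); rewrite /z; ring.
  have dJ := primitive_quotient df cphi fE (zr t) (zz0 t).
  have := rderZ (f z0)^-1 (rder_comp dz dJ); congr rder.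
  have E : phi (z t) * (z t - z0) = f (z t) - f z0.
    by rewrite (fE (z t)) [f z0 + _]addrC addrK.
  have zt : (a - z0) * cis t = z t - z0 by rewrite /z [z0 + _]addrC addrK.
  rewrite /h.
  have -> : 'i%C * (f (z t) / f z0 - 1) = 'i%C * ((f (z t) - f z0) / f z0) :> C.
    by rewrite mulrBl divff.
  by rewrite -E -zt; ring.
pose k t := complex.Im (G t).
have dk t : is_derive t 1 k (complex.Re (h t)).
  have := rder_Re (rderZ (- 'i%C) (dG t)).
  have -> : - 'i%C * ('i%C * h t) = h t :> C.
    by rewrite mulrA mulNr -expr2 sqr_i opprK mul1r.
  congr is_derive; apply/funext => u; rewrite /k; case: (G u) => p q /=.
  by rewrite !oppr0 !mul0r mulN1r sub0r opprK.
have h0 t : complex.Re (h t) <= 0.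
  rewrite /h cReB subr_le0; apply: le_trans (ler_norm _) _.
  apply: le_trans (cabs_Re _) _; rewrite cabsM cabsV ler_pdivrMr ?cabs_gt0 //.
  by rewrite mul1r fM.
have kpi : k pi = k (- pi).
  by rewrite /k /G /z /cis cosN sinN sinpi oppr0.
have pi0 : 0 < pi :> R := pi_gt0 R.
have kc t : - pi <= t <= pi -> k t = k pi.
  move=> /andP[t1 t2]; apply/eqP; rewrite eq_le {1}kpi; apply/andP; split.
    by apply: (@nonincreasing R k (fun t => complex.Re (h t))).
  by apply: (@nonincreasing R k (fun t => complex.Re (h t))).
have z00 : z 0 = a.
  by rewrite /z /cis cos0 sin0 mulr1 addrC subrK.
have hE : complex.Re (h 0) = 0.
  apply/eqP; rewrite -normr_le0; apply: ler_addgt0P => e e0; rewrite add0r.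
  have [l l0 lP] := (real_derive _ _ _).1 (dk 0) e e0.
  pose u := Num.min (l / 2) pi.
  have u0 : 0 < u by rewrite lt_min divr_gt0.
  have ul : `|u| < l.
    by rewrite gtr0_norm // /u gt_min; apply/orP; left; lra.
  have up : u <= pi by rewrite /u ge_min lexx orbT.
  have := lP u ul; rewrite add0r !kc; [|lra|lra].
  by rewrite subrr sub0r normrN normrM ler_pM2r ?normr_gt0 ?gt_eqF.
have w1 : cabs (f a / f z0) <= 1.
  by rewrite cabsM cabsV ler_pdivrMr ?cabs_gt0 // mul1r fM.
move: hE; rewrite /h z00 cReB => /eqP; rewrite subr_eq0 => /eqP w2.
suff E : f a / f z0 = 1 by apply: (mulIf (invr_neq0 F0)); rewrite E divff.
case: (f a / f z0) w1 w2 => p q; rewrite cabs_sqrt /= => + w2; rewrite {}w2 => w1.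
have : 1 + q ^+ 2 <= 1.
  move: w1; rewrite -(ler_pXn2r (_ : (0 < 2)%N)) ?nnegrE ?sqrtr_ge0 //.
  by rewrite sqr_sqrtr ?addr_ge0 ?sqr_ge0 // !expr1n.
rewrite gerDl => q0; have /eqP : q ^+ 2 = 0.
  by apply/eqP; rewrite eq_le q0 sqr_ge0.
by rewrite sqrf_eq0 => /eqP ->.
Qed.

Lemma compact_disc z0 (r : R) : compact [set z : C | cabs (z - z0) <= r].
Proof.
have [W cW WP] := @complex_compact_box R (r + cabs z0).
apply: subclosed_compact cW _.
  rewrite -openC openE => z /= /negP; rewrite -ltNge => rz.
  have rz0 : 0 < cabs (z - z0) - r by rewrite subr_gt0.
  apply/nbhsCP; exists (cabs (z - z0) - r) => // y yz.
  by apply/negP; rewrite -ltNge; have := cabs_triangle z y z0; rewrite (cabs_distC z y); lra.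
move=> z /= zr; apply: contrapT => /WP; rewrite cabsE ltcR ltNge => /negP; apply.
by have := cabs_dist z z0; lra.
Qed.

(** At a maximum [z1] inside the disc, [strong_max] makes [f] constant on the largest disc about
    [z1] that fits in. This disc touches the circle at some [z2], where continuity gives the value
    [f z1], too large for the bound on the circle. *)
Lemma disc_max f z0 (r M : R) : 0 < r ->
  (forall y, cabs (y - z0) <= r -> exists d, cder f y d) ->
  (forall y, cabs (y - z0) = r -> cabs (f y) <= M) ->
  forall y, cabs (y - z0) <= r -> cabs (f y) <= M.
Proof.
move=> r0 df fM y yr; rewrite leNgt; apply/negP => My.
have [||z1] := @compact_EVT_max C R (fun z => cabs (f z)) _ _ (@compact_disc z0 r).
- by exists y.
- apply: continuous_in_subspaceT => z /[!inE] /df[d /cder_cont/continuousCP cf].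
  by apply: continuous_comp => //; exact: cabs_continuous.
rewrite inE /= => z1r z1M.
have {}z1M z : cabs (z - z0) <= r -> cabs (f z) <= cabs (f z1).
  by move=> zr; apply: z1M; rewrite inE.
pose r1 := r - cabs (z1 - z0).
have inr z : cabs (z - z1) < r1 -> cabs (z - z0) <= r.
  by move=> zr1; have := cabs_triangle z z1 z0; rewrite /r1 in zr1; lra.
have fc z : cabs (z - z1) < r1 -> f z = f z1.
  by apply: strong_max => w /inr; [exact: df|exact: z1M].
have Mz1 : M < cabs (f z1) by apply: lt_le_trans (z1M _ yr).
have [r10|r10] := eqVneq r1 0.
  by have := fM z1; rewrite leNgt Mz1 => H; apply/notF/H; rewrite /r1 in r10; lra.
(* The point of the circle on the ray from [z0] through [z1], or any point of the circle if
   [z1 = z0]. *)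
have [z2 z2r z21] : exists2 z2, cabs (z2 - z0) = r & cabs (z2 - z1) = r1.
  have [E|E] := eqVneq z1 z0.
    exists (z0 + r%:C%C); rewrite ?E [z0 + _]addrC addrK cabs_real gtr0_norm //.
    by rewrite /r1 E subrr cabs0 subr0.
  have w0 : cabs (z1 - z0) != 0 by rewrite cabs_eq0 subr_eq0.
  pose q := r / cabs (z1 - z0).
  have q1 : 1 <= q by rewrite /q ler_pdivlMr ?mul1r // lt0r w0 cabs_ge0.
  exists (z0 + q%:C%C * (z1 - z0)).
    rewrite [z0 + _]addrC addrK cabsM cabs_real ger0_norm; last by lra.
    by rewrite /q mulfVK.
  have -> : z0 + q%:C%C * (z1 - z0) - z1 = (q - 1)%:C%C * (z1 - z0).
    by rewrite rmorphB /=; ring.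
  by rewrite cabsM cabs_real ger0_norm ?subr_ge0 // mulrBl mul1r /q mulfVK.
have : cabs (f z2) < cabs (f z1) by apply: le_lt_trans Mz1; exact: fM.
have z2r' : cabs (z2 - z0) <= r by rewrite z2r.
have [d /cder_cont cf] := df _ z2r'.
rewrite -subr_gt0 => f21; have [l l0 lP] := cf _ f21.
have r1p : 0 < r1 by rewrite lt0r r10 /r1 subr_ge0.
pose s := Num.min (1 / 2) (l / (2 * r1)).
have s0 : 0 < s by rewrite lt_min !divr_gt0 ?mulr_gt0.
have s2 : s <= 1 / 2 by rewrite /s ge_min lexx.
have sl : s * r1 < l.
  have : s <= l / (2 * r1) by rewrite /s ge_min lexx orbT.
  by rewrite ler_pdivlMr ?mulr_gt0 //; lra.
have := lP (pt z2 z1 s).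
have -> : pt z2 z1 s - z2 = s%:C%C * (z1 - z2) by rewrite /pt; ring.
rewrite cabsM cabs_real gtr0_norm // (cabs_distC z1 z2) z21 => /(_ sl).
rewrite fc; first by have := cabs_dist (f z1) (f z2); lra.
have -> : pt z2 z1 s - z1 = (1 - s)%:C%C * (z2 - z1) by rewrite /pt rmorphB /=; ring.
rewrite cabsM cabs_real z21 ger0_norm; last by lra.
by rewrite -subr_gt0 mulrBl mul1r opprB addrC subrK mulr_gt0.
Qed.

Lemma cder_sqr_bounded (h : C -> C) z0 (M r : R) : 0 < r ->
  (forall y, cabs (y - z0) < r -> cabs (h y) <= M) ->
  cder (fun y => (y - z0) ^+ 2 * h y) z0 0.
Proof.
move=> r0 hM; have M0 : 0 <= M.
  by apply: le_trans (hM z0 _); rewrite ?cabs_ge0 // subrr cabs0.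
apply/cderCP => e e0; exists (Num.min r (e / (M + 1))) => [|y].
  by rewrite lt_min r0 divr_gt0 // ltr_wpDl.
rewrite lt_min => /andP[yr ye]; rewrite subrr expr0n /= !mul0r !subr0 expr2 !cabsM.
rewrite mulrAC ler_wpM2r ?cabs_ge0 //.
move: ye; rewrite ltr_pdivlMr ?ltr_wpDl // => /ltW; apply: le_trans.
rewrite ler_wpM2l ?cabs_ge0 //; apply: le_trans (hM _ yr) _; lra.
Qed.

Lemma expr_dominated (A c x M : R) : 0 < c -> 0 < M -> 0 <= x ->
  (forall n, c * x ^+ n <= A * M ^+ n) -> x <= M.
Proof.
move=> c0 M0 x0 H; rewrite leNgt; apply/negP => Mx.
have xp : 0 < x by apply: lt_trans Mx.
have q01 : 0 <= M / x < 1 by rewrite divr_ge0 ?ltW //= ltr_pdivrMr // mul1r.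
have [n] := expr_small A q01 c0.
by rewrite ltNge expr_div_n mulrA ler_pdivlMr ?exprn_gt0 // H.
Qed.

(* The difference quotient [K] is controlled by the maximum principle for
   [((z - z0) (z - a))^2 K^n], which is differentiable at [z0] and at [a];
   letting [n] tend to infinity removes the first factor. *)
Lemma punctured_lipschitz f z0 (r B : R) : 0 < r ->
  (forall y, cabs (y - z0) < r -> y != z0 -> exists d, cder f y d) ->
  (forall y, cabs (y - z0) < r -> y != z0 -> cabs (f y) <= B) ->
  exists M : R, forall x y, cabs (x - z0) < r / 4 -> cabs (y - z0) < r / 4 ->
    x != z0 -> y != z0 -> cabs (f x - f y) <= M * cabs (x - y).
Proof.
move=> r0 df fB; pose B' := Num.max B (cabs (f z0)).
have B'0 : 0 <= B' by rewrite le_max cabs_ge0 orbT.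
have fB' y : cabs (y - z0) < r -> cabs (f y) <= B'.
  move=> yr; have [->|yz0] := eqVneq y z0; first by rewrite le_max lexx orbT.
  by rewrite le_max fB.
(* Points of the circle of radius [r / 2] are at distance at least [r / 4] from [a], so that
   [2 * B' / (r / 4)] bounds the quotient there; the [+ 1] makes [M] positive. *)
pose M := 2 * B' / (r / 4) + 1.
have M0 : 0 < M by rewrite ltr_wpDl // !divr_ge0 // ?mulr_ge0 //; lra.
exists M => x a xr ar xz0 az0.
have [->|xa] := eqVneq x a; first by rewrite !subrr cabs0 mulr0.
pose K z : C := (f z - f a) / (z - a).
have xa' : x - a != 0 by rewrite subr_eq0.
suff H : cabs (K x) <= M by move: H; rewrite cabsM cabsV ler_pdivrMr ?cabs_gt0.
(* [r / 2] and [3 / 4 * r] bound the distances to [z0] and to [a] on that circle. *)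
apply: (@expr_dominated (((r / 2) * (3 / 4 * r)) ^+ 2) (cabs ((x - z0) * (x - a)) ^+ 2)) => //.
- by rewrite exprn_gt0 // cabs_gt0 mulf_neq0 // subr_eq0.
- exact: cabs_ge0.
move=> n; rewrite -!cabsX -cabsM.
apply: (@disc_max (fun z => ((z - z0) * (z - a)) ^+ 2 * K z ^+ n) z0 (r / 2)); last 1 first.
- by lra.
- lra.
- move=> y yr.
  have dyz c : cder (fun x => x - c) y 1.
    by have := cderB (cder_id y) (cder_cst c y); rewrite subr0.
  have yr' : cabs (y - z0) < r by lra.
  have [E|yz0] := eqVneq y z0.
    exists 0; rewrite E.
    apply: (@near_cder R (fun z => (z - z0) ^+ 2 * ((z - a) ^+ 2 * K z ^+ n))).
      by near=> z; rewrite mulrA -exprMn.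
    have za0 : 0 < cabs (z0 - a) / 2 by rewrite divr_gt0 // cabs_gt0 subr_eq0 eq_sym.
    pose l := Num.min r (cabs (z0 - a) / 2).
    have l0 : 0 < l by rewrite lt_min r0.
    apply: (@cder_sqr_bounded _ _ ((cabs (z0 - a) + r) ^+ 2 * (2 * B' / (cabs (z0 - a) / 2)) ^+ n) l) => // z.
    rewrite lt_min => /andP[zr zl].
    rewrite cabsM !cabsX; apply: ler_pM; rewrite ?exprn_ge0 ?cabs_ge0 //.
      apply: lerXn2r; rewrite ?nnegrE ?cabs_ge0 ?addr_ge0 ?cabs_ge0 ?(ltW r0) //.
      by have := cabs_triangle z z0 a; lra.
    have za : cabs (z0 - a) / 2 <= cabs (z - a).
      by have := cabs_triangle z0 z a; rewrite (cabs_distC z0 z); lra.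
    apply: lerXn2r; rewrite ?nnegrE ?cabs_ge0 ?divr_ge0 ?mulr_ge0 ?cabs_ge0 //.
    rewrite cabsM cabsV; apply: ler_pM; rewrite ?cabs_ge0 ?invr_ge0 ?cabs_ge0 //.
      apply: le_trans (cabsB _ _) _; have ar' : cabs (a - z0) < r by lra.
      by have := fB' _ zr; have := fB' _ ar'; lra.
    by rewrite lef_pV2 ?posrE // (lt_le_trans za0).
  have [E|ya] := eqVneq y a.
    exists 0; rewrite E.
    apply: (@near_cder R (fun z => (z - a) ^+ 2 * ((z - z0) ^+ 2 * K z ^+ n))).
      by near=> z; rewrite mulrA -exprMn [(z - a) * _]mulrC.
    have [|d [phi [cphi _ fE]]] := df a _ az0; first by rewrite -E.
    have [l l0 lP] := cphi _ ltr01.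
    apply: (@cder_sqr_bounded _ _ ((cabs (a - z0) + l) ^+ 2 * (cabs (phi a) + 1) ^+ n) l) => // z zl.
    rewrite cabsM !cabsX; apply: ler_pM; rewrite ?exprn_ge0 ?cabs_ge0 //.
      apply: lerXn2r; rewrite ?nnegrE ?cabs_ge0 ?addr_ge0 ?cabs_ge0 ?(ltW l0) //.
      by have := cabs_triangle z a z0; lra.
    apply: lerXn2r; rewrite ?nnegrE ?cabs_ge0 ?addr_ge0 ?cabs_ge0 //.
    have [->|za] := eqVneq z a; first by rewrite /K !subrr mul0r cabs0 addr_ge0 ?cabs_ge0.
    rewrite /K (fE z) [f a + _]addrC addrK mulfK ?subr_eq0 //.
    by have := lP z zl; have := cabs_dist (phi z) (phi a); lra.
  have [d fd] := df y yr' yz0.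
  have dK := cderM (cderB fd (cder_cst (f a) y)) (cderV (f := fun x => x - a) (_ : y - a != 0) (dyz a)).
  have ya' : y - a != 0 by rewrite subr_eq0.
  by eexists; exact: cderM (cderX 2 (cderM (dyz z0) (dyz a))) (cderX n (dK ya')).
- move=> y yr; rewrite cabsM !cabsX; apply: ler_pM; rewrite ?exprn_ge0 ?cabs_ge0 //.
    rewrite cabsM; apply: lerXn2r; rewrite ?nnegrE ?mulr_ge0 ?cabs_ge0 //; [lra|lra|].
    rewrite yr ler_pM2l; last by lra.
    by have := cabs_triangle y z0 a; rewrite (cabs_distC z0 a); lra.
  apply: lerXn2r; rewrite ?nnegrE ?cabs_ge0 ?(ltW M0) //.
  have ya : r / 4 <= cabs (y - a) by have := cabs_triangle y a z0; lra.
  rewrite cabsM cabsV ler_pdivrMr; last by lra.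
  have : M * (r / 4) <= M * cabs (y - a) by rewrite ler_pM2l.
  have -> : M * (r / 4) = 2 * B' + r / 4 by rewrite /M; field; rewrite gt_eqF.
  have yr' : cabs (y - z0) < r by lra.
  have ar' : cabs (a - z0) < r by lra.
  by have := cabsB (f y) (f a); have := fB' _ yr'; have := fB' _ ar'; lra.
Unshelve. all: by end_near. Qed.

Lemma punctured_limit f z0 (r B : R) : 0 < r ->
  (forall y, cabs (y - z0) < r -> y != z0 -> exists d, cder f y d) ->
  (forall y, cabs (y - z0) < r -> y != z0 -> cabs (f y) <= B) ->
  exists l (M : R), forall y, cabs (y - z0) < r / 4 -> y != z0 ->
    cabs (f y - l) <= M * cabs (y - z0).
Proof.
move=> r0 df fB; have [M0 M0P] := punctured_lipschitz r0 df fB.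
pose M := Num.max M0 0; have MP x y : cabs (x - z0) < r / 4 -> cabs (y - z0) < r / 4 ->
    x != z0 -> y != z0 -> cabs (f x - f y) <= M * cabs (x - y).
  move=> ? ? ? ?; apply: le_trans (M0P x y _ _ _ _) _ => //.
  by rewrite ler_wpM2r ?cabs_ge0 // le_max lexx.
have Mge0 : 0 <= M by rewrite le_max lexx orbT.
pose h n : R := 2^-1 ^+ n; have h0 n : 0 < h n by rewrite exprn_gt0.
have h1 n : h n <= 1 by apply: exprn_ile1; lra.
(* Being Lipschitz off [z0], [f] has convergent values along a geometric sequence; the factor
   [r / 8] keeps this one in the disc of radius [r / 4]. *)
pose u n : C := z0 + (r / 8 * h n)%:C%C.
have uz n : u n - z0 = (r / 8 * h n)%:C%C by rewrite /u addrC addKr.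
have un n : cabs (u n - z0) = r / 8 * h n.
  by rewrite uz cabs_real ger0_norm // mulr_ge0 ?(ltW (h0 n)) //; lra.
have ur n : cabs (u n - z0) < r / 4.
  rewrite un; have : r / 8 * h n <= r / 8 * 1 by rewrite ler_pM2l // divr_gt0.
  lra.
have u0 n : u n != z0.
  by rewrite -subr_eq0 -cabs_eq0 un mulf_neq0 ?gt_eqF // divr_gt0.
have [|l lP] := @geometric_ccauchy R (fun n => f (u n)) (M * r).
  move=> n; apply: le_trans (MP _ _ (ur _) (ur _) (u0 _) (u0 _)) _.
  rewrite -mulrA ler_wpM2l //.
  have -> : u n.+1 - u n = (u n.+1 - z0) - (u n - z0) by ring.
  apply: le_trans (cabsB _ _) _; rewrite !un /h exprS.
  by have := h0 n; rewrite /h; move: (2^-1 ^+ n) => v v0; nra.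
exists l, M => y yr y0; apply: ler_addgt0P => e e0.
have [n ne] := half_expr_small (5 * (M * r)) e0.
have := cabs_triangle (f y) (f (u n)) l; have := lP n.
have := MP y (u n) yr (ur _) y0 (u0 _).
have : M * cabs (y - u n) <= M * cabs (y - z0) + M * r * h n.
  rewrite -mulrA -mulrDr ler_wpM2l //; apply: le_trans (cabs_triangle _ z0 _) _.
  rewrite lerD2l cabs_distC un ler_pM2r //; lra.
by move: ne; rewrite -/(h n); lra.
Qed.

(** The last hypothesis bounds the difference quotient [Q] by [M]. As [Q] is differentiable off
    [z0], [punctured_limit] applies to [Q] as well, and its limit is the derivative. *)
Lemma cder_at_limit f z0 l (r M : R) : 0 < r ->
  (forall y, cabs (y - z0) < r -> y != z0 -> exists d, cder f y d) ->
  f z0 = l ->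
  (forall y, cabs (y - z0) < r -> y != z0 -> cabs (f y - l) <= M * cabs (y - z0)) ->
  exists d, cder f z0 d.
Proof.
move=> r0 df fl fM; pose Q y : C := (f y - l) / (y - z0).
have [||d [K dK]] := @punctured_limit Q z0 r M r0.
- move=> y yr y0; have [d fd] := df y yr y0.
  have yz : y - z0 != 0 by rewrite subr_eq0.
  have dy : cder (fun x => x - z0) y (1 - 0) := cderB (cder_id y) (cder_cst z0 y).
  by eexists; exact: cderM (cderB fd (cder_cst l y)) (cderV (f := fun x => x - z0) yz dy).
- move=> y yr y0; rewrite /Q cabsM cabsV ler_pdivrMr ?fM //.
  by rewrite cabs_gt0 subr_eq0.
exists d; apply/cderCP => e e0.
pose K' := Num.max K 1; have K'0 : 0 < K' by rewrite lt_max ltr01 orbT.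
exists (Num.min (r / 4) (e / K')) => [|y]; first by rewrite lt_min !divr_gt0.
rewrite lt_min => /andP[yr ye]; have [->|y0] := eqVneq y z0.
  by rewrite !subrr mulr0 subrr cabs0 mulr0.
have yz : y - z0 != 0 by rewrite subr_eq0.
have -> : f y - f z0 - d * (y - z0) = (Q y - d) * (y - z0).
  by rewrite /Q mulrBl mulfVK // fl.
rewrite cabsM ler_wpM2r ?cabs_ge0 //; apply: le_trans (dK _ yr y0) _.
move: ye; rewrite ltr_pdivlMr // => /ltW; apply: le_trans.
by rewrite mulrC ler_wpM2l ?cabs_ge0 // le_max lexx.
Qed.

End Removable.

(** * Local theory of holomorphic functions *)

Section Holomorphic.
Variable R : realType.
Local Notation C := (R[i]^o).
Implicit Types (f g : C -> C) (x y z a b c d : C) (s t : R).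

Definition hol f z : Prop := \forall y \near z, derivable f y 1.

Lemma derivableCP f z : derivable f z 1 <-> exists d, cder f z d.
Proof.
split=> [/derivable_dz H|[d]]; first by eexists; exact: H.
exact: cder_derivable.
Qed.

Lemma nearS (P Q : C -> Prop) z : (forall y, P y -> Q y) ->
  (\forall y \near z, P y) -> \forall y \near z, Q y.
Proof. by move=> PQ /nearCP[r r0 rP]; apply/nearCP; exists r => // y /rP/PQ. Qed.

Lemma nearS2 (P Q S : C -> Prop) z : (forall y, P y -> Q y -> S y) ->
  (\forall y \near z, P y) -> (\forall y \near z, Q y) -> \forall y \near z, S y.
Proof.
move=> PQS /nearCP[r r0 rP] /nearCP[k k0 kQ]; apply/nearCP.
exists (Num.min r k) => [|y]; first by rewrite lt_min r0.
by rewrite lt_min => /andP[/rP Py /kQ]; exact: PQS.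
Qed.

Lemma near_near (P : C -> Prop) z :
  (\forall y \near z, P y) -> \forall y \near z, \forall x \near y, P x.
Proof.
move=> /nearCP[r r0 rP]; apply/nearCP; exists r => // y yr.
apply/nearCP; exists (r - cabs (y - z)) => [|x xr]; first by rewrite subr_gt0.
by apply: rP; have := cabs_triangle x y z; lra.
Qed.

Lemma near_ccont f z (P : C -> Prop) : ccont f z ->
  (\forall y \near f z, P y) -> \forall y \near z, P (f y).
Proof.
move=> cf /nearCP[r r0 rP]; have [k k0 kP] := cf _ r0.
by apply/nearCP; exists k => // y /kP/rP.
Qed.

Lemma hol_derivable f z : hol f z -> derivable f z 1.
Proof. exact: nbhs_singleton. Qed.

Lemma hol_cder f z : hol f z -> cder f z (dz f z).
Proof. by move/hol_derivable/derivable_dz. Qed.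

Lemma hol_cont f z : hol f z -> ccont f z.
Proof. by move/hol_cder/cder_cont. Qed.

Lemma hol_hol f z : hol f z -> \forall y \near z, hol f y.
Proof. exact: near_near. Qed.

Lemma near_derivable f g z : (\forall y \near z, f y = g y) ->
  derivable f z 1 -> derivable g z 1.
Proof. by move=> fg /derivable_dz/(near_cder fg)/cder_derivable. Qed.

Lemma near_hol f g z : (\forall y \near z, f y = g y) -> hol f z -> hol g z.
Proof.
move=> fg; have := @near_near (fun y => f y = g y) z fg.
by apply: nearS2 => y; exact: near_derivable.
Qed.

Lemma hol_cst c z : hol (fun=> c) z.
Proof. by apply/nearCP; exists 1 => // y _; exact: cder_derivable (cder_cst c y). Qed.

Lemma hol_id z : hol id z.
Proof. by apply/nearCP; exists 1 => // y _; exact: cder_derivable (cder_id y). Qed.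

Lemma holD f g z : hol f z -> hol g z -> hol (fun y => f y + g y) z.
Proof.
by apply: nearS2 => y /derivable_dz df /derivable_dz dg;
  exact: cder_derivable (cderD df dg).
Qed.

Lemma holM f g z : hol f z -> hol g z -> hol (fun y => f y * g y) z.
Proof.
by apply: nearS2 => y /derivable_dz df /derivable_dz dg;
  exact: cder_derivable (cderM df dg).
Qed.

Lemma holB f g z : hol f z -> hol g z -> hol (fun y => f y - g y) z.
Proof.
by apply: nearS2 => y /derivable_dz df /derivable_dz dg;
  exact: cder_derivable (cderB df dg).
Qed.

Lemma holX f n z : hol f z -> hol (fun y => f y ^+ n) z.
Proof.
by apply: nearS => y /derivable_dz df; exact: cder_derivable (cderX n df).
Qed.

Lemma hol_comp f g z : hol g z -> hol f (g z) -> hol (fun y => f (g y)) z.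
Proof.
move=> hg hf; apply: nearS2 hg (near_ccont (hol_cont hg) hf).
by move=> y /derivable_dz dg /derivable_dz df; exact: cder_derivable (cder_comp dg df).
Qed.

Lemma hol_sum n (f : 'I_n -> C -> C) z : (forall k, hol (f k) z) ->
  hol (fun y => \sum_(k < n) f k y) z.
Proof.
elim: n f => [|n IH] f H.
  by apply: near_hol (hol_cst 0 z); near=> y; rewrite big_ord0.
apply: (@near_hol (fun y => f ord0 y + \sum_(k < n) f (lift ord0 k) y)).
  by near=> y; rewrite big_ord_recl.
by apply: holD => //; apply: IH => k; exact: H.
Unshelve. all: by end_near. Qed.

Definition dquo f z0 : C -> C :=
  fun y => if y == z0 then dz f z0 else (f y - f z0) / (y - z0).

Lemma dquoE f z0 y : f y = f z0 + (y - z0) * dquo f z0 y.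
Proof.
rewrite /dquo; case: eqP => [->|/eqP yz]; first by rewrite subrr mul0r addr0.
by rewrite mulrC mulfVK ?subr_eq0 // addrC subrK.
Qed.

Lemma dquo_id f z0 : dquo f z0 z0 = dz f z0.
Proof. by rewrite /dquo eqxx. Qed.

Lemma cder_dquo f z0 y : y != z0 -> derivable f y 1 ->
  exists d, cder (dquo f z0) y d.
Proof.
move=> yz0 /derivable_dz df; have yz : y - z0 != 0 by rewrite subr_eq0.
have dy : cder (fun x => x - z0) y (1 - 0) := cderB (cder_id y) (cder_cst z0 y).
have := cderM (cderB df (cder_cst (f z0) y)) (cderV (f := fun x => x - z0) yz dy).
move=> H; eexists; apply: near_cder H.
have : \forall x \near y, x - z0 != 0 := near_neq0 (f := fun x => x - z0) (cder_cont dy) yz.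
by apply: nearS => x; rewrite subr_eq0 /dquo => /negPf ->.
Qed.

Lemma dquo_cont f z0 : derivable f z0 1 -> ccont (dquo f z0) z0.
Proof.
move=> /derivable_dz[phi [cphi phi0 E]].
apply: ccont_near cphi; near=> y; rewrite /dquo.
have [->//|yz] := eqVneq y z0.
by rewrite (E y) [f z0 + _]addrC addrK mulfK ?subr_eq0.
Unshelve. all: by end_near. Qed.

Lemma ccont_bounded f z : ccont f z ->
  exists M (r : R), [/\ 0 < M, 0 < r & forall y, cabs (y - z) < r -> cabs (f y) <= M].
Proof.
move=> cf; have [r r0 rP] := cf _ ltr01; exists (cabs (f z) + 1), r; split => //.
  by rewrite ltr_wpDl ?cabs_ge0.
by move=> y /rP; have := cabs_dist (f y) (f z); lra.
Qed.

Lemma cabs_small_eq0 a : (forall e : R, 0 < e -> cabs a <= e) -> a = 0.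
Proof.
move=> H; apply/eqP; rewrite -cabs_eq0 eq_le cabs_ge0 andbT.
by apply: ler_addgt0P => e /H; rewrite add0r.
Qed.

Lemma ccont_uniq f g z : ccont f z -> ccont g z ->
  (\forall y \near z, y != z -> f y = g y) -> f z = g z.
Proof.
move=> cf cg /nearCP[r r0 rP]; apply/eqP; rewrite -subr_eq0; apply/eqP.
apply: cabs_small_eq0 => e e0; have e2 : 0 < e / 2 by rewrite divr_gt0.
have [k k0 kP] := cf _ e2; have [l l0 lP] := cg _ e2.
pose h : R := Num.min r (Num.min k l) / 2.
have m0 : 0 < Num.min r (Num.min k l) by rewrite !lt_min r0 k0.
have h0 : 0 < h by rewrite divr_gt0.
have mr : Num.min r (Num.min k l) <= r by rewrite ge_min lexx.
have mk : Num.min r (Num.min k l) <= k by rewrite !ge_min lexx orbT.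
have ml : Num.min r (Num.min k l) <= l by rewrite !ge_min lexx !orbT.
pose y := z + h%:C%C; have yz : cabs (y - z) = h.
  by rewrite /y [z + _]addrC addrK cabs_real gtr0_norm.
have yz0 : y != z by rewrite -subr_eq0 -cabs_eq0 yz gt_eqF.
have hr : h < r by rewrite /h; lra.
have hk : h < k by rewrite /h; lra.
have hl : h < l by rewrite /h; lra.
have H1 := kP y; have H2 := lP y; have H3 := rP y; rewrite yz in H1 H2 H3.
have := cabs_triangle (f z) (f y) (g z); rewrite {2}(H3 hr yz0).
by have := H1 hk; have := H2 hl; rewrite (cabs_distC (f y)); lra.
Qed.

(** Boundedness gives a limit with a Lipschitz bound, and this bound makes the extension by the
    limit differentiable. *)
Lemma removable f z : (\forall y \near z, y != z -> derivable f y 1) ->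
  (exists M : R, \forall y \near z, y != z -> cabs (f y) <= M) ->
  exists2 g, hol g z & \forall y \near z, y != z -> g y = f y.
Proof.
move=> /nearCP[r1 r10 rP1] [M /nearCP[r2 r20 rP2]].
pose r := Num.min r1 r2; have r0 : 0 < r by rewrite lt_min r10.
have df y : cabs (y - z) < r -> y != z -> exists d, cder f y d.
  by rewrite lt_min => /andP[/rP1 H _] /H/derivable_dz ?; eexists; eassumption.
have fM y : cabs (y - z) < r -> y != z -> cabs (f y) <= M.
  by rewrite lt_min => /andP[_ /rP2].
have [l [K lK]] := punctured_limit r0 df fM.
pose g y := if y == z then l else f y.
have gE y : y != z -> g y = f y by rewrite /g => /negPf ->.
have dg y : cabs (y - z) < r -> y != z -> exists d, cder g y d.
  move=> yr yz; have [d fd] := df y yr yz; exists d; apply: near_cder fd.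
  have yz' : y - z != 0 by rewrite subr_eq0.
  have cy : ccont (fun x => x - z) y by apply: ccontD; [exact: ccont_id|exact: ccont_cst].
  have := near_neq0 cy yz'.
  by apply: nearS => x; rewrite subr_eq0 => /gE ->.
have r4 : 0 < r / 4 by rewrite divr_gt0.
have dgz : exists d, cder g z d.
  apply: (@cder_at_limit R g z l (r / 4) K) => //.
  - by move=> y yr; apply: dg; lra.
  - by rewrite /g eqxx.
  - by move=> y yr yz; rewrite gE //; exact: lK.
exists g; last by near=> y; exact: gE.
apply/nearCP; exists r => // y yr; apply/derivableCP.
by have [->//|yz] := eqVneq y z; exact: dg.
Unshelve. all: by end_near. Qed.

(** The difference quotient is continuous at [z0] and differentiable elsewhere near it, so the
    singularity is removable. This takes the place of Cauchy's formula: iterated, it yields Taylor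
    expansions, and it makes the derivative holomorphic. *)
Lemma dquo_derivable f z0 : hol f z0 -> exists d, cder (dquo f z0) z0 d.
Proof.
move=> hf; have cq := dquo_cont (hol_derivable hf).
have [M [r [M0 r0 rP]]] := ccont_bounded cq.
have [||g hg gE] := @removable (dquo f z0) z0.
- apply: nearS hf => y dy yz; have [d fd] := cder_dquo yz dy.
  exact: cder_derivable fd.
- by exists M; apply/nearCP; exists r => // y /rP.
have gz : g z0 = dquo f z0 z0 by apply: ccont_uniq (hol_cont hg) cq gE.
have := hol_cder hg => dg; eexists; apply: near_cder dg.
by apply: nearS gE => y; have [->|yz ->] := eqVneq y z0.
Qed.

Lemma dquo_ball f z0 (r : R) : (forall y, cabs (y - z0) < r -> derivable f y 1) ->
  forall y, cabs (y - z0) < r -> derivable (dquo f z0) y 1.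
Proof.
move=> df y yr; apply/derivableCP; have [E|yz] := eqVneq y z0; last first.
  by apply: cder_dquo => //; exact: df.
rewrite E; apply: dquo_derivable; apply/nearCP; exists r => //.
by apply: le_lt_trans yr; exact: cabs_ge0.
Qed.

Lemma hol_dquo f z0 : hol f z0 -> hol (dquo f z0) z0.
Proof.
move=> /nearCP[r r0 rP]; apply/nearCP; exists r; [exact: r0|exact: (dquo_ball rP)].
Qed.

Lemma hol_taylor f z0 m : hol f z0 ->
  exists (a : nat -> C) (u : C -> C), hol u z0 /\
    forall y, f y = \sum_(j < m) a j * (y - z0) ^+ j + (y - z0) ^+ m * u y.
Proof.
elim: m f => [|m IH] f hf.
  by exists (fun=> 0), f; split=> // y; rewrite big_ord0 add0r expr0 mul1r.
have [a [u [hu E]]] := IH _ (hol_dquo hf).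
exists (fun j => if j is j'.+1 then a j' else f z0), u; split=> // y.
rewrite (dquoE f z0 y) E big_ord_recl /= expr0 mulr1 -addrA; congr (_ + _).
rewrite mulrDr mulr_sumr exprS -mulrA; congr (_ + _).
by apply: eq_bigr => j _; rewrite exprS; ring.
Qed.

Lemma hol_lipschitz f z : hol f z -> exists M (r : R), [/\ 0 < M, 0 < r &
  forall x y, cabs (x - z) < r -> cabs (y - z) < r ->
    cabs (f x - f y) <= M * cabs (x - y)].
Proof.
move=> hf; have [B [r1 [B0 r10 rB]]] := ccont_bounded (hol_cont hf).
have [B' [r3 [B'0 r30 rB']]] := ccont_bounded (dquo_cont (hol_derivable hf)).
have /nearCP[r2 r20 rP] := hf.
pose r := Num.min r1 r2; have r0 : 0 < r by rewrite lt_min r10.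
have [||M MP] := @punctured_lipschitz R f z r B r0.
- by move=> y; rewrite lt_min => /andP[_ /rP/derivable_dz ?] _; eexists; eassumption.
- by move=> y; rewrite lt_min => /andP[/rB].
pose K := Num.max M B'; exists K, (Num.min (r / 4) r3); split.
- by rewrite lt_max B'0 orbT.
- by rewrite lt_min divr_gt0.
(* [punctured_lipschitz] leaves out the pairs that contain [z]; for these the bound on the
   difference quotient serves. *)
have H y : cabs (y - z) < Num.min (r / 4) r3 -> cabs (f y - f z) <= K * cabs (y - z).
  rewrite lt_min => /andP[_ /rB' yB].
  rewrite (dquoE f z y) [f z + _]addrC addrK cabsM mulrC ler_wpM2r ?cabs_ge0 //.
  by apply: le_trans yB _; rewrite le_max lexx orbT.
move=> x y xr yr; have [->|xz] := eqVneq x z.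
  by rewrite cabs_distC (cabs_distC z); exact: H.
have [->|yz] := eqVneq y z; first exact: H.
move: xr yr; rewrite !lt_min => /andP[xr _] /andP[yr _].
apply: le_trans (MP _ _ xr yr xz yz) _.
by rewrite ler_wpM2r ?cabs_ge0 // le_max lexx.
Qed.

Lemma lipschitz_derive f z d (M r : R) : 0 < r -> cder f z d ->
  (forall y, cabs (y - z) < r -> cabs (f y - f z) <= M * cabs (y - z)) ->
  cabs d <= M.
Proof.
move=> r0 /cderCP df fM; apply: ler_addgt0P => e e0.
have [k k0 kP] := df _ e0; pose h := Num.min r k / 2.
have m0 : 0 < Num.min r k by rewrite lt_min r0.
have mr : Num.min r k <= r by rewrite ge_min lexx.
have mk : Num.min r k <= k by rewrite ge_min lexx orbT.
have h0 : 0 < h by rewrite divr_gt0.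
have yz : cabs (z + h%:C%C - z) = h by rewrite [z + _]addrC addrK cabs_real gtr0_norm.
have H1 := kP (z + h%:C%C); have H2 := fM (z + h%:C%C); rewrite yz in H1 H2.
have hk : h < k by rewrite /h; lra.
have hr : h < r by rewrite /h; lra.
rewrite -(ler_pM2r h0) -{1}yz -cabsM mulrDl.
set u := f _ - _ in H1 H2; set v := d * _ in H1 *.
have := cabs_triangle v u 0; rewrite !subr0 (cabs_distC v).
by have := H1 hk; have := H2 hr; lra.
Qed.

(** Differentiating [f y = f z + (y - z) * Q y] with [Q = dquo f z] gives
    [f' y = Q y + (y - z) * Q' y], where [Q'] is bounded because [Q] is Lipschitz. *)
Lemma dz_cont f z : hol f z -> ccont (dz f) z.
Proof.
move=> hf; have hq := hol_dquo hf; have [M [r [M0 r0 rP]]] := hol_lipschitz hq.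
have E : \forall y \near z, dz f y = dquo f z y + (y - z) * dz (dquo f z) y.
  apply: nearS hq => y /derivable_dz dq.
  apply: cder_dz; have := cderD (cder_cst (f z) y)
    (cderM (cderB (cder_id y) (cder_cst z y)) dq).
  rewrite add0r subr0 mul1r; apply: near_cder.
  by near=> x; rewrite -(dquoE f z x).
move=> e e0; have e2 : 0 < e / 2 by rewrite divr_gt0.
have [k k0 kP] := dquo_cont (hol_derivable hf) e2.
have /nearCP[l l0 lP] := E; have /nearCP[m m0 mP] := hq.
exists (Num.min (Num.min k l) (Num.min m (Num.min r (e / (2 * M))))) => [|y].
  by rewrite !lt_min k0 l0 m0 r0 divr_gt0 // mulr_gt0.
rewrite !lt_min => /andP[/andP[yk /lP ->] /andP[ym /andP[yr ye]]].
have := kP _ yk; rewrite dquo_id => H1.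
have H2 : cabs (dz (dquo f z) y) <= M.
  apply: (@lipschitz_derive (dquo f z) y _ M (r - cabs (y - z))).
  - by rewrite subr_gt0.
  - exact/derivable_dz/mP.
  by move=> x xy; apply: rP => //; have := cabs_triangle x y z; lra.
rewrite addrAC; apply: le_lt_trans (cabsD _ _) _; rewrite cabsM.
have : cabs (y - z) * cabs (dz (dquo f z) y) <= cabs (y - z) * M.
  by rewrite ler_wpM2l ?cabs_ge0.
have : cabs (y - z) * M < e / 2.
  rewrite -ltr_pdivlMr //; apply: lt_le_trans ye _.
  by rewrite le_eqVlt; apply/orP; left; apply/eqP; field; rewrite gt_eqF.
lra.
Unshelve. all: by end_near. Qed.

(** In the formula [f' y = Q y + (y - x) * Q' y], write [Q y = Q x + phi y * (y - x)]. Then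
    [phi + Q'] is a Caratheodory factor of [f'] at [x], continuous there by [dz_cont]. *)
Lemma hol_derive f z : hol f z -> hol (dz f) z.
Proof.
suff H x : hol f x -> derivable (dz f) x 1 by move/hol_hol; apply: nearS => y; exact: H.
move=> {z} hf; apply/derivableCP; have hq := hol_dquo hf.
exists (dz (dquo f x) x + dz (dquo f x) x).
have [phi [cphi phi0 pE]] := hol_cder hq.
have E : \forall y \near x, dz f y = dz f x + (phi y + dz (dquo f x) y) * (y - x).
  apply: nearS hq => y /derivable_dz dq.
  apply: cder_dz; have := cderD (cder_cst (f x) y)
    (cderM (cderB (cder_id y) (cder_cst x y)) dq).
  rewrite (pE y) dquo_id add0r subr0 mul1r => H.
  have {}H : cder (fun u => f x + (u - x) * dquo f x u) y
      (dz f x + (phi y + dz (dquo f x) y) * (y - x)).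
    by move: H; congr (cder _ _ _); ring.
  by apply: near_cder H; near=> u; rewrite -(dquoE f x u).
have H : cder (fun y => dz f x + (phi y + dz (dquo f x) y) * (y - x)) x
   (dz (dquo f x) x + dz (dquo f x) x).
  exists (fun y => phi y + dz (dquo f x) y); split.
  - by apply: ccontD => //; exact: dz_cont.
  - by rewrite phi0.
  - by move=> y; rewrite subrr mulr0 addr0.
by apply: near_cder H; apply: nearS E => y ->.
Unshelve. all: by end_near. Qed.

End Holomorphic.

(** * Local injectivity, primitives and orders of vanishing *)

Section LocalTheory.
Variable R : realType.
Local Notation C := (R[i]^o).
Implicit Types (f g : C -> C) (x y z a b c d : C) (s t : R).

Lemma mean_value_ball f (df : C -> C) z c (r M : R) :
  (forall y, cabs (y - z) < r -> cder f y (df y)) ->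
  (forall y, cabs (y - z) < r -> cabs (df y - c) <= M) ->
  forall x y, cabs (x - z) < r -> cabs (y - z) < r ->
    cabs (f y - f x - c * (y - x)) <= M * cabs (y - x).
Proof.
move=> dfP dfM x y xr yr.
have -> : f y - f x - c * (y - x) =
    (f (pt x y 1) - c * pt x y 1) - (f (pt x y 0) - c * pt x y 0).
  by rewrite pt0 pt1; ring.
apply: (@mean_value R (fun t => f (pt x y t) - c * pt x y t)
  (fun t => df (pt x y t) * (y - x) - c * (y - x))) => t t01.
  have := pt_lt xr yr t01 => ptr; apply: rderB.
    by apply: rder_comp; [exact: rder_pt|exact: dfP].
  by apply: rderZ; exact: rder_pt.
rewrite -mulrBl cabsM ler_wpM2r ?cabs_ge0 //; apply: dfM.
exact: pt_lt.
Qed.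

(** On a disc where the derivative differs from [d = dz f z] by at most [|d| / 2], the increment of
    [f] differs from [d * (y - x)] by at most half the modulus of the latter. *)
Lemma locally_injective f z : hol f z -> dz f z != 0 ->
  exists2 r : R, 0 < r & forall x y, cabs (x - z) < r -> cabs (y - z) < r ->
    f x = f y -> x = y.
Proof.
move=> hf; rewrite -cabs_gt0 => d0.
have d2 : 0 < cabs (dz f z) / 2 by rewrite divr_gt0.
have [r r0 rP] := dz_cont hf d2; have /nearCP[k k0 kP] := hf.
exists (Num.min r k) => [|x y xr yr E]; first by rewrite lt_min r0.
have := @mean_value_ball f (dz f) z (dz f z) (Num.min r k) (cabs (dz f z) / 2) _ _ x y xr yr.
rewrite E subrr sub0r cabsN cabsM => H.
apply/esym/eqP; rewrite -subr_eq0 -cabs_eq0 eq_le cabs_ge0 andbT.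
have {}H : cabs (dz f z) * cabs (y - x) <= cabs (dz f z) / 2 * cabs (y - x).
  apply: H => w; rewrite lt_min => /andP[wr wk]; first exact/derivable_dz/kP.
  exact/ltW/rP.
by rewrite -(ler_pM2l d2) mulr0; lra.
Qed.

Lemma hol_primitive f z : hol f z -> exists F, \forall y \near z, cder F y (f y).
Proof.
move=> /nearCP[r r0 rP]; exists (J f z); apply/nearCP; exists (r / 2) => [|y yr].
  by rewrite divr_gt0.
(* A smaller disc, taken closed because [Dlim] asks for limits in [D]. *)
pose D := [set y : C | cabs (y - z) <= r / 2].
apply: (@primitive_J R D f) => //=.
- by move=> a b t Da Db t01; exact: pt_le.
- move=> u l K Du ul; apply: ler_addgt0P => e e0.
  have [n ne] := half_expr_small K e0.
  have := cabs_triangle l (u n) z; rewrite (cabs_distC l (u n)).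
  by have := Du n; rewrite /D /=; have := ul n; lra.
- move=> y' Dy; have {}Dy : cabs (y' - z) <= r / 2 := Dy.
  by exists (dz f y'); apply/derivable_dz/rP; lra.
- by rewrite /D /= subrr cabs0 divr_ge0 // ltW.
apply/nearCP; exists (r / 2 - cabs (y - z)) => [|x xy]; first by rewrite subr_gt0.
by rewrite /D /=; have := cabs_triangle x y z; lra.
Qed.

Lemma punctured_constant f z : ccont f z ->
  (\forall y \near z, y != z -> cder f y 0) -> \forall y \near z, f y = f z.
Proof.
move=> cf /nearCP[r r0 rP]; apply/nearCP; exists r => // y yr.
apply/eqP; rewrite -subr_eq0; apply/eqP; apply: cabs_small_eq0 => e e0.
have [->|yz] := eqVneq y z; first by rewrite subrr cabs0 ltW.
have [k k0 kP] := cf _ e0.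
have yz0 : 0 < cabs (y - z) by rewrite cabs_gt0 subr_eq0.
(* [x] will be a point between [z] and [y], within [k / 2] of [z] but distinct from it, so that the
   segment from [x] to [y] avoids [z]. *)
pose s := Num.min 1 (k / 2 / cabs (y - z)).
have s0 : 0 < s by rewrite lt_min ltr01 !divr_gt0.
have s1 : s <= 1 by rewrite ge_min lexx.
have sk : s * cabs (y - z) <= k / 2.
  by rewrite -ler_pdivlMr // /s ge_min lexx orbT.
pose x := pt z y s; have xz : cabs (x - z) = s * cabs (y - z).
  have -> : x - z = s%:C%C * (y - z) by rewrite /x /pt; ring.
  by rewrite cabsM cabs_real gtr0_norm.
have : cabs (f y - f x) <= 0.
  rewrite -[X in f X - _](pt1 x y) -[X in _ - f X](pt0 x y).
  apply: (@mean_value R (fun t => f (pt x y t)) (fun=> 0 * (y - x))) => t t01; last first.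
    by rewrite mul0r cabs0.
  apply: rder_comp; first exact: rder_pt.
  have E : pt x y t - z = (s + (1 - s) * t)%:C%C * (y - z).
    by rewrite /x /pt rmorphD rmorphM rmorphB /=; ring.
  have w0 : 0 < s + (1 - s) * t.
    by rewrite ltr_pwDl // mulr_ge0 ?subr_ge0 //; case/andP: t01.
  have w1 : s + (1 - s) * t <= 1.
    case/andP: t01 => _ t1.
    by have : (1 - s) * t <= 1 - s by [rewrite ler_piMr ?subr_ge0|]; lra.
  apply: rP.
    rewrite E cabsM cabs_real gtr0_norm //; apply: le_lt_trans yr.
    by rewrite ler_piMl ?cabs_ge0.
  rewrite -subr_eq0 E mulf_neq0 ?subr_eq0 //.
  by rewrite -cabs_eq0 cabs_real gtr0_norm // gt_eqF.
have := cabs_triangle (f y) (f x) (f z).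
by have := kP x; rewrite xz => H; have : s * cabs (y - z) < k by [lra|]; move/H; lra.
Qed.

(** [h n] is the [n]-th iterated difference quotient at [z], and the first one that is nonzero at
    [z] gives the order. If all vanish there, [f y = (y - z) ^+ n * h n y] for every [n]; the
    maximum principle bounds [h n] by [B / r ^+ n], and [B * (|y - z| / r) ^+ n] tends to 0. *)
Lemma order_of_vanishing f z : hol f z ->
  (\forall y \near z, f y = 0) \/
  exists k h, [/\ hol h z, h z != 0 & forall y, f y = (y - z) ^+ k * h y].
Proof.
move=> hf; pose h n := iter n (fun g => dquo g z) f.
have hh n : hol (h n) z by elim: n => [|n IH]; [exact: hf|exact: (hol_dquo IH)].
have fE n : (forall j, (j < n)%N -> h j z = 0) -> forall y, f y = (y - z) ^+ n * h n y.
  elim: n => [|n IH] H y; first by rewrite expr0 mul1r.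
  rewrite IH => [|j jn]; last by apply: H; rewrite ltnS ltnW.
  by rewrite (dquoE (h n) z y) H // add0r exprSr mulrA.
have [[k k0]|all0] := pselect (exists k, h k z != 0).
  have [n n0 nmin] := find_ex_minn (ex_intro (fun k => h k z != 0) k k0).
  right; exists n, (h n); split; [exact: hh|exact: n0|apply: fE => j jn].
  by apply/eqP; apply: contraTT jn => /nmin; rewrite -leqNgt.
left; have h0 n : h n z = 0.
  by apply/eqP; apply: contrapT => /negP H; apply: all0; exists n.
have [B [r1 [B0 r10 rB]]] := ccont_bounded (hol_cont hf).
have /nearCP[r2 r20 rP] := hf.
pose r := Num.min r1 r2 / 2; have m0 : 0 < Num.min r1 r2 by rewrite lt_min r10.
have r0 : 0 < r by rewrite divr_gt0.
have m1 : Num.min r1 r2 <= r1 by rewrite ge_min lexx.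
have m2 : Num.min r1 r2 <= r2 by rewrite ge_min lexx orbT.
have hd n y : cabs (y - z) < r2 -> derivable (h n) y 1.
  elim: n y => [|n IH] y yr; first exact: rP.
  by apply: (dquo_ball (r := r2)).
apply/nearCP; exists r => // y yr; apply: cabs_small_eq0 => e e0.
have q01 : 0 <= cabs (y - z) / r < 1.
  by rewrite divr_ge0 ?cabs_ge0 ?(ltW r0) //= ltr_pdivrMr // mul1r.
have [n ne] := expr_small B q01 e0.
rewrite (fE n) // cabsM cabsX; apply: le_trans (ltW ne).
rewrite expr_div_n mulrCA ler_wpM2l ?exprn_ge0 ?cabs_ge0 //.
apply: (@disc_max R (h n) z r) => //; last exact: ltW.
  by move=> w wr; eexists; apply/derivable_dz/hd; rewrite /r in wr; lra.
move=> w wr; rewrite ler_pdivlMr ?exprn_gt0 // -wr -cabsX mulrC -cabsM -fE //.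
by apply: rB; rewrite /r in wr; lra.
Qed.

(** The first [m] Taylor coefficients of the [n] functions form an [n] by [m] matrix, whose rows are
    dependent since [m < n]. *)
Lemma vanishing_combination (m n : nat) (b : 'I_n -> C -> C) z : (m < n)%N ->
  (forall k, hol (b k) z) ->
  exists c : 'I_n -> C, (exists k, c k != 0) /\
    exists2 u, hol u z & forall y, \sum_(k < n) c k * b k y = (y - z) ^+ m * u y.
Proof.
move=> mn hb.
have /choice[a /choice[u H]] : forall k, exists (a : nat -> C), exists u : C -> C,
    hol u z /\ forall y, b k y = \sum_(j < m) a j * (y - z) ^+ j + (y - z) ^+ m * u y.
  by move=> k; exact: hol_taylor.
pose A : 'M[R[i]]_(n, m) := \matrix_(k, j) a k j.
have : kermx A != 0.
  rewrite kermx_eq0 /row_free neq_ltn; apply/orP; left.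
  exact: leq_ltn_trans (rank_leq_col A) mn.
case/rowV0Pn => v /sub_kermxP vA v0.
exists (fun k => v 0 k); split.
  by have /rV0Pn[k vk] := v0; exists k.
exists (fun y => \sum_(k < n) v 0 k * u k y).
  apply: hol_sum => k; apply: holM; first exact: hol_cst.
  by have [] := H k.
move=> y; have E k : v 0 k * b k y =
    \sum_(j < m) (v 0 k * A k j) * (y - z) ^+ j + (y - z) ^+ m * (v 0 k * u k y).
  have [_ ->] := H k; rewrite mulrDr mulr_sumr mulrCA; congr (_ + _).
  by apply: eq_bigr => j _; rewrite mxE mulrA.
under eq_bigr do rewrite E.
rewrite big_split /= -mulr_sumr exchange_big /= big1 ?add0r // => j _.
have : (v *m A) 0 j = 0 by rewrite vA mxE.
by rewrite -mulr_suml mxE => ->; rewrite mul0r.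
Qed.

End LocalTheory.

(** * Functions on a closed Riemann surface *)

Local Notation dom i := (chart_dom (curve_chart i)).
Local Notation coord i := (chart_map (curve_chart i)).
Local Notation inv i := (chart_inv (curve_chart i)).

Section Surface.
Variables (R : realType) (X : complex_curve R).
Local Notation C := (R[i]^o).
Implicit Types (i j : curve_index X) (c x y : X) (F G : X -> C) (P Q : X -> Prop).

Lemma dom_near i c : dom i c -> \forall y \near c, dom i y.
Proof.
move=> ic; apply: open_nbhs_nbhs; split => //.
exact: (chart_dom_open (curve_chart i)).
Qed.

Lemma coordK i c : dom i c -> inv i (coord i c) = c.
Proof. exact: (chart_mapK (c := curve_chart i)). Qed.

Lemma coord_near i c (S : C -> Prop) : dom i c ->
  (\forall z \near coord i c, S z) -> \forall y \near c, S (coord i y).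
Proof. by move=> ic; exact: (chart_map_continuous ic). Qed.

Lemma inv_near i c P : dom i c -> (\forall y \near c, P y) ->
  \forall z \near coord i c,
    [/\ dom i (inv i z), coord i (inv i z) = z & P (inv i z)].
Proof.
move=> ic cP.
have H1 : \forall z \near coord i c, P (inv i z).
  by apply: (chart_inv_continuous ic); rewrite (coordK ic).
have H2 : nbhs (coord i c) (coord i @` dom i).
  apply: open_nbhs_nbhs; split; last by exists c.
  exact: chart_img_open.
apply: nearS2 H1 H2 => z Pz [y iy yz]; move: Pz; rewrite -yz (coordK iy) => Pz.
by split.
Qed.

Lemma coord_inj i x y : dom i x -> dom i y -> coord i x = coord i y -> x = y.
Proof. by move=> ix iy E; rewrite -(coordK ix) E (coordK iy). Qed.

Definition differentiable_at F c : Prop :=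
  forall i, dom i c -> exists d, cder (fun z => F (inv i z)) (coord i c) d.

Lemma compat_cder i j c : dom i c -> dom j c ->
  cder (fun z => coord j (inv i z)) (coord i c)
    (dz (fun z => coord j (inv i z)) (coord i c)).
Proof. by move=> ic jc; apply: derivable_dz; exact: curve_compat. Qed.

Lemma change_chart F i j c d : dom i c -> dom j c ->
  cder (fun z => F (inv i z)) (coord i c) d ->
  cder (fun z => F (inv j z)) (coord j c)
    (d * dz (fun z => coord i (inv j z)) (coord j c)).
Proof.
move=> ic jc; rewrite -{1}(coordK jc) => dF.
have := cder_comp (g := fun z => coord i (inv j z)) (compat_cder jc ic) dF.
apply: near_cder; apply: nearS (inv_near jc (dom_near ic)) => z [_ _ iz].
by rewrite (coordK iz).
Qed.

Lemma differentiable_at1 F i c : dom i c ->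
  (exists d, cder (fun z => F (inv i z)) (coord i c) d) -> differentiable_at F c.
Proof. by move=> ic [d dF] j jc; eexists; exact: change_chart dF. Qed.

Lemma Dat_near F G c : (\forall y \near c, F y = G y) ->
  differentiable_at F c -> differentiable_at G c.
Proof.
move=> FG dF i ic; have [d fd] := dF i ic; exists d; apply: near_cder fd.
by apply: nearS (inv_near ic FG) => z [].
Qed.

Lemma Dat_cst (k : C) c : differentiable_at (fun=> k) c.
Proof. by move=> i ic; exists 0; exact: cder_cst. Qed.

Lemma DatD F G c : differentiable_at F c -> differentiable_at G c ->
  differentiable_at (fun y => F y + G y) c.
Proof.
by move=> dF dG i ic; have [a fa] := dF i ic; have [b gb] := dG i ic;
  eexists; exact: (cderD fa gb).
Qed.

Lemma DatB F G c : differentiable_at F c -> differentiable_at G c ->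
  differentiable_at (fun y => F y - G y) c.
Proof.
by move=> dF dG i ic; have [a fa] := dF i ic; have [b gb] := dG i ic;
  eexists; exact: (cderB fa gb).
Qed.

Lemma DatM F G c : differentiable_at F c -> differentiable_at G c ->
  differentiable_at (fun y => F y * G y) c.
Proof.
by move=> dF dG i ic; have [a fa] := dF i ic; have [b gb] := dG i ic;
  eexists; exact: (cderM fa gb).
Qed.

Lemma Dat_coord i c : dom i c -> differentiable_at (coord i) c.
Proof. by move=> ic j jc; eexists; exact: compat_cder. Qed.

Lemma Dat_cont F c (S : C -> Prop) : differentiable_at F c ->
  (\forall z \near F c, S z) -> \forall y \near c, S (F y).
Proof.
move=> dF FS; have [i ic] := curve_cover c; have [d fd] := dF i ic.
have FS' : \forall z \near F (inv i (coord i c)), S z by rewrite (coordK ic).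
have H := near_ccont (cder_cont fd) FS'.
apply: filterS2 (coord_near ic H) (dom_near ic) => y + iy.
by rewrite (coordK iy).
Qed.

Lemma hol_of_near F i c : dom i c -> (\forall y \near c, differentiable_at F y) ->
  hol (fun z => F (inv i z)) (coord i c).
Proof.
move=> ic H; rewrite /hol; apply: nearS (inv_near ic H) => z [iz E dF].
have [d fd] := dF i iz; rewrite E in fd; exact: cder_derivable fd.
Qed.

Definition pnear c P : Prop := \forall y \near c, y <> c -> P y.

Lemma pnearS P Q c : (forall y, P y -> Q y) -> pnear c P -> pnear c Q.
Proof. by move=> PQ; rewrite /pnear; apply: filterS => y yP /yP/PQ. Qed.

Lemma pnear2 P Q c : pnear c P -> pnear c Q -> pnear c (fun y => P y /\ Q y).
Proof. by rewrite /pnear; apply: filterS2 => y yP yQ yc; split; [exact: yP|exact: yQ]. Qed.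

Lemma near_pnear P c : (\forall y \near c, P y) -> pnear c P.
Proof. by rewrite /pnear; apply: filterS => y Py _. Qed.

Lemma pnearN (P Q S : X -> Prop) c : (forall y, y <> c -> P y -> Q y -> S y) ->
  pnear c P -> (\forall y \near c, Q y) -> pnear c S.
Proof.
move=> PQS; rewrite /pnear; apply: filterS2 => y yP Qy yc.
exact: PQS yc (yP yc) Qy.
Qed.

Lemma inv_pnear i c P : dom i c -> pnear c P ->
  \forall z \near coord i c, z != coord i c ->
    [/\ dom i (inv i z), coord i (inv i z) = z & P (inv i z)].
Proof.
move=> ic H; apply: nearS (inv_near ic H) => z [iz E zP] zc; split => //.
by apply: zP => Ec; move: zc; rewrite -E Ec eqxx.
Qed.

Lemma coord_pnear i c (S : C -> Prop) : dom i c ->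
  (\forall z \near coord i c, z != coord i c -> S z) ->
  pnear c (fun y => S (coord i y)).
Proof.
move=> ic H; apply: filterS2 (coord_near ic H) (dom_near ic) => y yS iy yc.
by apply: yS; apply/eqP => E; apply: yc; exact: coord_inj E.
Qed.

Lemma pnear_exists P c : pnear c P -> exists y, y <> c /\ P y.
Proof.
move=> H; have [i ic] := curve_cover c.
have /nearCP[r r0 rP] := inv_pnear ic H.
have yz : cabs (coord i c + (r / 2)%:C%C - coord i c) = r / 2.
  by rewrite [_ + (_)%:C%C]addrC addrK cabs_real gtr0_norm // divr_gt0.
have yc : coord i c + (r / 2)%:C%C != coord i c.
  by rewrite -subr_eq0 -cabs_eq0 yz gt_eqF // divr_gt0.
have [|_ E Py] := rP _ _ yc; first by rewrite yz; lra.
exists (inv i (coord i c + (r / 2)%:C%C)); split => // Ec.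
by move: yc; rewrite -{1}E Ec eqxx.
Qed.

Hypothesis hX : closed_riemann_surface X.

Lemma separate x y : x <> y -> \forall x' \near x, x' <> y.
Proof.
move=> xy; have [hH _ _] := hX.
have /eqP/(hausdorff_accessible hH)[A [oA]] := xy.
rewrite !inE => Ax Ay; apply: filterS (open_nbhs_nbhs (conj oA Ax)) => z Az zy.
by apply: Ay; rewrite -zy.
Qed.

Lemma clopen_connected (E : set X) : E !=set0 ->
  (forall c, E c -> \forall y \near c, E y) ->
  (forall c, (forall P, (\forall y \near c, P y) -> exists y, E y /\ P y) -> E c) ->
  forall c, E c.
Proof.
move=> E0 Eop Ecl c; have [_ _ cX] := hX.
suff -> : E = [set: X] by [].
apply: cX => //; exists E; rewrite ?setTI //.
by rewrite openE => y /Eop.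
Qed.

Lemma finite_of_pnear (A : set X) : (forall c, pnear c (fun y => ~ A y)) ->
  finite_set A.
Proof.
move=> HA; have [_ cX _] := hX.
(* The filter of large finite sets: the near-covering form of compactness, applied to the property
   [A y -> D y], yields one finite set that contains [A]. *)
pose F : set_system (set X) := fun S =>
  exists2 D0, finite_set D0 & forall D, finite_set D -> D0 `<=` D -> S D.
have FF : Filter F.
  split=> [|S S' [D1 f1 H1] [D2 f2 H2]|S S' SS' [D1 f1 H1]].
  - by exists set0.
  - exists (D1 `|` D2) => [|D fD]; first by rewrite finite_setU.
    by rewrite subUset => -[D1D D2D]; split; [exact: H1|exact: H2].
  - by exists D1 => // D fD D1D; apply: SS'; exact: H1.
have /compact_near_coveringP/(_ _ F (fun D y => A y -> D y) FF) := cX.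
case=> [c _|D0 f0 H]; last first.
  by apply: sub_finite_set (f0) => y Ay; exact: (H D0).
exists ([set y | y <> c -> ~ A y], [set D : set X | D c]).
  split=> //=; first exact: HA.
  by exists [set c]; [exact: finite_set1|move=> D _; apply].
move=> [y D] [/= yA Dc] Ay; have [->//|/eqP yc] := eqVneq y c.
by case: (yA yc).
Qed.

(** The value of [F] at an isolated point may be meaningless, so [F] is replaced by the function
    [Ft] of its limits, which is differentiable everywhere. Its modulus has a maximum by
    compactness, and the set where [Ft] takes its value at the maximum is open by [strong_max] and
    closed by continuity. *)
Lemma liouville F : (forall c, pnear c (differentiable_at F)) ->
  (forall c, exists M : R, pnear c (fun y => cabs (F y) <= M)) ->
  exists k : C, forall c, pnear c (fun y => F y = k).
Proof.
move=> dF bF.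
have /choice[ch chP] : forall c, exists i, dom i c by exact: curve_cover.
have /choice[g gP] : forall c, exists g : C -> C, hol g (coord (ch c) c) /\
    pnear c (fun y => g (coord (ch c) y) = F y).
  move=> c; have ic := chP c; have [M bM] := bF c.
  have [||g hg gE] := @removable R (fun z => F (inv (ch c) z)) (coord (ch c) c).
  - apply: nearS (inv_pnear ic (dF c)) => z H /H[iz E dz].
    by have [d fd] := dz _ iz; rewrite E in fd; exact: cder_derivable fd.
  - by exists M; apply: nearS (inv_pnear ic bM) => z H /H[].
  exists g; split; first exact: hg.
  apply: pnearN (coord_pnear ic gE) (dom_near ic) => y _ yE iy.
  by rewrite yE (coordK iy).
pose Ft c := g c (coord (ch c) c).
have FtE c : \forall y \near c, Ft y = g c (coord (ch c) y).
  have [hg gE] := gP c; have ic := chP c.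
  have hgy := coord_near ic (hol_hol hg).
  have gE' : \forall y \near c, \forall x \near y, x <> c -> g c (coord (ch c) x) = F x.
    by move: gE; rewrite /pnear => /nbhs_interior.
  apply: filterS3 (dom_near ic) hgy gE' => y iy hgy {}gE.
  have [->//|/eqP yc] := eqVneq y c.
  have {}gE : \forall x \near y, g c (coord (ch c) x) = F x.
    by apply: filterS2 gE (separate yc) => x H /H.
  have [hgy' gE''] := gP y; have iy' := chP y.
  rewrite /Ft; apply/esym.
  have E1 : g c (coord (ch c) y) = (fun z => g c (coord (ch c) (inv (ch y) z))) (coord (ch y) y).
    by rewrite /= (coordK iy').
  rewrite E1; apply: (@ccont_uniq R (fun z => g c (coord (ch c) (inv (ch y) z))) (g y)).
  - apply: (@ccont_comp R (g c) (fun z => coord (ch c) (inv (ch y) z))).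
      by apply: cder_cont; exact: compat_cder iy' iy.
    by rewrite (coordK iy'); exact: hol_cont.
  - exact: hol_cont.
  apply: nearS2 (inv_pnear iy' gE'') (inv_near iy' gE) => z H [iz E Hz] zy.
  by have [_ _ {}H] := H zy; rewrite Hz -H E.
have dFt c : differentiable_at Ft c.
  have [hg _] := gP c; have ic := chP c.
  apply: (@Dat_near (fun y => g c (coord (ch c) y))).
    by apply: filterS (FtE c) => y ->.
  apply: (differentiable_at1 ic); have dg := hol_cder hg.
  eexists; apply: near_cder dg.
  by apply: nearS (inv_near ic (dom_near ic)) => z [_ -> _].
have FtF c : pnear c (fun y => F y = Ft y).
  have [_ gE] := gP c.
  by apply: pnearN gE (FtE c) => y _ <- ->.
(* The maximum needs a point, and connectedness does not exclude an empty [X]. *)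
have [[x0 _]|X0] := pselect (exists x : X, True); last first.
  by exists 0 => c; case: X0; exists c.
have cFt : continuous (fun c => cabs (Ft c)).
  move=> c A /nbhs_ballP[e /= e0 eA]; change (\forall y \near c, A (cabs (Ft y))).
  have H := Dat_cont (dFt c) (near_cabs (Ft c) e0).
  apply: filterS H => y yc; apply: eA; rewrite /ball /=.
  have := cabs_dist (Ft y) (Ft c); have := cabs_dist (Ft c) (Ft y).
  by rewrite ltr_norml (cabs_distC (Ft c)); lra.
have [_ cX _] := hX.
have [||m _ mP] := @compact_EVT_max X R (fun c => cabs (Ft c)) [set: X] _ cX.
- by exists x0.
- exact: continuous_subspaceT.
have {}mP y : cabs (Ft y) <= cabs (Ft m) by apply: mP; rewrite inE.
have cst : forall c, Ft c = Ft m.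
  apply: (clopen_connected (E := [set c | Ft c = Ft m])) => [|c /= Ec|c H /=].
  - by exists m.
  - have ic := chP c.
    have hF : hol (fun z => Ft (inv (ch c) z)) (coord (ch c) c).
      by apply: hol_of_near => //; near=> y; exact: dFt.
    have /nearCP[r r0 rP] := hF.
    have Ec' : Ft (inv (ch c) (coord (ch c) c)) = Ft m by rewrite (coordK ic).
    have const : \forall z \near coord (ch c) c, Ft (inv (ch c) z) = Ft m.
      apply/nearCP; exists r => // z zr; rewrite -Ec'.
      apply: (@strong_max R (fun z => Ft (inv (ch c) z)) _ r) => // y yr.
        by apply/derivableCP; exact: rP.
      by rewrite Ec'; exact: mP.
    apply: filterS2 (coord_near ic const) (dom_near ic) => y + iy.
    by rewrite (coordK iy).
  apply/eqP; rewrite -subr_eq0; apply/eqP; apply: cabs_small_eq0 => e e0.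
  have [y [/= <- yP]] := H _ (Dat_cont (dFt c) (near_cabs (Ft c) e0)).
  by rewrite cabs_distC ltW.
exists (Ft m) => c; apply: pnearS (FtF c) => y ->.
exact: cst.
Unshelve. all: by end_near. Qed.

Lemma liouville_zero F c0 : (forall c, pnear c (differentiable_at F)) ->
  (forall c, exists M : R, pnear c (fun y => cabs (F y) <= M)) ->
  (forall e : R, 0 < e -> pnear c0 (fun y => cabs (F y) <= e)) ->
  forall c, pnear c (fun y => F y = 0).
Proof.
move=> dF bF F0; have [k kP] := liouville dF bF.
suff k0 : k = 0 by rewrite k0 in kP.
apply: cabs_small_eq0 => e /F0 He.
by have [y [_ [+ <-]]] := pnear_exists (pnear2 He (kP c0)).
Qed.

End Surface.

(** * The involution and its quotient *)

Section Involution.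
Variables (R : realType) (X : complex_curve R).
Local Notation C := (R[i]^o).
Implicit Types (i j : curve_index X) (c x y : X) (F G : X -> C) (P Q : X -> Prop).

Hypothesis hX : closed_riemann_surface X.

Lemma separate2 x y : x <> y -> exists P Q : X -> Prop,
  [/\ \forall x' \near x, P x', \forall y' \near y, Q y' & forall z, P z -> ~ Q z].
Proof.
move=> /eqP xy; have [hH _ _] := hX.
rewrite open_hausdorff in hH; have [[A B] /= [xA yB] [oA oB /eqP AB]] := hH x y xy.
rewrite !inE in xA yB; exists A, B; split.
- exact: open_nbhs_nbhs.
- exact: open_nbhs_nbhs.
by move=> z Az Bz; have : set0 z by rewrite -AB.
Qed.

Variable s : X -> X.
Hypothesis hs : holomorphic_map s.

Lemma map_near c P : (\forall y \near s c, P y) -> \forall y \near c, P (s y).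
Proof. by have [cs _] := hs; exact: cs. Qed.

Lemma map_cder i j c : dom i c -> dom j (s c) ->
  cder (fun z => coord j (s (inv i z))) (coord i c)
    (dz (fun z => coord j (s (inv i z))) (coord i c)).
Proof. by move=> ic jc; apply: derivable_dz; have [_ H] := hs; exact: H. Qed.

Lemma map_inv_near i j c : dom i c -> dom j (s c) ->
  \forall z \near coord i c,
    [/\ dom i (inv i z), coord i (inv i z) = z & dom j (s (inv i z))].
Proof.
move=> ic jc; have H := @map_near c (fun y => dom j y) (dom_near jc).
exact: (inv_near ic H).
Qed.

Lemma map_hol i j c : dom i c -> dom j (s c) ->
  hol (fun z => coord j (s (inv i z))) (coord i c).
Proof.
move=> ic jc; rewrite /hol; apply: nearS (map_inv_near ic jc) => z [iz E jz].
by have := map_cder iz jz; rewrite E => /cder_derivable.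
Qed.

Lemma Dat_map F c : differentiable_at F (s c) -> differentiable_at (fun y => F (s y)) c.
Proof.
move=> dF i ic; have [j jc] := curve_cover (s c); have [d fd] := dF j jc.
have E : coord j (s c) = (fun z => coord j (s (inv i z))) (coord i c) by rewrite /= (coordK ic).
rewrite E in fd; have H := cder_comp (map_cder ic jc) fd.
eexists; apply: near_cder H.
by apply: nearS (map_inv_near ic jc) => z [_ _ jz]; rewrite (coordK jz).
Qed.

Lemma not_fixed_near c : s c <> c -> \forall y \near c, s y <> y.
Proof.
move=> /separate2[P [Q [sP cQ PQ]]].
by apply: filterS2 (map_near sP) cQ => y Py Qy E; apply: (PQ (s y)); rewrite // E.
Qed.

Hypothesis ss : s \o s = id.
Hypothesis s1 : s <> id.

Lemma involutionK y : s (s y) = y.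
Proof. by have := congr1 (@^~ y) ss. Qed.

Lemma involution_inj x y : s x = s y -> x = y.
Proof. by move=> E; rewrite -(involutionK x) E involutionK. Qed.

Lemma map_pnear c P : pnear (s c) P -> pnear c (fun y => P (s y)).
Proof.
move=> /map_near; rewrite /pnear; apply: filterS => y H yc; apply: H.
by move/involution_inj.
Qed.

Local Notation st i := (fun z => coord i (s (inv i z))).

(** In the coordinate, [z + s z] has derivative 2, hence is injective near [c]; it takes the same
    value at [z] and at [s z], so these agree. *)
Lemma fixed_tangent_id i c : dom i c -> s c = c -> dz (st i) (coord i c) = 1 ->
  \forall y \near c, s y = y.
Proof.
move=> ic sc d1; have ic' : dom i (s c) by rewrite sc.
have hst := map_hol ic ic'.
have hxi := holD (hol_id (coord i c)) hst.
have dxi := cder_dz (cderD (cder_id (coord i c)) (hol_cder hst)).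
rewrite d1 in dxi.
have [|r r0 inj] := locally_injective hxi; first by rewrite dxi (_ : 1 + 1 = 2%:R) // pnatr_eq0.
have stc : st i (coord i c) = coord i c by rewrite (coordK ic) sc.
have near_r : \forall z \near coord i c, cabs (st i z - coord i c) < r.
  have H0 : \forall w \near st i (coord i c), cabs (w - coord i c) < r.
    by rewrite stc; exact: near_cabs.
  exact: (near_ccont (hol_cont hst) H0).
have H : \forall z \near coord i c, dom i (inv i z) -> s (inv i z) = inv i z.
  have near_r' := near_cabs (coord i c) r0.
  apply: nearS2 (map_inv_near ic ic') (nearS2 (fun z => @conj _ _) near_r near_r').
  move=> z [iz zE isz] [zr zr'] _.
  have E : coord i (s (inv i z)) = z.
    apply: inj => //; rewrite (coordK isz) involutionK zE; exact: addrC.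
  by apply: (coord_inj isz iz); rewrite E zE.
apply: filterS2 (coord_near ic H) (dom_near ic) => y + iy.
by rewrite (coordK iy) => /(_ iy).
Qed.

(** The set of points near which [s] is the identity is closed: at a limit point [x], [s x = x], and
    [s] has derivative 1 by continuity of the derivative, so that [fixed_tangent_id] applies. *)
Lemma fixed_near_eq0 c : ~ \forall y \near c, s y = y.
Proof.
move=> H0; apply: s1; apply/funext => y.
suff : \forall x \near y, s x = x by exact: nbhs_singleton.
apply: (clopen_connected hX (E := [set c | \forall y \near c, s y = y])).
- by exists c.
- by move=> x /= /nbhs_interior.
move=> x H /=; have sx : s x = x.
  by apply: contrapT => /not_fixed_near/H[z [/nbhs_singleton]].
have [i ix] := curve_cover x; have ix' : dom i (s x) by rewrite sx.
apply: (fixed_tangent_id ix sx); apply/eqP; rewrite -subr_eq0; apply/eqP.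
apply: cabs_small_eq0 => e e0; have hst := map_hol ix ix'.
have [r r0 rP] := dz_cont hst e0.
have [z [/= zs [zr iz]]] := H _ (filterI (coord_near ix (near_cabs (coord i x) r0)) (dom_near ix)).
have dz1 : dz (st i) (coord i z) = 1.
  apply: cder_dz; apply: near_cder (cder_id (coord i z)).
  by apply: nearS (inv_near iz zs) => w [_ wE ->]; rewrite wE.
by have := rP _ zr; rewrite dz1 cabs_distC => /ltW.
Qed.

(** The derivative has square 1, and the value 1 would make [s] the identity near [c]. *)
Lemma fixed_dz i c : dom i c -> s c = c -> dz (st i) (coord i c) = -1.
Proof.
move=> ic sc; have ic' : dom i (s c) by rewrite sc.
have hst := map_hol ic ic'.
have stc : coord i c = st i (coord i c) by rewrite (coordK ic) sc.
have dst := hol_cder hst; have dst' := dst; rewrite [X in cder _ X]stc in dst'.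
have H := cder_comp dst dst'.
have {}H : cder id (coord i c) (dz (st i) (coord i c) * dz (st i) (coord i c)).
  apply: near_cder H; apply: nearS (map_inv_near ic ic') => z [iz zE isz].
  by rewrite (coordK isz) involutionK zE.
have := cder_uniq H (cder_id _); rewrite -expr2 => /eqP; rewrite sqrf_eq1.
by case/orP => /eqP // /(fixed_tangent_id ic sc)/fixed_near_eq0.
Qed.

(** At a fixed point, [s z - z] has derivative [-2] in the coordinate, so it is injective nearby. *)
Lemma fixed_isolated c : pnear c (fun y => s y <> y).
Proof.
have [sc|/not_fixed_near/near_pnear//] := pselect (s c = c).
have [i ic] := curve_cover c; have ic' : dom i (s c) by rewrite sc.
have hst := map_hol ic ic'; have hd := holB hst (hol_id (coord i c)).
have dE : dz (fun z => st i z - id z) (coord i c) = -1 - 1.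
  by rewrite (cder_dz (cderB (hol_cder hst) (cder_id _))) fixed_dz.
have [|r r0 inj] := locally_injective hd.
  by rewrite dE -opprD oppr_eq0 (_ : 1 + 1 = 2%:R) // pnatr_eq0.
have near_r := coord_near ic (near_cabs (coord i c) r0).
apply: pnearN (near_pnear near_r) (dom_near ic) => y yc yr iy sy; apply: yc.
apply: (coord_inj iy ic); apply: inj => //; first by rewrite subrr cabs0.
by rewrite /= !(coordK ic) !(coordK iy) sc sy !subrr.
Qed.

Lemma fixed_finite : finite_set [set y | s y = y].
Proof. by apply: (finite_of_pnear hX) => c; exact: fixed_isolated. Qed.

(** As the derivative is [-1], distances to [c] shrink at most by half; this transfers the bound on
    a pole of [f] at [c] to [f o s]. *)
Lemma fixed_quotient i c : dom i c -> s c = c ->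
  \forall y \near c, dom i y /\
    cabs (coord i y - coord i c) / 2 <= cabs (coord i (s y) - coord i c).
Proof.
move=> ic sc; have ic' : dom i (s c) by rewrite sc.
have hst := map_hol ic ic'.
have := hol_cder hst => /cderCP/(_ 2^-1)[|r r0 rP]; first by rewrite invr_gt0.
apply: filterS2 (coord_near ic (near_cabs (coord i c) r0)) (dom_near ic).
move=> y /rP + iy; rewrite !(coordK ic) (coordK iy) fixed_dz // sc => H; split=> //.
move: H; rewrite mulN1r opprK.
set a := coord i (s y) - _; set b := coord i y - _ => H.
by have := cabsB (a + b) a; rewrite addrAC subrr add0r; lra.
Qed.

End Involution.

(** * The coordinates of the sphere as functions on the surface *)

Section Quotient.
Variables (R : realType) (X : complex_curve R).
Local Notation C := (R[i]^o).
Implicit Types (i k : curve_index X) (j : bool) (c x y : X) (F G : X -> C).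

Local Notation sdom j := (chart_dom (sphere_chart R j)).

Lemma holomorphic_on_at (Y : complex_curve R) (U : set Y) (f : Y -> C) :
  holomorphic_on U f <-> forall y : Y, U y -> differentiable_at f y.
Proof.
split=> [H y Uy i iy|H i y Uy iy].
  by apply/derivableCP; exact: H.
by apply/derivableCP; exact: H.
Qed.

Lemma transition_neq0 i k c : dom i c -> dom k c ->
  dz (fun z => coord k (inv i z)) (coord i c) != 0.
Proof.
move=> ic kc; have d1 := compat_cder ic kc; have d2 := compat_cder kc ic.
rewrite -[in X in cder _ X](coordK ic) in d2.
have H := cder_comp d1 d2; apply/eqP => E; rewrite E mulr0 in H.
have {}H : cder id (coord i c) 0.
  apply: near_cder H; apply: nearS (inv_near ic (dom_near kc)) => z [iz zE kz].
  by rewrite (coordK kz).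
by have /eqP := cder_uniq (cder_id _) H; rewrite oner_eq0.
Qed.

Hypothesis hX : closed_riemann_surface X.
Variable s : X -> X.
Hypothesis hs : holomorphic_map s.
Hypothesis ss : s \o s = id.
Hypothesis s1 : s <> id.
Variable p : X -> riemann_sphere R.
Hypothesis hp : is_involution_quotient s p.

Definition sphere_coord j y : C := sphere_chart R j (p y).
Local Notation u := sphere_coord.

Lemma quotient_map y : p (s y) = p y.
Proof. by have [_ H _ _] := hp; apply/esym/H; right. Qed.

Lemma quotient_fiber x y : p x = p y -> y = x \/ y = s x.
Proof. by have [_ H _ _] := hp => /H. Qed.

Lemma sphere_coord_map j y : u j (s y) = u j y.
Proof. by rewrite /sphere_coord quotient_map. Qed.

Lemma quotient_near c (S' : riemann_sphere R -> Prop) :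
  (\forall o \near p c, S' o) -> \forall y \near c, S' (p y).
Proof.
have [_ _ H _] := hp => /nbhs_interior.
rewrite nbhsE => -[U [oU Uc] US].
have oV : open (p @^-1` U) by apply/H.
apply: filterS (open_nbhs_nbhs (conj oV Uc)) => y /US.
exact: nbhs_singleton.
Qed.

Lemma sphere_dom_near j c : sdom j (p c) -> \forall y \near c, sdom j (p y).
Proof. by move=> jc; apply: quotient_near; exact: (@dom_near R (riemann_sphere R) j). Qed.

Lemma Dat_sphere_coord j c : sdom j (p c) -> differentiable_at (u j) c.
Proof.
move=> jc; have [_ _ _ H] := hp.
have oj : open (sdom j) := chart_dom_open (sphere_chart R j).
have : holomorphic_on (p @^-1` sdom j) (sphere_chart R j \o p).
  apply/(H (sdom j) (sphere_chart R j) oj) => l o oj' ol.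
  exact: sphere_compat.
by move=> /holomorphic_on_at; apply.
Qed.

Lemma sphere_coord_hol i j c : dom i c -> sdom j (p c) ->
  hol (fun z => u j (inv i z)) (coord i c).
Proof.
move=> ic jc; apply: (hol_of_near ic).
by apply: filterS (sphere_dom_near jc) => y; exact: Dat_sphere_coord.
Qed.

(** The clause on holomorphic functions in [is_involution_quotient] turns invariant functions into
    functions on the sphere. Applied to well-chosen [N], this shows that the derivative of [u j]
    does not vanish to too high an order. *)
Lemma descend (V : set X) (N : X -> C) j c :
  open V -> (forall y, V y -> V (s y)) -> (forall y, V y -> N (s y) = N y) ->
  (forall y, V y -> differentiable_at N y) -> V c -> sdom j (p c) ->
  exists2 H : C -> C, hol H (u j c) & \forall y \near c, N y = H (u j y).
Proof.
move=> oV Vs Ns dN Vc jc; have [_ pE pop phol] := hp.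
(* [h] picks any preimage in [V], which is harmless since [N] is invariant; the default [c] matters
   off [U] only. *)
pose U := p @` V; pose h o := N (xget c [set y | V y /\ p y = o]).
have UV : p @^-1` U = V.
  apply/seteqP; split=> [y [y' Vy' /quotient_fiber[->//|->]]|y Vy]; first exact: Vs.
  by exists y.
have oU : open U by apply/pop; rewrite UV.
have hE y : V y -> h (p y) = N y.
  move=> Vy; rewrite /h; case: xgetP => [y' _ [Vy' /quotient_fiber[->//|->]]|/(_ y) []//].
  by rewrite Ns.
have : holomorphic_on (p @^-1` U) (h \o p).
  rewrite UV; apply/holomorphic_on_at => y Vy; apply: (@Dat_near R X N); last exact: dN.
  by apply: filterS (open_nbhs_nbhs (conj oV Vy)) => y' Vy'; rewrite /= hE.
move=> /(phol U h oU)/holomorphic_on_at hU.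
exists (fun z => h (chart_inv (sphere_chart R j) z)).
  apply: (@hol_of_near R (riemann_sphere R) h j) => //.
  have Uc : U (p c) by exists c.
  by apply: filterS (open_nbhs_nbhs (conj oU Uc)) => o; exact: hU.
apply: filterS2 (sphere_dom_near jc) (open_nbhs_nbhs (conj oV Vc)) => y jy Vy.
by rewrite /sphere_coord (@coordK R (riemann_sphere R) j _ jy) hE.
Qed.

Definition dsphere i j y : C := dz (fun z => u j (inv i z)) (coord i y).
Local Notation du := dsphere.

(** A small neighbourhood [V0] of [c] is disjoint from its image by [s]. The coordinate on [V0],
    carried over to that image, is an invariant function; hence [coord i = H o u j] near [c], and
    the chain rule gives [1 = H' * du]. *)
Lemma du_neq0 i j c : dom i c -> sdom j (p c) -> s c <> c -> du i j c != 0.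
Proof.
move=> ic jc sc; have [P0 [Q0 [cP sQ PQ]]] := separate2 hX (nesym sc).
pose V0 : set X := interior [set y | [/\ dom i y, P0 y & Q0 (s y)]].
have oV0 : open V0 by exact: open_interior.
have V0P y : V0 y -> [/\ dom i y, P0 y & Q0 (s y)] by move/interior_subset.
have V0c : V0 c.
  rewrite /V0 /interior /=; apply: filterS3 (dom_near ic) cP (map_near hs sQ) => y *.
  by split.
have oV1 : open (s @^-1` V0).
  by have [/continuousP cs _] := hs; exact: cs.
have K := involutionK ss.
pose N y := if `[< V0 y >] then coord i y else coord i (s y).
have N0 y : V0 y -> N y = coord i y by move=> Vy; rewrite /N asboolT.
have N1 y : V0 (s y) -> N y = coord i (s y).
  move=> Vy; rewrite /N asboolF // => /V0P[_ Py _].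
  by have [_ _ +] := V0P _ Vy; rewrite K; exact: PQ.
have [|||||H hH NH] := @descend (V0 `|` s @^-1` V0) N j c _ _ _ _ _ jc.
- exact: openU.
- by move=> y [Vy|Vy]; [right; rewrite /= K|left].
- move=> y [Vy|Vy]; last by rewrite (N0 _ Vy) (N1 _ Vy).
  have Vy' : V0 (s (s y)) by rewrite K.
  by rewrite (N1 _ Vy') (N0 _ Vy) K.
- move=> y [Vy|Vy].
    apply: (@Dat_near R X (coord i)); last by apply: Dat_coord; have [] := V0P _ Vy.
    by apply: filterS (open_nbhs_nbhs (conj oV0 Vy)) => y' /N0.
  apply: (@Dat_near R X (fun y => coord i (s y))); last first.
    by apply: (@Dat_map R X s hs (coord i)); apply: Dat_coord; have [] := V0P _ Vy.
  by apply: filterS (open_nbhs_nbhs (conj oV1 Vy)) => y' /N1.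
- by left.
have hu := hol_cder (sphere_coord_hol ic jc).
have hH' := hol_cder hH; rewrite -[in X in cder _ X](coordK ic) in hH'.
have D := cder_comp hu hH'; apply/eqP => d0; rewrite -/(du i j c) d0 mulr0 in D.
have {}D : cder id (coord i c) 0.
  have E : \forall y \near c, coord i y = H (u j y).
    by apply: filterS2 (open_nbhs_nbhs (conj oV0 V0c)) NH => y /N0 <-.
  by apply: near_cder D; apply: nearS (inv_near ic E) => z [_ + <-] => ->.
by have /eqP := cder_uniq (cder_id _) D; rewrite oner_eq0.
Qed.

Lemma du_near i j c : dom i c -> sdom j (p c) -> s c <> c ->
  exists2 a : R, 0 < a & \forall y \near c, dom i y /\ a <= cabs (du i j y).
Proof.
move=> ic jc sc; have d0 := du_neq0 ic jc sc.
exists (cabs (du i j c) / 2); first by rewrite divr_gt0 // cabs_gt0.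
have [r r0 rP] := ccont_neq0 (dz_cont (sphere_coord_hol ic jc)) d0.
apply: filterS2 (coord_near ic (near_cabs (coord i c) r0)) (dom_near ic) => y yr iy.
by split=> //; apply/ltW/rP.
Qed.

Local Notation st i := (fun z => coord i (s (inv i z))).

(* Near a fixed point the product of a coordinate and its conjugate by [s]
   vanishes to order 2 and is a function of [u j]: so [d (u j)] vanishes to order
   at most 1. *)
Lemma du_near_fixed i j c : dom i c -> sdom j (p c) -> s c = c ->
  exists2 a : R, 0 < a & \forall y \near c,
    dom i y /\ a * cabs (coord i y - coord i c) <= cabs (du i j y).
Proof.
move=> ic jc sc; have ic' : dom i (s c) by rewrite sc.
have hst := map_hol hs ic ic'; set z0 := coord i c in hst *.
have stc : st i z0 = z0 by rewrite /z0 (coordK ic) sc.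
have K := involutionK ss.
pose V : set X := interior [set y | dom i y /\ dom i (s y)].
have oV : open V by exact: open_interior.
have VP y : V y -> dom i y /\ dom i (s y) by move/interior_subset.
have Vc : V c by rewrite /V /interior /=; apply: filterS2 (dom_near ic) (map_near hs (dom_near ic')).
pose N y := (coord i y - z0) * (coord i (s y) - z0).
have oV' : open (V `&` s @^-1` V).
  by apply: openI => //; have [/continuousP cs _] := hs; exact: cs.
have [||||H hH NH] := @descend (V `&` s @^-1` V) N j c oV' _ _ _ _ jc.
- by move=> y [Vy Vsy]; split => //=; rewrite K.
- by move=> y [Vy Vsy]; rewrite /N K mulrC.
- move=> y [/VP[iy isy] _]; apply: DatM.
    by apply: DatB; [exact: Dat_coord|exact: Dat_cst].
  apply: DatB; last exact: Dat_cst.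
  by apply: (@Dat_map R X s hs (coord i)); exact: Dat_coord.
- by split; rewrite //= sc.
pose q := dquo (st i) z0; have hq : hol q z0 := hol_dquo hst.
have q0 : q z0 = -1 by rewrite /q dquo_id fixed_dz.
have qE z : st i z = z0 + (z - z0) * q z by rewrite -{1}stc; exact: dquoE.
have cq := hol_cont hq; have cdq := hol_cont (hol_derive hq).
(* The product [N] is [(z - z0) ^+ 2 * q z] in the coordinate. Its derivative is [z - z0] times this
   function, whose value at [z0] is [q z0 + q z0 = -2]. *)
have cg : ccont (fun z => q z + (q z + (z - z0) * dz q z)) z0.
  apply: ccontD; first exact: cq.
  apply: ccontD; first exact: cq.
  apply: ccontM; last exact: cdq.
  by apply: ccontD; [exact: ccont_id|exact: ccont_cst].
have g1 : \forall z \near z0, 1 <= cabs (q z + (q z + (z - z0) * dz q z)).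
  have [r r0 rP] := cg _ ltr01; apply/nearCP; exists r => // z /rP.
  rewrite q0 subrr mul0r addr0; set w := q z + _ => H1.
  have := cabs_triangle (-1 + -1) w 0; rewrite !subr0 cabs_distC -opprD cabsN.
  have -> : cabs (1 + 1 : C) = 2.
    by rewrite (_ : 1 + 1 = 2%:C%C) ?cabs_real ?ger0_norm // rmorphD.
  by move: H1; rewrite -opprD; lra.
have [M [r1 [M0 r10 rM]]] := ccont_bounded (dz_cont hH).
have Hu : \forall y \near c, cabs (dz H (u j y)) <= M /\ derivable H (u j y) 1.
  have bH : \forall z \near u j c, cabs (dz H z) <= M by apply/nearCP; exists r1.
  have H1 := Dat_cont (Dat_sphere_coord jc) bH.
  have H2 := Dat_cont (Dat_sphere_coord jc) hH.
  by apply: filterS2 H1 H2.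
exists M^-1; first by rewrite invr_gt0.
have NE := nbhs_interior NH; have hq' := hol_derivable hq.
have hqn := coord_near ic (hol_hol hq).
have dj := sphere_dom_near jc.
apply: filterS3 (filterI Hu (filterI dj NE)) (filterI hqn (coord_near ic g1)) (dom_near ic).
move=> y [[HM dH] [jy Ny]] [hqy gy] iy; split=> //.
have dN1 : cder (fun z => N (inv i z)) (coord i y)
   (q (coord i y) * (coord i y - z0) + (coord i y - z0) * (q (coord i y) + (coord i y - z0) * dz q (coord i y))).
  have dzz : cder (fun z => z - z0) (coord i y) (1 - 0) := cderB (cder_id _) (cder_cst _ _).
  have := cderM dzz (cderM dzz (hol_cder hqy)).
  rewrite subr0 !mul1r => D.
  have {}D : cder (fun z => (z - z0) * ((z - z0) * q z)) (coord i y)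
   (q (coord i y) * (coord i y - z0) + (coord i y - z0) * (q (coord i y) + (coord i y - z0) * dz q (coord i y))).
    by rewrite [q _ * (_ - _)]mulrC.
  apply: near_cder D; apply: nearS (inv_near iy (dom_near iy)) => z [_ zE _].
  by rewrite /N zE qE [z0 + _]addrC addrK.
have dN2 : cder (fun z => N (inv i z)) (coord i y) (dz H (u j y) * du i j y).
  have hu := hol_cder (sphere_coord_hol iy jy).
  have dH' := derivable_dz dH; rewrite -[in X in cder _ X](coordK iy) in dH'.
  have := cder_comp hu dH'; apply: near_cder.
  by apply: nearS (inv_near iy Ny) => z [_ _ ->].
have := cder_uniq dN1 dN2.
rewrite [q _ * _]mulrC -mulrDr => E.
have : cabs (coord i y - z0) <= M * cabs (du i j y).
  apply: (@le_trans _ _ (cabs (dz H (u j y) * du i j y))).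
    by rewrite -E cabsM ler_peMr ?cabs_ge0.
  by rewrite cabsM ler_wpM2r ?cabs_ge0.
by rewrite ler_pdivrMl.
Qed.

Lemma hol_linear_bound (f : C -> C) (z0 : C) : hol f z0 ->
  exists2 M : R, 0 < M & \forall z \near z0, cabs (f z - f z0) <= M * cabs (z - z0).
Proof.
move=> hf; have [M [r [M0 r0 H]]] := hol_lipschitz hf.
exists M => //; apply/nearCP; exists r => // z zr; apply: H => //.
by rewrite subrr cabs0.
Qed.

Lemma sphere_coord_linear i j c : dom i c -> sdom j (p c) ->
  exists2 M : R, 0 < M & \forall y \near c,
    dom i y /\ cabs (u j y - u j c) <= M * cabs (coord i y - coord i c).
Proof.
move=> ic jc; have [M M0 H] := hol_linear_bound (sphere_coord_hol ic jc).
exists M => //; apply: filterS2 (coord_near ic H) (dom_near ic) => y + iy.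
by rewrite (coordK iy) (coordK ic).
Qed.

(** Since [u j o s = u j] and [s] has derivative [-1] at [c], the derivative of [u j] at [c] is
    equal to its opposite. *)
Lemma sphere_coord_quadratic i j c : dom i c -> sdom j (p c) -> s c = c ->
  exists2 M : R, 0 < M & \forall y \near c,
    dom i y /\ cabs (u j y - u j c) <= M * cabs (coord i y - coord i c) ^+ 2.
Proof.
move=> ic jc sc; have ic' : dom i (s c) by rewrite sc.
have hu := sphere_coord_hol ic jc.
have d0 : dz (fun z => u j (inv i z)) (coord i c) = 0.
  have stc : coord i c = st i (coord i c) by rewrite (coordK ic) sc.
  have dst := map_cder hs ic ic'; have du' := hol_cder hu.
  rewrite [X in cder _ X]stc in du'; have D := cder_comp dst du'.
  rewrite fixed_dz // in D.
  have {}D : cder (fun z => u j (inv i z)) (coord i c)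
     (dz (fun z => u j (inv i z)) (coord i c) * -1).
    apply: near_cder D; apply: nearS (map_inv_near hs ic ic') => z [iz zE isz].
    by rewrite (coordK isz) sphere_coord_map.
  have := cder_uniq D (hol_cder hu); rewrite mulrN1 => /eqP.
  by rewrite eq_sym -subr_eq0 opprK -mulr2n mulrn_eq0 /= => /eqP.
have [M M0 H] := hol_linear_bound (hol_dquo hu); rewrite dquo_id d0 in H.
exists M => //; apply: filterS2 (coord_near ic H) (dom_near ic) => y + iy.
rewrite subr0 => {}H; split=> //.
have := dquoE (fun z => u j (inv i z)) (coord i c) (coord i y).
rewrite (coordK iy) (coordK ic) => ->; rewrite [u j c + _]addrC addrK cabsM.
by rewrite mulrC expr2 mulrA ler_wpM2r ?cabs_ge0.
Qed.

End Quotient.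

(** * Holomorphic 1-forms *)

Section Forms.
Variables (R : realType) (X : complex_curve R).
Local Notation C := (R[i]^o).
Implicit Types (i k : curve_index X) (j : bool) (c x y : X) (F G : X -> C) (w : one_form X).

Local Notation sdom j := (chart_dom (sphere_chart R j)).

Lemma form_hol w i c : dom i c -> hol (w i) (coord i c).
Proof.
move=> ic; rewrite /hol; apply: nearS (inv_near ic (dom_near ic)) => z [iz zE _].
by rewrite -zE; exact: form_holomorphic.
Qed.

Lemma form_transition w i k c : dom i c -> dom k c ->
  w i (coord i c) = w k (coord k c) * dz (fun z => coord k (inv i z)) (coord i c).
Proof. by move=> ic kc; rewrite dzE; exact: form_compat. Qed.

Lemma form_eq0 w i k c : dom i c -> dom k c ->
  w i (coord i c) = 0 -> w k (coord k c) = 0.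
Proof.
by move=> ic kc wi0; rewrite (form_transition w kc ic) wi0 mul0r.
Qed.

Lemma form_zerosP w i c : dom i c -> form_zeros w c <-> w i (coord i c) = 0.
Proof.
move=> ic; split=> [[k kc]|w0]; last by exists i.
exact: form_eq0.
Qed.

Hypothesis hX : closed_riemann_surface X.

Lemma form_order w i c : dom i c -> (\forall y \near c, form_zeros w y) \/
  exists n h, [/\ hol h (coord i c), h (coord i c) != 0 &
    forall z, w i z = (z - coord i c) ^+ n * h z].
Proof.
move=> ic; have [H|H] := order_of_vanishing (form_hol w ic); last by right.
left; apply: filterS2 (coord_near ic H) (dom_near ic) => y w0 iy.
exact/(form_zerosP w iy).
Qed.

(** Identity theorem: the set of points near which [w] vanishes identically is open and closed, and
    it misses [x0]. *)
Lemma form_zeros_isolated w : nonzero_form w ->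
  forall c, pnear c (fun y => ~ form_zeros w y).
Proof.
move=> [x0 x0P].
have zero_or c : (\forall y \near c, form_zeros w y) \/ pnear c (fun y => ~ form_zeros w y).
  have [i ic] := curve_cover c; have [H|[k [h [hh h0 wE]]]] := form_order w ic; first by left.
  right; have hn := near_neq0 (hol_cont hh) h0.
  apply: pnearN (near_pnear (coord_near ic hn)) (dom_near ic) => y yc hy iy.
  move/(form_zerosP w iy)/eqP; rewrite wE mulf_eq0 (negPf hy) orbF expf_eq0 subr_eq0.
  by move=> /andP[_ /eqP /(coord_inj iy ic)].
move=> c; have [H|//] := zero_or c; exfalso.
suff /nbhs_singleton : \forall y \near x0, form_zeros w y by [].
apply: (clopen_connected hX (E := [set c | \forall y \near c, form_zeros w y])).
- by exists c.
- by move=> y /= /nbhs_interior.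
move=> y Hy /=; have [//|Hn] := zero_or y.
have [z [/= zE zn]] := Hy _ Hn; have [zy|/zn] := pselect (z = y); first by rewrite -zy.
by have /nbhs_singleton := zE.
Qed.

Lemma form_zeros_finite w : nonzero_form w -> finite_set (form_zeros w).
Proof. by move=> w0; apply: (finite_of_pnear hX) => c; exact: form_zeros_isolated. Qed.

Definition chart_at c : curve_index X := sval (cid (curve_cover c)).

Lemma chart_atP c : dom (chart_at c) c.
Proof. exact: svalP (cid (curve_cover c)). Qed.

Variable s : X -> X.
Hypothesis hs : holomorphic_map s.
Hypothesis ss : s \o s = id.
Hypothesis s1 : s <> id.
Variable p : X -> riemann_sphere R.
Hypothesis hp : is_involution_quotient s p.

Local Notation u := (sphere_coord p).
Local Notation du := (dsphere p).

(* The quotient of the form [w] by [d (u j)], a function on [X]; junk over the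
   pole of [sphere_chart j] and at the fixed points of [s]. *)
Definition form_ratio w j y : C := w (chart_at y) (coord (chart_at y) y) / du (chart_at y) j y.
Local Notation ratio := form_ratio.

Lemma du_transition i k j c : dom i c -> dom k c -> sdom j (p c) ->
  du i j c = du k j c * dz (fun z => coord k (inv i z)) (coord i c).
Proof.
move=> ic kc jc; have H := hol_cder (sphere_coord_hol hp kc jc).
by have := cder_dz (change_chart kc ic H).
Qed.

Lemma ratioE w i j c : dom i c -> sdom j (p c) ->
  ratio w j c = w i (coord i c) / du i j c.
Proof.
move=> ic jc; have kc := chart_atP c; rewrite /form_ratio.
rewrite (form_transition w ic kc) (du_transition ic kc jc) invfM.
have t0 := transition_neq0 ic kc.
by rewrite mulrACA divff // mulr1.
Qed.

Lemma sdom_or j (o : riemann_sphere R) : sdom j o \/ sdom (~~ j) o.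
Proof.
case: j => /=; case: o => [z|] /=; rewrite /chart_dom /=.
- by right.
- by left.
- by left.
- by right.
Qed.

Lemma not_sdom_uniq j (o o' : riemann_sphere R) : ~ sdom j o -> ~ sdom j o' -> o = o'.
Proof. by case: j; rewrite /chart_dom /= => /contrapT -> /contrapT ->. Qed.

Lemma sphere_coord_inv j y : sdom j (p y) -> sdom (~~ j) (p y) ->
  u j y = (u (~~ j) y)^-1.
Proof.
rewrite /sphere_coord; case: j; case: (p y) => [z|] //= _ _.
by rewrite invrK.
Qed.

Lemma sphere_coord_inj j x y : sdom j (p x) -> sdom j (p y) -> u j x = u j y -> p x = p y.
Proof.
move=> jx jy; rewrite /sphere_coord => E.
rewrite -(@coordK R (riemann_sphere R) j _ jx) -(@coordK R (riemann_sphere R) j _ jy).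
by congr (chart_inv _ _).
Qed.

Lemma sphere_coord_pole j c : ~ sdom j (p c) -> u (~~ j) c = 0.
Proof.
by rewrite /sphere_coord; case: j; case: (p c) => [z|] //= /contrapT // [->].
Qed.

(** The fibre over the pole of the chart has at most two points, and fixed points are isolated. *)
Lemma good_near j c : pnear c (fun y => sdom j (p y) /\ s y <> y).
Proof.
apply: pnear2 (fixed_isolated hX hs ss s1 c).
have [jc|jc] := pselect (sdom j (p c)); first exact: (near_pnear (sphere_dom_near hp jc)).
have H : pnear c (fun y => y <> s c).
  have [sc|/nesym sc] := pselect (s c = c); last exact: (near_pnear (separate hX sc)).
  by rewrite /pnear sc; near=> y.
rewrite /pnear in H *; apply: filterS H => y H yc; apply: contrapT => jy.
have [E|E] := quotient_fiber hp (not_sdom_uniq jc jy); first exact: yc.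
exact: H.
Unshelve. all: by end_near. Qed.

(** From [u j = 1 / v] with [v = u (~~ j)] comes [d (u j) = - dv / v ^+ 2]. The factor [- v ^+ 2]
    vanishes at the pole of [u j]: this is why the functions built from ratios tend to 0 over
    infinity. *)
Lemma ratio_inv w j y : sdom j (p y) -> sdom (~~ j) (p y) ->
  ratio w j y = - u (~~ j) y ^+ 2 * ratio w (~~ j) y.
Proof.
move=> jy jy'; have iy := chart_atP y; set i := chart_at y in iy.
rewrite (ratioE w iy jy) (ratioE w iy jy').
have v0 : u (~~ j) y != 0.
  rewrite /sphere_coord; case: (j) jy jy'; case: (p y) => [z|] //=.
    by move=> H _; apply/eqP => z0; apply: H; rewrite z0.
  by move=> _ H; rewrite invr_eq0; apply/eqP => z0; apply: H; rewrite z0.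
have -> : du i j y = - du i (~~ j) y / u (~~ j) y ^+ 2.
  apply: cder_dz; have hv := hol_cder (sphere_coord_hol hp iy jy').
  have v0' : (fun z => u (~~ j) (inv i z)) (coord i y) != 0 by rewrite /= (coordK iy).
  have D := cderV v0' hv; rewrite (coordK iy) in D; apply: near_cder D.
  have H : \forall x \near y, sdom j (p x) /\ sdom (~~ j) (p x).
    exact: filterI (sphere_dom_near hp jy) (sphere_dom_near hp jy').
  apply: nearS (inv_near iy H) => z [_ _ [H1 H2]].
  by rewrite (sphere_coord_inv H1 H2).
(* Division by 0 gives 0, so both sides vanish at the zeros of [du]. *)
have [->|d0] := eqVneq (du i (~~ j) y) 0; first by rewrite oppr0 mul0r !invr0 !mulr0.
by field; rewrite v0 d0.
Qed.

Lemma Dat_ratio w j c : sdom j (p c) -> s c <> c -> differentiable_at (ratio w j) c.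
Proof.
move=> jc sc; have [i ic] := curve_cover c.
apply: (differentiable_at1 ic).
have hw := hol_cder (form_hol w ic).
have hd := hol_cder (hol_derive (sphere_coord_hol hp ic jc)).
have d0 := du_neq0 hX hs ss hp ic jc sc.
have := cderM hw (cderV d0 hd) => H; eexists; apply: near_cder H.
apply: nearS (inv_near ic (sphere_dom_near hp jc)) => z [iz zE jz].
by rewrite (ratioE w iz jz) /dsphere zE.
Qed.

End Forms.

(** * Forms are odd under the involution; cancellation of a pole *)

Section OddForms.
Variables (R : realType) (X : complex_curve R).
Local Notation C := (R[i]^o).
Implicit Types (i k : curve_index X) (j : bool) (c x y : X) (F G : X -> C) (w : one_form X).

Local Notation sdom j := (chart_dom (sphere_chart R j)).

Definition bounded_near F c := exists M : R, pnear c (fun y => cabs (F y) <= M).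

Lemma Dat_bounded F c : differentiable_at F c -> bounded_near F c.
Proof.
move=> dF; exists (cabs (F c) + 1); apply: near_pnear.
apply: filterS (Dat_cont dF (near_cabs (F c) ltr01)) => y.
by have := cabs_dist (F y) (F c); lra.
Qed.

Lemma bounded_nearM F G c : bounded_near F c -> bounded_near G c ->
  bounded_near (fun y => F y * G y) c.
Proof.
move=> [M HM] [N HN]; exists (M * N); apply: pnearS (pnear2 HM HN) => y [H1 H2].
by rewrite cabsM; apply: ler_pM; rewrite ?cabs_ge0.
Qed.

Lemma bounded_near_eq F G c : pnear c (fun y => F y = G y) ->
  bounded_near F c -> bounded_near G c.
Proof.
by move=> FG [M HM]; exists M; apply: pnearS (pnear2 FG HM) => y [<-].
Qed.

Lemma small_nearM F G c : differentiable_at F c -> F c = 0 -> bounded_near G c ->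
  forall e : R, 0 < e -> pnear c (fun y => cabs (F y * G y) <= e).
Proof.
move=> dF F0 [M HM] e e0; pose N := Num.max M 1.
have N0 : 0 < N by rewrite lt_max ltr01 orbT.
have d0 : 0 < e / N by rewrite divr_gt0.
have H := near_pnear (Dat_cont dF (near_cabs (F c) d0)).
apply: pnearS (pnear2 H HM) => y [H1 H2]; rewrite F0 subr0 in H1.
rewrite cabsM; apply: (@le_trans _ _ (e / N * N)); last by rewrite divfK ?gt_eqF.
apply: ler_pM; rewrite ?cabs_ge0 ?(ltW H1) //.
by apply: le_trans H2 _; rewrite le_max lexx.
Qed.

Hypothesis hX : closed_riemann_surface X.
Variable s : X -> X.
Hypothesis hs : holomorphic_map s.
Hypothesis ss : s \o s = id.
Hypothesis s1 : s <> id.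
Variable p : X -> riemann_sphere R.
Hypothesis hp : is_involution_quotient s p.

Local Notation u := (sphere_coord p).
Local Notation du := (dsphere p).
Local Notation ratio := (form_ratio p).
Local Notation st i k := (fun z => coord k (s (inv i z))).

Lemma not_fixed_map y : s y <> y -> s (s y) <> s y.
Proof. by rewrite (involutionK ss) => H E; apply: H. Qed.

Lemma du_map i k j y : dom i y -> dom k (s y) -> sdom j (p y) ->
  du i j y = du k j (s y) * dz (st i k) (coord i y).
Proof.
move=> iy ky jy; apply: cder_dz.
have jy' : sdom j (p (s y)) by rewrite (quotient_map hp).
have D := hol_cder (sphere_coord_hol hp ky jy').
have E : coord k (s y) = st i k (coord i y) by rewrite (coordK iy).
rewrite [X in cder _ X]E in D; have {}D := cder_comp (map_cder hs iy ky) D.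
apply: near_cder D; apply: nearS (map_inv_near hs iy ky) => z [_ _ kz].
by rewrite (coordK kz) (sphere_coord_map hp).
Qed.

(** By [du_near_fixed] the denominator vanishes to order at most 1 at the fixed point, which the
    zero of [F] compensates. *)
Lemma fixed_div_bounded i j c F : dom i c -> sdom j (p c) -> s c = c ->
  differentiable_at F c -> F c = 0 -> bounded_near (fun y => F y / du i j y) c.
Proof.
move=> ic jc sc dF F0; have [a a0 H] := du_near_fixed hX hs ss s1 hp ic jc sc.
have [d fd] := dF i ic; have [phi [cphi _ fE]] := fd.
have [M [r [M0 r0 rM]]] := ccont_bounded cphi.
have H2 := coord_near ic (near_cabs (coord i c) r0).
exists (M / a); apply: pnearN (near_pnear H) H2 => y yc [iy ay] yr.
have yc' : 0 < cabs (coord i y - coord i c).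
  rewrite cabs_gt0 subr_eq0; apply/eqP => E; apply: yc; exact: (coord_inj iy ic).
have FE := fE (coord i y); rewrite (coordK iy) (coordK ic) F0 add0r in FE.
rewrite cabsM cabsV FE cabsM ler_pdivrMr; last by apply: lt_le_trans ay; rewrite mulr_gt0.
rewrite mulrAC ler_pdivlMr // -mulrA; apply: ler_pM; rewrite ?cabs_ge0 ?mulr_ge0 ?cabs_ge0 ?(ltW a0) //.
  exact: rM.
by rewrite mulrC.
Qed.

Section Ratio.
Variable w : one_form X.

Let F j y : C := ratio w j y + ratio w j (s y).

Let bF j c : sdom j (p c) -> bounded_near (F j) c.
Proof.
move=> jc; have [sc|sc] := pselect (s c = c); last first.
  apply: Dat_bounded; apply: DatD; first exact: (Dat_ratio hX hs ss hp).
  apply: (Dat_map hs); apply: (Dat_ratio hX hs ss hp); last exact: not_fixed_map.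
  by rewrite (quotient_map hp).
have [i ic] := curve_cover c; have ic' : dom i (s c) by rewrite sc.
(* Over the denominator [du i j], this is the numerator of [F j]: the coefficient of [w + s^* w]. At
   the fixed point its two terms cancel, as [s] has derivative [-1] there. *)
pose N y := w i (coord i y) + w i (coord i (s y)) * dz (st i i) (coord i y).
have hst := map_hol hs ic ic'; have hw := form_hol w ic.
have hw' := form_hol w ic'.
have stc : coord i (s c) = st i i (coord i c) by rewrite (coordK ic).
rewrite stc in hw'.
have hN := holD hw (holM (hol_comp hst hw') (hol_derive hst)).
have dN : differentiable_at N c.
  apply: (differentiable_at1 ic); have D := hol_cder hN; eexists; apply: near_cder D.
  by apply: nearS (inv_near ic (dom_near ic)) => z [_ zE _]; rewrite /N zE.
have N0 : N c = 0.
  by rewrite /N sc (fixed_dz hX hs ss s1 ic sc) mulrN1 subrr.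
apply: bounded_near_eq (fixed_div_bounded ic jc sc dN N0).
have H : \forall y \near c, dom i y /\ dom i (s y).
  exact: filterI (dom_near ic) (map_near hs (dom_near ic')).
apply: pnearN (good_near hX hs ss s1 hp j c) H => y yc [jy sy] [iy isy].
have jy' : sdom j (p (s y)) by rewrite (quotient_map hp).
have d0 := du_neq0 hX hs ss hp iy jy sy.
rewrite /F (ratioE hp w iy jy) (ratioE hp w isy jy') /N mulrDl.
have := du_map iy isy jy => E; rewrite E in d0 *; move: d0; rewrite mulf_eq0 negb_or.
move=> /andP[d1 d2]; congr (_ + _).
by rewrite -mulf_div divff // mulr1.
Qed.

Let F_inv j c : pnear c (fun y => - u (~~ j) y ^+ 2 * F (~~ j) y = F j y).
Proof.
apply: pnearS (pnear2 (good_near hX hs ss s1 hp j c) (good_near hX hs ss s1 hp (~~ j) c)).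
move=> y [[jy sy] [jy' _]]; rewrite /F mulrDr (ratio_inv hp w jy jy').
have jsy : sdom j (p (s y)) by rewrite (quotient_map hp).
have jsy' : sdom (~~ j) (p (s y)) by rewrite (quotient_map hp).
by rewrite (ratio_inv hp w jsy jsy') (sphere_coord_map hp).
Qed.

Lemma pole_exists j : exists c, ~ sdom j (p c).
Proof.
have [psurj _ _ _] := hp; case: j.
  by have [c pc] := psurj (Some 0); exists c; rewrite pc.
by have [c pc] := psurj None; exists c; rewrite pc.
Qed.

Lemma ratio_odd j c : pnear c (fun y => ratio w j (s y) = - ratio w j y).
Proof.
have [c0 jc0] := pole_exists j.
have Dsq c1 : sdom (~~ j) (p c1) -> differentiable_at (fun y => - u (~~ j) y ^+ 2) c1.
  move=> jc; have D := Dat_sphere_coord hp jc.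
  apply: (@Dat_near R X (fun y => (-1) * (u (~~ j) y * u (~~ j) y))).
    by near=> y; rewrite mulN1r expr2.
  by apply: DatM; [exact: Dat_cst|exact: DatM].
have other c1 : ~ sdom j (p c1) -> sdom (~~ j) (p c1).
  by have [H|//] := sdom_or j (p c1).
suff H : forall c, pnear c (fun y => F j y = 0).
  by apply: pnearS (H c) => y /eqP; rewrite /F addrC addr_eq0 => /eqP.
apply: (@liouville_zero R X hX (F j) c0) => [c1|c1|e e0].
- apply: pnearS (good_near hX hs ss s1 hp j c1) => y [jy sy].
  apply: DatD; first exact: (Dat_ratio hX hs ss hp).
  apply: (Dat_map hs); apply: (Dat_ratio hX hs ss hp); last exact: not_fixed_map.
  by rewrite (quotient_map hp).
- have [jc|jc] := pselect (sdom j (p c1)); first exact: bF.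
  apply: bounded_near_eq (F_inv j c1) _; apply: bounded_nearM; last exact/bF/other.
  exact/Dat_bounded/Dsq/other.
have V0 : - u (~~ j) c0 ^+ 2 = 0 by rewrite (sphere_coord_pole jc0) expr0n oppr0.
have H := small_nearM (Dsq c0 (other c0 jc0)) V0 (bF (other c0 jc0)) e0.
by apply: pnearS (pnear2 H (F_inv j c0)) => y [+ <-].
Unshelve. all: by end_near. Qed.

(** This is [s^* w = - w] in charts: [ratio_odd] gives it off isolated points, and continuity at the
    others. *)
Lemma form_odd i k c : dom i c -> dom k (s c) ->
  w k (coord k (s c)) * dz (st i k) (coord i c) = - w i (coord i c).
Proof.
move=> ic kc; have hst := map_hol hs ic kc; have hw' := form_hol w kc.
have stc : coord k (s c) = st i k (coord i c) by rewrite (coordK ic).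
rewrite stc in hw'; rewrite [in LHS]stc.
have hA := hol_cont (holD (holM (hol_comp hst hw') (hol_derive hst)) (form_hol w ic)).
apply/eqP; rewrite -addr_eq0; apply/eqP.
apply: (ccont_uniq hA (ccont_cst 0 (coord i c))).
have j : bool := true.
have H0 := pnear2 (ratio_odd j c) (good_near hX hs ss s1 hp j c).
have H := pnear2 H0 (near_pnear (map_near hs (dom_near kc))).
apply: nearS (inv_pnear ic H) => z zP zc; have [iz zE [[odd [jz sz]] kz]] := zP zc.
have jz' : sdom j (p (s (inv i z))) by rewrite (quotient_map hp).
move: odd; rewrite (ratioE hp w iz jz) (ratioE hp w kz jz').
have d0 := du_neq0 hX hs ss hp iz jz sz.
have E := du_map iz kz jz; rewrite E in d0 *; move: d0; rewrite mulf_eq0 negb_or zE.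
set D := dz _ z; set d := du k j _; set A := w k _; set B := w i z => /andP[d0 D0] odd.
have -> : A = A / d * d by rewrite mulfVK.
by rewrite odd; field; rewrite d0 D0.
Qed.

(* [T = (u j - u j c) (f - f o s) (w / d (u j))] is bounded near [c]: the first
   factor over [d (u j)] vanishes at [c] whether or not [c] is fixed. *)
Lemma pole_cancel i n m c (f : X -> C) : dom i c ->
  (forall y, y <> c -> differentiable_at f y) ->
  (exists M : R, pnear c (fun y => cabs (f y) * cabs (coord i y - coord i c) ^+ n <= M)) ->
  (exists M : R, pnear c (fun y =>
    cabs (w i (coord i y)) <= M * cabs (coord i y - coord i c) ^+ m)) ->
  (n <= m.+1)%N -> nonzero_form w -> pnear c (fun y => f y = f (s y)).
Proof.
move=> ic df [M1 fM1] [M3 wM3] nm w0.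
have K := involutionK ss.
pose h y := f y - f (s y); pose e y := cabs (coord i y - coord i c).
have [j jc] : exists j, sdom j (p c) by have [H|H] := sdom_or true (p c); eexists; exact: H.
pose G j' y := h y * ratio w j' y; pose T y := (u j y - u j c) * G j y.
have dh y : y <> c -> y <> s c -> differentiable_at h y.
  move=> yc ysc; apply: DatB; first exact: df.
  by apply: (Dat_map hs); apply: df => E; apply: ysc; rewrite -E K.
have off y : pnear y (fun y' => y' <> c /\ y' <> s c).
  apply: pnear2.
    have [->|yc] := pselect (y = c); first by rewrite /pnear; near=> z.
    exact: near_pnear (separate hX yc).
  have [->|yc] := pselect (y = s c); first by rewrite /pnear; near=> z.
  exact: near_pnear (separate hX yc).
(* At a fixed point other than [c], [h] vanishes, which compensates the zero of [d (u j')]. *)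
have bG j' y : y <> c -> y <> s c -> sdom j' (p y) -> bounded_near (G j') y.
  move=> yc ysc jy; have dhy := dh y yc ysc.
  have [sy|sy] := pselect (s y = y); last first.
    by apply/Dat_bounded/DatM => //; exact: (Dat_ratio hX hs ss hp).
  have [k ky] := curve_cover y.
  have hy0 : h y = 0 by rewrite /h sy subrr.
  have dw : differentiable_at (fun z => w k (coord k z)) y.
    apply: (differentiable_at1 ky); have D := hol_cder (form_hol w ky).
    eexists; apply: near_cder D.
    by apply: nearS (inv_near ky (dom_near ky)) => z [_ -> _].
  have hw0 : h y * w k (coord k y) = 0 by rewrite hy0 mul0r.
  apply: bounded_near_eq (fixed_div_bounded ky jy sy (DatM dhy dw) hw0).
  apply: pnearN (good_near hX hs ss s1 hp j' y) (dom_near ky) => z _ [jz _] kz.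
  by rewrite /G (ratioE hp w kz jz) mulrA.
have other y : ~ sdom j (p y) -> sdom (~~ j) (p y).
  by have [H|//] := sdom_or j (p y).
have pole_off y : ~ sdom j (p y) -> y <> c /\ y <> s c.
  by move=> jy; split=> E; apply: jy; rewrite E ?(quotient_map hp).
(* With [v = u (~~ j)], this is [(1 / v - u j c) * (- v ^+ 2)]: the pole of [u j - u j c] is simple
   in [v], so [V] still vanishes at [v = 0]. *)
pose V y := u j c * (u (~~ j) y * u (~~ j) y) - u (~~ j) y.
have T_inv y : pnear y (fun z => V z * G (~~ j) z = T z).
  apply: pnearS (pnear2 (good_near hX hs ss s1 hp j y) (good_near hX hs ss s1 hp (~~ j) y)).
  move=> z [[jz sz] [jz' _]]; rewrite /T /G (ratio_inv hp w jz jz') (sphere_coord_inv jz jz').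
  by rewrite /V; have [->|v0] := eqVneq (u (~~ j) z) 0; [rewrite invr0; ring|field].
have dV y : sdom (~~ j) (p y) -> differentiable_at V y.
  move=> jy; have D := Dat_sphere_coord hp jy.
  by apply: DatB => //; apply: DatM; [exact: Dat_cst|exact: DatM].
have ef : pnear c (fun y => [/\ dom i y, 0 < e y & e y <= 1]).
  have H := coord_near ic (near_cabs (coord i c) ltr01).
  apply: pnearN (near_pnear H) (dom_near ic) => y yc /ltW ye iy; split=> //.
  by rewrite /e cabs_gt0 subr_eq0; apply/eqP => E; apply: yc; exact: (coord_inj iy ic).
have [K1 K10 HA] : exists2 K1 : R, 0 <= K1 & pnear c (fun y =>
    cabs (u j y - u j c) <= K1 * (e y * cabs (du i j y))).
  have [sc|sc] := pselect (s c = c).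
    have [a a0 H1] := du_near_fixed hX hs ss s1 hp ic jc sc.
    have [M M0 H2] := sphere_coord_quadratic hX hs ss s1 hp ic jc sc.
    exists (M / a); first by rewrite divr_ge0 // ltW.
    apply: pnearN (near_pnear H1) H2 => y yc [_ H] [_ H'].
    apply: le_trans H' _; rewrite mulrAC ler_pdivlMr // -mulrA ler_pM2l //.
    by rewrite expr2 -mulrA ler_wpM2l ?cabs_ge0 // mulrC.
  have [a a0 H1] := du_near hX hs ss hp ic jc sc.
  have [M M0 H2] := sphere_coord_linear hp ic jc.
  exists (M / a); first by rewrite divr_ge0 // ltW.
  apply: pnearN (near_pnear H1) H2 => y yc [_ H] [_ H'].
  apply: le_trans H' _; rewrite mulrAC ler_pdivlMr // -mulrA ler_pM2l //.
  by rewrite ler_wpM2l ?cabs_ge0.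
(* [h] has a pole of order at most [n] at [c]. If [c] is fixed, the bound for [f o s] costs the
   factor [2 ^+ n] from [fixed_quotient]; otherwise [f o s] is bounded there. *)
have [K2 HB] : exists K2 : R, pnear c (fun y => cabs (h y) * e y ^+ n <= K2).
  have [sc|sc] := pselect (s c = c).
    exists (M1 + 2 ^+ n * M1).
    have fs : pnear c (fun y => cabs (f (s y)) * cabs (coord i (s y) - coord i c) ^+ n <= M1).
      by apply: (map_pnear hs ss (P := fun y => cabs (f y) * cabs (coord i y - coord i c) ^+ n <= M1)); rewrite sc.
    apply: pnearN (pnear2 fM1 fs) (fixed_quotient hX hs ss s1 ic sc) => y yc [H1 H2] [iy H3].
    apply: le_trans (ler_wpM2r _ (cabsB _ _)) _; first by rewrite exprn_ge0 // cabs_ge0.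
    rewrite mulrDl; apply: lerD => //.
    apply: (@le_trans _ _ (2 ^+ n * (cabs (f (s y)) * cabs (coord i (s y) - coord i c) ^+ n))).
      rewrite mulrCA -exprMn ler_wpM2l ?cabs_ge0 //.
      by apply: lerXn2r; rewrite ?nnegrE ?mulr_ge0 ?cabs_ge0 // -/(e y); rewrite /e; lra.
    by rewrite ler_wpM2l ?exprn_ge0.
  have [M HM] := Dat_bounded (Dat_map hs (df _ sc)).
  exists (M1 + M); apply: pnearS (pnear2 (pnear2 fM1 HM) ef) => y [[H1 H2] [_ e0 e1]].
  have en : e y ^+ n <= 1 by rewrite exprn_ile1 // ltW.
  have en0 : 0 <= e y ^+ n by rewrite exprn_ge0 // ltW.
  apply: le_trans (ler_wpM2r en0 (cabsB _ _)) _.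
  rewrite mulrDl; apply: lerD => //; apply: le_trans H2.
  by rewrite ler_piMr ?cabs_ge0.
have bTc : bounded_near T c.
  (* The factor [du] cancels and leaves [h * e ^+ m.+1], bounded because [n <= m.+1]; the additional
     1 is the factor [e y] in [HA]. *)
  pose K3 := Num.max M3 0; exists (K1 * K3 * K2).
  have K30 : 0 <= K3 by rewrite le_max lexx orbT.
  apply: pnearS (pnear2 (pnear2 HA HB) (pnear2 ef (pnear2 wM3 (good_near hX hs ss s1 hp j c)))).
  move=> y [[H1 H2] [[iy e0 e1] [H3 [jy sy]]]].
  have d0 : 0 < cabs (du i j y) by rewrite cabs_gt0; exact: (du_neq0 hX hs ss hp iy jy sy).
  rewrite /T /G (ratioE hp w iy jy) !cabsM cabsV.
  have {}H3 : cabs (w i (coord i y)) <= K3 * e y ^+ m.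
    by apply: le_trans H3 _; rewrite ler_wpM2r ?exprn_ge0 ?cabs_ge0 // le_max lexx.
  have emn : e y ^+ m.+1 <= e y ^+ n by rewrite ler_wiXn2l // ltW.
  apply: (@le_trans _ _ (K1 * (e y * cabs (du i j y)) * (cabs (h y) * (K3 * e y ^+ m / cabs (du i j y))))).
    apply: ler_pM; rewrite ?cabs_ge0 ?mulr_ge0 ?cabs_ge0 ?invr_ge0 ?cabs_ge0 //.
    rewrite ler_wpM2l ?cabs_ge0 // ler_wpM2r ?invr_ge0 ?cabs_ge0 //.
  have -> : K1 * (e y * cabs (du i j y)) * (cabs (h y) * (K3 * e y ^+ m / cabs (du i j y))) =
     K1 * K3 * (cabs (h y) * e y ^+ m.+1) by rewrite exprS; field; rewrite gt_eqF.
  rewrite ler_wpM2l ?mulr_ge0 //; apply: le_trans H2.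
  by rewrite ler_wpM2l ?cabs_ge0.
(* [f - f o s] and the ratio are both odd under [s], so [T] is even and inherits at [s c] its bound
   at [c]. *)
have bTsc : bounded_near T (s c).
  have [M HM] := bTc; exists M.
  have HM' : pnear (s c) (fun y => cabs (T (s y)) <= M).
    by apply: (map_pnear hs ss (P := fun y => cabs (T y) <= M)); rewrite K.
  apply: pnearS (pnear2 HM' (ratio_odd j (s c))) => y [+ odd].
  rewrite /T /G /h odd (sphere_coord_map hp) K.
  by congr (cabs (_ * _) <= _); rewrite mulrN -mulNr opprB.
have [c0 jc0] := pole_exists j.
have T0 : forall y, pnear y (fun z => T z = 0).
  apply: (@liouville_zero R X hX T c0) => [y|y|r r0].
  - apply: pnearS (pnear2 (good_near hX hs ss s1 hp j y) (off y)) => z [[jz sz] [zc zsc]].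
    apply: DatM; first by apply: DatB; [exact: (Dat_sphere_coord hp)|exact: Dat_cst].
    by apply: DatM; [exact: dh|exact: (Dat_ratio hX hs ss hp)].
  - have [jy|jy] := pselect (sdom j (p y)); last first.
      apply: bounded_near_eq (T_inv y) _; have [yc ysc] := pole_off y jy.
      apply: bounded_nearM; first exact: (Dat_bounded (dV y (other y jy))).
      by apply: bG => //; exact: other.
    have [->//|yc] := pselect (y = c); have [->//|ysc] := pselect (y = s c).
    apply: bounded_nearM; last exact: bG.
    by apply/Dat_bounded/DatB; [exact: (Dat_sphere_coord hp)|exact: Dat_cst].
  have [yc ysc] := pole_off c0 jc0.
  have V0 : V c0 = 0 by rewrite /V (sphere_coord_pole jc0) !mulr0 subrr.
  have := small_nearM (dV c0 (other c0 jc0)) V0 (bG (~~ j) c0 yc ysc (other c0 jc0)) r0.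
  by move=> H; apply: pnearS (pnear2 H (T_inv c0)) => z [+ <-].
have Hw := form_zeros_isolated hX w0 c.
apply: pnearN (pnear2 (pnear2 (T0 c) (off c)) (pnear2 Hw (good_near hX hs ss s1 hp j c))) (dom_near ic).
move=> y _ [[Ty [yc ysc]] [wy [jy sy]]] iy.
move: Ty; rewrite /T /G (ratioE hp w iy jy) => /eqP; rewrite !mulf_eq0 invr_eq0.
rewrite (negPf (du_neq0 hX hs ss hp iy jy sy)) orbF => /orP[|/orP[|]].
- rewrite subr_eq0 => /eqP /(sphere_coord_inj jy jc)/(quotient_fiber hp)[E|E].
    by case: yc.
  by case: ysc; rewrite E K.
- by rewrite subr_eq0 => /eqP.
by move=> /eqP /(form_zerosP w iy).
Unshelve. all: by end_near.
Qed.

End Ratio.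

End OddForms.

(** * Weierstrass points *)

Local Notation st s i k := (fun z => coord k (s (inv i z))).

Section Weierstrass.
Variables (R : realType) (X : complex_curve R).
Local Notation C := (R[i]^o).
Implicit Types (i k : curve_index X) (c x y : X) (w : one_form X).

Lemma form_sum n (b : 'I_n -> one_form X) (a : 'I_n -> C) :
  exists w, forall i z, w i z = \sum_(l < n) a l * b l i z.
Proof.
pose W i z : C := \sum_(l < n) a l * b l i z.
have hW i x : dom i x -> derivable (W i) (coord i x) 1.
  move=> ix; apply: hol_derivable; apply: hol_sum => l.
  by apply: holM; [exact: hol_cst|exact: form_hol].
have cW i k x : dom i x -> dom k x ->
    W i (coord i x) = W k (coord k x) * derive1 (coord k \o inv i) (coord i x).
  move=> ix kx; rewrite /W mulr_suml; apply: eq_bigr => l _.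
  by rewrite -mulrA; congr (_ * _); exact: form_compat.
by exists (OneForm hW cW).
Qed.

Hypothesis hX : closed_riemann_surface X.

Lemma vanishing_form g w i x : has_genus X g -> (0 < g)%N -> nonzero_form w ->
  dom i x -> exists eta : one_form X, nonzero_form eta /\
    exists2 v, hol v (coord i x) & forall z, eta i z = (z - coord i x) ^+ g.-1 * v z.
Proof.
move=> [b bP] g0 w0 ix.
have gg : (g.-1 < g)%N by rewrite prednK.
have [a [[l al] [v hv vE]]] :=
  vanishing_combination gg (fun l => form_hol (b l) ix).
have [eta etaE] := form_sum b a.
exists eta; split; last by exists v => // z; rewrite etaE vE.
apply: contrapT => H; have {}H y : form_zeros eta y.
  by apply: contrapT => Hy; apply: H; exists y.
have [a1 [a1P a1U]] := bP w.
(* If [eta] vanished identically, adding [a] to the coordinates of [w] would give a second expansion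
   of [w], against uniqueness. *)
have := a1U [ffun l => a1 l + a l].
move=> /(_ _)/ffunP/(_ l); rewrite ffunE => E.
have {}E : a1 l = a1 l + a l.
  apply: E => i' y iy; rewrite a1P //.
  under [RHS]eq_bigr do rewrite ffunE mulrDl.
  rewrite big_split /= -etaE.
  by have /(form_zerosP eta iy) -> := H y; rewrite addr0.
by move: al; rewrite -{1}(addKr (a1 l) (a l)) -E addNr eqxx.
Qed.

Variable s : X -> X.
Hypothesis hs : holomorphic_map s.
Hypothesis ss : s \o s = id.
Hypothesis s1 : s <> id.
Variable p : X -> riemann_sphere R.
Hypothesis hp : is_involution_quotient s p.

Lemma proportional_forms w (eta : one_form X) : (forall y, ~ form_zeros w y) ->
  exists a : C, forall i y, dom i y -> eta i (coord i y) = a * w i (coord i y).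
Proof.
move=> w0; pose F y := eta (chart_at y) (coord (chart_at y) y) /
  w (chart_at y) (coord (chart_at y) y).
have FE i y : dom i y -> F y = eta i (coord i y) / w i (coord i y).
  move=> iy; have ky := chart_atP y; rewrite /F.
  rewrite (form_transition eta iy ky) (form_transition w iy ky) -mulf_div.
  by rewrite divff ?mulr1 // transition_neq0.
have wn i y : dom i y -> w i (coord i y) != 0.
  by move=> iy; apply/eqP => /(form_zerosP w iy); exact: w0.
have dF y : differentiable_at F y.
  have [i iy] := curve_cover y; apply: (differentiable_at1 iy).
  have D := cderM (hol_cder (form_hol eta iy)) (cderV (wn _ _ iy) (hol_cder (form_hol w iy))).
  eexists; apply: near_cder D.
  by apply: nearS (inv_near iy (dom_near iy)) => z [iz zE _]; rewrite (FE i) // zE.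
have [||a aP] := @liouville R X hX F.
- by move=> c; apply: near_pnear; near=> y; exact: dF.
- by move=> c; exact: Dat_bounded.
exists a => i y iy.
have hd := hol_cont (holB (form_hol eta iy) (holM (hol_cst a _) (form_hol w iy))).
apply/eqP; rewrite -subr_eq0; apply/eqP.
apply: (ccont_uniq hd (ccont_cst 0 _)).
apply: nearS (inv_pnear iy (aP y)) => z H /H[iz zE]; rewrite (FE i) // zE => <-.
by rewrite mulfVK ?subrr // -zE wn.
Unshelve. all: by end_near. Qed.

Lemma weierstrass_fixed w x : nonzero_form w -> weierstrass_point x ->
  s x = x /\ exists c, form_zeros w c.
Proof.
move=> w0 [g [f [n [hg ng [n0 fpole] fhol]]]].
have df y : y <> x -> differentiable_at f y.
  by move=> yx; move/holomorphic_on_at : fhol; apply.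
have [i ix] := curve_cover x; have [h [h0 hh fE]] := fpole i ix.
set z0 := coord i x in h0 hh fE.
have g0 : (0 < g)%N by apply: leq_trans ng.
have [eta [eta0 [v hv etaE]]] := vanishing_form hg g0 w0 ix.
have ch : ccont h z0 := hol_cont (hh : hol h z0).
have ex_f : pnear x (fun y => f y = h (coord i y) / (coord i y - z0) ^+ n /\ coord i y != z0).
  have fE' : \forall z \near z0, z != z0 -> f (inv i z) = h z / (z - z0) ^+ n.
    by move: fE; rewrite /dnbhs.
  have H := coord_pnear ix (nearS (fun z H (z1 : z != z0) => conj (H z1) z1) fE').
  by apply: pnearN H (dom_near ix) => y _ [+ +] iy; rewrite (coordK iy).
have [M [r [M0 r0 rM]]] := ccont_bounded ch.
have fs : pnear x (fun y => f y = f (s y)).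
  apply: (@pole_cancel R X hX s hs ss s1 p hp eta i n g.-1 x f ix df).
  - exists M; apply: pnearN ex_f (coord_near ix (near_cabs z0 r0)) => y _ [-> yz] yr.
    have ye : cabs (coord i y - z0) ^+ n != 0.
      by rewrite expf_neq0 // cabs_eq0 subr_eq0.
    by rewrite cabsM cabsV cabsX mulfVK //; exact: rM.
  - have [N [q [N0 q0 qN]]] := ccont_bounded (hol_cont hv).
    exists N; apply: near_pnear; apply: filterS (coord_near ix (near_cabs z0 q0)) => y yq.
    by rewrite etaE cabsM cabsX mulrC ler_wpM2r ?exprn_ge0 ?cabs_ge0 // qN.
  - by rewrite prednK.
  - exact: eta0.
(* Otherwise [f o s], hence [f], would be bounded near [x], against the pole. *)
have sx : s x = x.
  apply: contrapT => sx; have [N HN] := Dat_bounded (Dat_map hs (df _ sx)).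
  pose N' := Num.max N 1; have N'0 : 0 < N' by rewrite lt_max ltr01 orbT.
  have [q q0 qh] := ccont_neq0 ch h0.
  have h0' : 0 < cabs (h z0) / 2 / N' by rewrite !divr_gt0 // cabs_gt0.
  have near_e := coord_near ix (near_cabs z0 (_ : 0 < Num.min (Num.min 1 q) (cabs (h z0) / 2 / N'))).
  have m0 : 0 < Num.min (Num.min 1 q) (cabs (h z0) / 2 / N') by rewrite !lt_min ltr01 q0.
  have [y [_ [[fsy HNy] [[fy yz] ye]]]] :=
    pnear_exists (pnear2 (pnear2 fs HN) (pnear2 ex_f (near_pnear (near_e m0)))).
  move: ye; rewrite !lt_min => /andP[/andP[y1 /qh yq] ye].
  have e0 : 0 < cabs (coord i y - z0) by rewrite cabs_gt0 subr_eq0.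
  have : cabs (h (coord i y)) <= N' * cabs (coord i y - z0).
    have -> : h (coord i y) = f y * (coord i y - z0) ^+ n.
      by rewrite fy mulfVK // expf_neq0 // subr_eq0.
    rewrite cabsM cabsX; apply: ler_pM; rewrite ?exprn_ge0 ?cabs_ge0 //.
      by rewrite fsy; apply: le_trans HNy _; rewrite le_max lexx.
    by rewrite -[X in _ <= X]expr1 ler_wiXn2l // ltW.
  by move: ye; rewrite ltr_pdivlMr //; lra.
split=> //; apply: contrapT => nozero.
have {}nozero y : ~ form_zeros w y by move=> yz; apply: nozero; exists y.
have [a aE] := proportional_forms eta nozero.
have a0 : a != 0.
  apply/eqP => E; have [y yz] := eta0; apply: yz; exists (chart_at y).
    exact: chart_atP.
  by rewrite (aE _ _ (chart_atP y)) E mul0r.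
(* [eta] is a nonzero multiple of [w], so it does not vanish at [x], and the exponent [g.-1] has to
   be 0. *)
have : eta i z0 != 0.
  rewrite (aE _ _ ix) mulf_neq0 //; apply/eqP => /(form_zerosP w ix).
  exact: nozero.
rewrite etaE subrr; case: (posnP g.-1) => [g1|/prednK <-]; last first.
  by rewrite exprS !mul0r eqxx.
have n1 : n = 1%N.
  by apply/eqP; rewrite eqn_leq n0 andbT; apply: leq_trans ng _; rewrite -(prednK g0) g1.
move=> _; have isx : dom i (s x) by rewrite sx.
have hst := map_hol hs ix isx; set q := dquo (st s i i) z0.
have cq : ccont q z0 := hol_cont (hol_dquo hst).
have stz : st s i i z0 = z0 by rewrite /z0 (coordK ix) sx.
have q0 : q z0 = -1 by rewrite /q dquo_id (fixed_dz hX hs ss s1 ix sx).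
have chst : ccont (fun z => h (st s i i z)) z0.
  by apply: ccont_comp; [exact: hol_cont|rewrite stz].
(* With a simple pole, [f = f o s] reads [h z / (z - z0) = h (s z) / ((z - z0) * q z)]. At [z0],
   where [q] is [-1], this gives [h z0 = - h z0]. *)
have : h (st s i i z0) = h z0 * q z0.
  apply: (ccont_uniq chst (ccontM ch cq)).
  have exs : pnear x (fun y => f (s y) = h (coord i (s y)) / (coord i (s y) - z0) ^+ n /\ coord i (s y) != z0).
    by apply: (map_pnear hs ss (P := fun y => f y = h (coord i y) / (coord i y - z0) ^+ n /\ coord i y != z0)); rewrite sx.
  apply: nearS (inv_pnear ix (pnear2 fs (pnear2 ex_f exs))) => z H zz.
  have [iz zE [fsz [[fz _] [fs' sz]]]] := H zz.
  have qE : coord i (s (inv i z)) - z0 = (z - z0) * q z.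
    have -> : coord i (s (inv i z)) = z0 + (z - z0) * q z by rewrite -{1}stz -dquoE.
    by rewrite [z0 + _]addrC addrK.
  have := fsz; rewrite fz fs' zE n1 !expr1 qE => E.
  have zz' : z - z0 != 0 by rewrite subr_eq0.
  have qz : q z != 0.
    by move: sz; rewrite -subr_eq0 qE mulf_eq0 negb_or => /andP[].
  have -> : h z = h z / (z - z0) * (z - z0) by rewrite mulfVK.
  by rewrite E; field; rewrite zz' qz.
rewrite stz q0 mulrN1 => /eqP; rewrite -subr_eq0 opprK -mulr2n mulrn_eq0 /=.
by rewrite (negPf h0).
Qed.

End Weierstrass.

(** * Conjugates of the involution by affine maps *)

Section Affine.
Variables (R : realType) (X : complex_curve R).
Local Notation C := (R[i]^o).
Implicit Types (i k : curve_index X) (c x y : X) (tau : X -> X) (U V : set X).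

Hypothesis hX : closed_riemann_surface X.
Variable w : one_form X.
Hypothesis w0 : nonzero_form w.

Lemma primitive_flat i y (W : C -> C) : dom i y -> ~ form_zeros w y ->
  (\forall z \near coord i y, cder W z (w i z)) ->
  exists2 U, flat_coordinate w U (fun x => W (coord i x)) & U y.
Proof.
move=> iy wy dW.
have hW : hol W (coord i y) by apply: nearS dW => z; exact: cder_derivable.
have dWy : dz W (coord i y) = w i (coord i y) := cder_dz (nbhs_singleton dW).
have wn : w i (coord i y) != 0 by apply/eqP => /(form_zerosP w iy).
have [|r r0 inj] := locally_injective hW; first by rewrite dWy.
have wnear := near_neq0 (hol_cont (form_hol w iy)) wn.
pose S z := [/\ cabs (z - coord i y) < r, w i z != 0 & cder W z (w i z)].
have nS : \forall z \near coord i y, S z.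
  apply: nearS2 (near_cabs _ r0) (nearS2 (fun z => @conj _ _) wnear dW).
  by move=> z ? [? ?]; split.
pose U : set X := interior [set x | dom i x /\ S (coord i x)].
have UP x : U x -> dom i x /\ S (coord i x) by move/interior_subset.
exists U; last first.
  by rewrite /U /interior /=; apply: filterS2 (dom_near iy) (coord_near iy nS).
split.
- exact: open_interior.
- by move=> x /UP[ix [_ wx _]] /(form_zerosP w ix) /eqP; rewrite (negPf wx).
- move=> x x' /UP[ix [xr _ _]] /UP[ix' [xr' _ _]] /(inj _ _ xr xr').
  exact: coord_inj.
move=> k x /UP[ix [_ _ dWx]] kx; apply/cderP.
have D := compat_cder kx ix; rewrite -[in X in cder _ X](coordK kx) in dWx.
by have := cder_comp D dWx; rewrite (form_transition w kx ix).
Qed.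

Lemma flat_cder U zeta i y : flat_coordinate w U zeta -> U y -> dom i y ->
  cder (fun z => zeta (inv i z)) (coord i y) (w i (coord i y)).
Proof. by move=> [_ _ _ H] Uy iy; apply/cderP; exact: H. Qed.

Lemma flat_near U zeta y : flat_coordinate w U zeta -> U y -> \forall x \near y, U x.
Proof. by move=> [oU _ _ _] Uy; exact: open_nbhs_nbhs. Qed.

Lemma flat_exists y : ~ form_zeros w y -> exists U zeta, flat_coordinate w U zeta /\ U y.
Proof.
move=> wy; have iy := chart_atP y; have [W dW] := hol_primitive (form_hol w iy).
by have [U fU Uy] := primitive_flat iy wy dW; exists U; eexists; split; [exact: fU|].
Qed.

(** The primitive is normalised to vanish at [c], whence [0 < n]; it is not locally zero because the
    zeros of [w] are isolated. At a zero of [w] it replaces the flat coordinates, which do not exist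
    there. *)
Lemma primitive_order i c : dom i c -> exists (W : C -> C) n h,
  [/\ \forall z \near coord i c, cder W z (w i z), (0 < n)%N, hol h (coord i c),
      h (coord i c) != 0 & forall z, W z = (z - coord i c) ^+ n * h z].
Proof.
move=> ic; have [F dF] := hol_primitive (form_hol w ic).
pose W z := F z - F (coord i c).
have dW : \forall z \near coord i c, cder W z (w i z).
  apply: nearS dF => z dz; have := cderB dz (cder_cst (F (coord i c)) z).
  by rewrite subr0.
have hW : hol W (coord i c) by apply: nearS dW => z; exact: cder_derivable.
have [Wz|[n [h [hh h0 WE]]]] := order_of_vanishing hW; last first.
  exists W, n, h; split=> //; rewrite lt0n; apply/eqP => n0.
  have := WE (coord i c); rewrite /W subrr n0 expr0 mul1r => /eqP.
  by rewrite eq_sym (negPf h0).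
exfalso; have Wz' := @near_near R (fun z => W z = 0) _ Wz.
have wz : \forall z \near coord i c, w i z = 0.
  apply: nearS2 dW Wz' => z dz Wz0; apply: cder_uniq dz _.
  by apply: near_cder (cder_cst 0 z); apply: nearS Wz0 => y ->.
have H : \forall y \near c, form_zeros w y.
  by apply: filterS2 (coord_near ic wz) (dom_near ic) => y wy iy; apply/(form_zerosP w iy).
by have [y [_ []]] := pnear_exists (pnear2 (form_zeros_isolated hX w0 c) (near_pnear H)).
Qed.

(* The maps [phi \o s \o phi^-1], [phi] affine, all belong to this class. *)
Record half_turn tau : Prop := HalfTurn {
  half_turn_continuous : continuous tau;
  half_turnK : tau \o tau = id;
  half_turn_zeros : forall y, form_zeros w y -> form_zeros w (tau y);
  half_turn_flat : forall U V (zeta xi : X -> C),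
    flat_coordinate w U zeta -> flat_coordinate w V xi ->
    forall y, U y -> V (tau y) -> exists a : C, \forall x \near y, xi (tau x) = - zeta x + a;
  half_turn_fixed : finite_set [set y | tau y = y] }.

Section HalfTurn.
Variable tau : X -> X.
Hypothesis ht : half_turn tau.

Lemma half_turn_near c (P : X -> Prop) : (\forall y \near tau c, P y) ->
  \forall y \near c, P (tau y).
Proof. exact: (half_turn_continuous ht). Qed.

Lemma half_turn_nonzeros y : ~ form_zeros w y -> ~ form_zeros w (tau y).
Proof.
move=> wy /(half_turn_zeros ht); have := congr1 (@^~ y) (half_turnK ht).
by rewrite /= => ->.
Qed.

Lemma half_turn_ccont i k c : dom i c -> dom k (tau c) ->
  ccont (st tau i k) (coord i c).
Proof.
move=> ic kc e e0.
have H := half_turn_near (coord_near kc (near_cabs (coord k (tau c)) e0)).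
by have /nearCP[r r0 rP] := inv_near ic H; exists r => // z /rP[_ _]; rewrite (coordK ic).
Qed.

Lemma half_turn_inv_near i k c : dom i c -> dom k (tau c) ->
  \forall z \near coord i c,
    [/\ dom i (inv i z), coord i (inv i z) = z & dom k (tau (inv i z))].
Proof.
move=> ic kc; have H := @half_turn_near c (fun y => dom k y) (dom_near kc).
exact: (inv_near ic H).
Qed.

Lemma half_turn_local i k y (W W' : C -> C) : dom i y -> dom k (tau y) ->
  ~ form_zeros w y -> (\forall z \near coord i y, cder W z (w i z)) ->
  (\forall z \near coord k (tau y), cder W' z (w k z)) ->
  exists a, \forall z \near coord i y, W' (st tau i k z) = - W z + a.
Proof.
move=> iy ky wy dW dW'.
have [U fU Uy] := primitive_flat iy wy dW.
have [V fV Vy] := primitive_flat ky (half_turn_nonzeros wy) dW'.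
have [a H] := half_turn_flat ht fU fV Uy Vy; exists a.
by apply: nearS (inv_near iy H) => z [_ zE ->]; rewrite zE.
Qed.

(** [tau] is only known to be continuous. The relation [W' o tau = - W + a] between primitives, with
    [W'] of nonzero derivative, makes it differentiable by [cder_lift]. *)
Lemma half_turn_derivable i k y : dom i y -> dom k (tau y) -> ~ form_zeros w y ->
  exists d, cder (st tau i k) (coord i y) d.
Proof.
move=> iy ky wy.
have [W dW] := hol_primitive (form_hol w iy).
have [W' dW'] := hol_primitive (form_hol w ky).
have [a H] := half_turn_local iy ky wy dW dW'.
have wk : w k (coord k (tau y)) != 0.
  by apply/eqP => /(form_zerosP w ky); exact: half_turn_nonzeros.
have tE : st tau i k (coord i y) = coord k (tau y) by rewrite (coordK iy).
have D1 : cder W' (st tau i k (coord i y)) (w k (coord k (tau y))).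
  by rewrite tE; exact: (nbhs_singleton dW').
have D2 : cder (fun z => W' (st tau i k z)) (coord i y) (- w i (coord i y) + 0).
  have := cderD (cderN (nbhs_singleton dW)) (cder_cst a (coord i y)).
  by apply: near_cder; apply: nearS H => z ->.
by eexists; exact: (cder_lift (half_turn_ccont iy ky) D1 wk D2).
Qed.

(** Only the zeros of [w] remain; they are isolated, and by continuity of [tau] the singularities
    there are removable. *)
Lemma half_turn_holomorphic : holomorphic_map tau.
Proof.
split; first exact: (half_turn_continuous ht).
move=> i k c ic kc; have ct := half_turn_ccont ic kc.
have pz : pnear c (fun y => ~ form_zeros w y /\ dom k (tau y)).
  apply: pnear2 (form_zeros_isolated hX w0 c) _.
  by apply: near_pnear; apply: half_turn_near; exact: dom_near.
have [||g hg gE] := @removable R (st tau i k) (coord i c).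
- apply: nearS (inv_pnear ic pz) => z H /H[iz zE [wz kz]].
  by have [d D] := half_turn_derivable iz kz wz; rewrite zE in D; exact: cder_derivable D.
- have [M [r [M0 r0 rM]]] := ccont_bounded ct.
  by exists M; apply/nearCP; exists r => // z zr _; exact: rM.
have gc : g (coord i c) = st tau i k (coord i c) by apply: ccont_uniq (hol_cont hg) ct gE.
have D := hol_cder hg; apply: (@cder_derivable R (st tau i k) _ _).
  apply: near_cder D; apply: nearS gE => z.
  by have [->|zc H] := eqVneq z (coord i c); [rewrite gc|exact: H].
Qed.

(** At a zero [c] of [w] the flat relation is available off [c] only. There [W' o tau + W] has
    derivative 0; being continuous at [c], it is constant near [c], with value 0 by the
    normalisation. *)
Lemma half_turn_primitive i k c (W W' : C -> C) : dom i c -> dom k (tau c) ->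
  (\forall z \near coord i c, cder W z (w i z)) ->
  (\forall z \near coord k (tau c), cder W' z (w k z)) ->
  W (coord i c) = 0 -> W' (coord k (tau c)) = 0 ->
  \forall z \near coord i c, W' (st tau i k z) = - W z.
Proof.
move=> ic kc dW dW' Wc W'c.
have tE : st tau i k (coord i c) = coord k (tau c) by rewrite (coordK ic).
have ct := half_turn_ccont ic kc.
pose D z := W' (st tau i k z) + W z.
have cD : ccont D (coord i c).
  apply: ccontD; last exact: cder_cont (nbhs_singleton dW).
  by apply: ccont_comp => //; rewrite tE; exact: cder_cont (nbhs_singleton dW').
have D0 : D (coord i c) = 0 by rewrite /D tE Wc W'c addr0.
suff H : \forall z \near coord i c, z != coord i c -> cder D z 0.
  apply: nearS (punctured_constant cD H) => z; rewrite D0 /D => /eqP.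
  by rewrite addr_eq0 => /eqP.
have nW := near_near dW; have nW' := half_turn_near (coord_near kc (near_near dW')).
have pz : pnear c (fun y => ~ form_zeros w y /\
    (dom k (tau y) /\ \forall z \near coord k (tau y), cder W' z (w k z))).
  apply: pnear2 (form_zeros_isolated hX w0 c) _; apply: near_pnear.
  exact: filterI (half_turn_near (dom_near kc)) nW'.
apply: nearS2 (inv_pnear ic pz) nW => z H nWz zc.
have [iz zE [wz [kz dW'z]]] := H zc.
have nWz' : \forall z' \near coord i (inv i z), cder W z' (w i z') by rewrite zE.
have [a Ha] := half_turn_local iz kz wz nWz' dW'z; rewrite zE in Ha.
apply: near_cder (cder_cst a z); apply: nearS Ha => z' E.
by rewrite /D E addrAC addNr add0r.
Qed.

End HalfTurn.

Lemma order_unique (z0 : C) n m (A B : C -> C) : ccont A z0 -> ccont B z0 ->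
  A z0 != 0 -> B z0 != 0 ->
  (\forall z \near z0, z != z0 -> (z - z0) ^+ n * A z = (z - z0) ^+ m * B z) ->
  n = m /\ A z0 = B z0.
Proof.
wlog nm : n m A B / (n <= m)%N.
  move=> H cA cB A0 B0 E; have [nm|mn] := leqP n m; first exact: (H n m A B).
  have [|mn' AB] := H m n B A (ltnW mn) cB cA B0 A0; last by rewrite mn' AB.
  by apply: nearS E => z E /E.
move=> cA cB A0 B0 E.
have cE : ccont (fun z => (z - z0) ^+ (m - n) * B z) z0.
  apply: ccontM => //; apply: hol_cont; apply: holX.
  by apply: holB; [exact: hol_id|exact: hol_cst].
have H : A z0 = (z0 - z0) ^+ (m - n) * B z0.
  apply: (ccont_uniq cA cE); apply: nearS E => z E zz.
  have zn : (z - z0) ^+ n != 0 by rewrite expf_neq0 // subr_eq0.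
  by apply: (mulfI zn); rewrite E // mulrA -exprD subnKC.
case: (posnP (m - n)%N) H => [/eqP|mn0]; last first.
  by rewrite subrr expr0n (gtn_eqF mn0) mul0r => H; rewrite H eqxx in A0.
rewrite subn_eq0 => mn; have -> : m = n by apply/eqP; rewrite eqn_leq nm mn.
by rewrite subnn expr0 mul1r.
Qed.

(** At a limit point of the set where [rho] is locally the identity, [rho z - z] in a chart cannot
    have a zero of finite order. *)
Lemma holomorphic_identity (rho : X -> X) c0 : holomorphic_map rho ->
  (\forall y \near c0, rho y = y) -> forall y, rho y = y.
Proof.
move=> hr r0 y.
suff : \forall x \near y, rho x = x by exact: nbhs_singleton.
apply: (clopen_connected hX (E := [set c | \forall y \near c, rho y = y])).
- by exists c0.
- by move=> x /= /nbhs_interior.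
move=> x H /=; have rx : rho x = x.
  by apply: contrapT => /(not_fixed_near hX hr)/H[z [/nbhs_singleton]].
have [i ix] := curve_cover x; have ix' : dom i (rho x) by rewrite rx.
have hd := holB (map_hol hr ix ix') (hol_id (coord i x)).
have H0 : \forall z \near coord i x, dom i (inv i z) -> dom i (rho (inv i z)) -> st rho i i z = z ->
    rho (inv i z) = inv i z.
  apply: nearS (inv_near ix (dom_near ix)) => z [_ zE _] iz jz E.
  by apply: (coord_inj jz iz); rewrite E zE.
have fin : (\forall z \near coord i x, st rho i i z - id z = 0) -> \forall y \near x, rho y = y.
  move=> Hz; have Hz' := nearS2 (fun z => @conj _ _) H0 Hz.
  apply: filterS3 (coord_near ix Hz') (dom_near ix) (map_near hr (dom_near ix')).
  move=> z [+ +] iz jz; rewrite (coordK iz) => H1 /eqP; rewrite subr_eq0 => /eqP E.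
  exact: H1.
have [Hz|[n [h [hh h0 hE]]]] := order_of_vanishing hd; first exact: fin.
have hn := coord_near ix (near_neq0 (hol_cont hh) h0).
have [z [zr [hz iz]]] := H _ (filterI hn (dom_near ix)).
have [<-//|zx] := pselect (z = x).
have /nbhs_singleton rz := zr; exfalso.
have := hE (coord i z); rewrite /= (coordK iz) rz subrr => /esym/eqP.
rewrite mulf_eq0 (negPf hz) orbF expf_eq0 subr_eq0 => /andP[_ /eqP].
by move/(coord_inj iz ix).
Qed.

End Affine.

(** * Finiteness of the half-turns; conjugation by affine maps *)

Section HalfTurns.
Variables (R : realType) (X : complex_curve R).
Local Notation C := (R[i]^o).
Implicit Types (i k : curve_index X) (c x y : X) (U V : set X) (f g tau : X -> X).

Lemma map_comp_cder f g i k l c : holomorphic_map f -> holomorphic_map g ->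
  dom i c -> dom k (f c) -> dom l (g (f c)) ->
  cder (st (fun y => g (f y)) i l) (coord i c)
    (dz (st g k l) (coord k (f c)) * dz (st f i k) (coord i c)).
Proof.
move=> hf hg ic kc lc; have D1 := map_cder hf ic kc; have D2 := map_cder hg kc lc.
have E : coord k (f c) = st f i k (coord i c) by rewrite (coordK ic).
rewrite [X in cder _ X]E in D2; have := cder_comp D1 D2; apply: near_cder.
by apply: nearS (map_inv_near hf ic kc) => z [_ _ kz]; rewrite (coordK kz).
Qed.

Lemma holomorphic_map_comp f g : holomorphic_map f -> holomorphic_map g ->
  holomorphic_map (fun y => g (f y)).
Proof.
move=> hf hg; split.
  have [cf _] := hf; have [cg _] := hg.
  by move=> y; apply: (@continuous_comp _ _ _ f g); [exact: cf|exact: cg].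
move=> i l c ic lc; have [k kc] := curve_cover (f c).
exact: cder_derivable (map_comp_cder hf hg ic kc lc).
Qed.

Lemma finite_power_roots n (a : C) : (0 < n)%N -> finite_set [set d : C | d ^+ n = a].
Proof.
move=> n0; pose P : {poly R[i]} := 'X^n - a%:P.
have [r Pr] := closed_field_poly_normal P.
have P0 : P != 0.
  by rewrite -size_poly_eq0 /P size_XnsubC.
apply: (@sub_finite_set _ _ [set` r]); last exact: finite_seq.
move=> d /= da; have : root P d.
  by rewrite rootE /P !hornerE da subrr.
by rewrite Pr rootZ ?lead_coef_eq0 // root_prod_XsubC.
Qed.

Hypothesis hX : closed_riemann_surface X.
Variable w : one_form X.
Hypothesis w0 : nonzero_form w.

Lemma half_turn_dz tau i k c : half_turn w tau -> dom i c -> dom k (tau c) ->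
  dz (st tau k i) (coord k (tau c)) * dz (st tau i k) (coord i c) = 1.
Proof.
move=> ht ic kc; have hol_tau := half_turn_holomorphic hX w0 ht.
have tt y : tau (tau y) = y by have := congr1 (@^~ y) (half_turnK ht).
have ic' : dom i (tau (tau c)) by rewrite tt.
have D := map_comp_cder hol_tau hol_tau ic kc ic'.
apply: (cder_uniq D); apply: near_cder (cder_id _).
by apply: nearS (inv_near ic (dom_near ic)) => z [_ zE _]; rewrite tt zE.
Qed.

(** In coordinates, with [W = (z - c) ^+ n * h] and [W' = (z - y) ^+ n' * h'], the leading terms of
    [W' o tau = - W] give [d ^+ n' * h' y = - h c] for the derivative [d] of [tau]. The exponent and
    [a] are read off from this and do not depend on [tau]. *)
Lemma half_turn_multiplier i k c y : dom i c -> dom k y -> exists n (a : C), (0 < n)%N /\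
  forall tau, half_turn w tau -> tau c = y -> dz (st tau i k) (coord i c) ^+ n = a.
Proof.
move=> ic ky.
have [W [n [h [dW n0 hh h0 WE]]]] := primitive_order hX w0 ic.
have [W' [n' [h' [dW' n'0 hh' h'0 WE']]]] := primitive_order hX w0 ky.
have Wc : W (coord i c) = 0 by rewrite WE subrr expr0n (gtn_eqF n0) mul0r.
have W'y : W' (coord k y) = 0 by rewrite WE' subrr expr0n (gtn_eqF n'0) mul0r.
exists n', (- h (coord i c) / h' (coord k y)); split=> // tau ht tc.
have kc : dom k (tau c) by rewrite tc.
have E := half_turn_primitive hX w0 ht ic kc dW; rewrite tc in E.
have {}E := E W' dW' Wc W'y.
have htau := map_hol (half_turn_holomorphic hX w0 ht) ic kc.
set q := dquo (st tau i k) (coord i c); set d := dz _ _.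
have q0 : q (coord i c) = d by rewrite /q dquo_id.
have tE : st tau i k (coord i c) = coord k y by rewrite (coordK ic) tc.
have cq : ccont q (coord i c) := hol_cont (hol_dquo htau).
have d0 : d != 0.
  by apply/eqP => d0; have /eqP := half_turn_dz ht ic kc; rewrite -/d d0 mulr0 eq_sym oner_eq0.
have cA : ccont (fun z => q z ^+ n' * h' (st tau i k z)) (coord i c).
  apply: ccontM; last by apply: ccont_comp; [exact: hol_cont|rewrite tE; exact: hol_cont].
  apply: (@ccont_comp R (fun z => z ^+ n') q); first exact: cq.
  exact: hol_cont (holX n' (hol_id _)).
have cB : ccont (fun z => (-1) * h z) (coord i c).
  by apply: ccontM; [exact: ccont_cst|exact: hol_cont].
have [|||_] := @order_unique R (coord i c) n' n _ _ cA cB.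
- by rewrite q0 tE mulf_neq0 // expf_neq0.
- by rewrite mulN1r oppr_eq0.
- apply: nearS E => z + _; rewrite WE WE' mulN1r mulrN => <-.
  rewrite mulrA -exprMn; congr (_ ^+ _ * _).
  have := dquoE (st tau i k) (coord i c) z; rewrite -/q tE => ->.
  by rewrite [coord k y + _]addrC addrK.
by rewrite q0 tE mulN1r => <-; rewrite mulfK.
Qed.

(** [rho = tau o tau'] fixes [c], has derivative 1 there and preserves the primitive
    [W = (z - z0) ^+ n * h]. Writing [rho z - z0 = (z - z0) * q z] gives
    [q z ^+ n * h (rho z) = h z], hence [(q z - 1) * G z = h z - h (rho z)], of modulus at most
    [M * |z - z0| * |q z - 1|]. As [G z0 = n * h z0] is not 0, this forces [q = 1] near [z0], so
    [rho] is the identity. *)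
Lemma half_turn_unique i k c tau tau' : half_turn w tau -> half_turn w tau' ->
  dom i c -> dom k (tau c) -> tau' c = tau c ->
  dz (st tau' i k) (coord i c) = dz (st tau i k) (coord i c) ->
  forall y, tau' y = tau y.
Proof.
move=> ht ht' ic kc cE dE.
have hol_t := half_turn_holomorphic hX w0 ht; have hol_t' := half_turn_holomorphic hX w0 ht'.
have tt y : tau (tau y) = y by have := congr1 (@^~ y) (half_turnK ht).
pose rho y := tau (tau' y).
have hrho : holomorphic_map rho := holomorphic_map_comp hol_t' hol_t.
have kc' : dom k (tau' c) by rewrite cE.
have rc : rho c = c by rewrite /rho cE tt.
have irc : dom i (rho c) by rewrite rc.
have drho : dz (st rho i i) (coord i c) = 1.
  rewrite (cder_dz (map_comp_cder hol_t' hol_t ic kc' irc)) cE dE.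
  exact: half_turn_dz.
suff H : \forall y \near c, rho y = y.
  by move=> y; rewrite -[LHS]tt -/(rho y) (holomorphic_identity hX hrho H).
have [W [n [h [dW n0 hh h0 WE]]]] := primitive_order hX w0 ic.
have [W' [n' [h' [dW' n'0 hh' h'0 WE']]]] := primitive_order hX w0 kc.
have Wc : W (coord i c) = 0 by rewrite WE subrr expr0n (gtn_eqF n0) mul0r.
have W'c : W' (coord k (tau c)) = 0 by rewrite WE' subrr expr0n (gtn_eqF n'0) mul0r.
have E1 := half_turn_primitive hX w0 ht' ic kc' dW; rewrite cE in E1.
have {}E1 := E1 W' dW' Wc W'c.
have ittc : dom i (tau (tau c)) by rewrite tt.
have E2 := half_turn_primitive hX w0 ht kc ittc dW'; rewrite tt in E2.
have {}E2 := E2 W dW W'c Wc.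
have t'E : st tau' i k (coord i c) = coord k (tau c) by rewrite (coordK ic) cE.
have ct' := half_turn_ccont ht' ic kc'.
have E2' : \forall z \near coord i c, W (st tau k i (st tau' i k z)) = - W' (st tau' i k z).
  by apply: (near_ccont ct' (P := fun v => W (st tau k i v) = - W' v)); rewrite t'E.
have E3 : \forall z \near coord i c, W (st rho i i z) = W z.
  have := nearS2 (fun z => @conj _ _) E1 E2'.
  apply: nearS2 (half_turn_inv_near ht' ic kc') => z [_ _ kz] [e1 e2].
  by rewrite /rho -[X in tau X](coordK kz) e2 e1 opprK.
have hr := map_hol hrho ic irc.
set z0 := coord i c in dW hh h0 WE Wc hr drho E3 *.
have rE : st rho i i z0 = z0 by rewrite /z0 (coordK ic) rc.
pose q := dquo (st rho i i) z0.
have qE z : st rho i i z = z0 + (z - z0) * q z by rewrite -{1}rE; exact: dquoE.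
have q0 : q z0 = 1 by rewrite /q dquo_id.
pose G z := (\sum_(l < n) q z ^+ l) * h (st rho i i z).
have cG : ccont G z0.
  apply: ccontM; last by apply: ccont_comp; [exact: hol_cont|rewrite rE; exact: hol_cont].
  by apply: hol_cont; apply: hol_sum => l; exact: (holX _ (hol_dquo hr)).
have G0 : G z0 != 0.
  rewrite /G rE q0 mulf_neq0 //; under eq_bigr do rewrite expr1n.
  by rewrite sumr_const card_ord pnatr_eq0 -lt0n.
have [r1 r10 G1] := ccont_neq0 cG G0.
have [M [r2 [M0 r20 lip]]] := hol_lipschitz hh.
have r30 : 0 < cabs (G z0) / 2 / M by rewrite !divr_gt0 // cabs_gt0.
have rnear : \forall z \near z0, cabs (st rho i i z - z0) < r2.
  apply: (near_ccont (hol_cont hr) (P := fun v => cabs (v - z0) < r2)).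
  by rewrite rE; exact: near_cabs.
have ball : \forall z \near z0, cabs (z - z0) < Num.min r1 (Num.min r2 (cabs (G z0) / 2 / M)).
  by apply: near_cabs; rewrite !lt_min r10 r20.
have fixed : \forall z \near z0, st rho i i z = z.
  have := nearS2 (fun z => @conj _ _) E3 rnear; apply: nearS2 ball => z + [e3 zr].
  rewrite !lt_min => /andP[/G1 Gz /andP[z2 zM]].
  have [->|zz] := eqVneq z z0; first exact: rE.
  have zz0 : z - z0 != 0 by rewrite subr_eq0.
  rewrite qE; have [->|q1] := eqVneq (q z) 1; first by rewrite mulr1 addrC subrK.
  exfalso; have qn : q z ^+ n * h (st rho i i z) = h z.
    apply: (mulfI (expf_neq0 n zz0)); rewrite -WE -e3 WE qE [z0 + _ - z0]addrC addKr exprMn.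
    by rewrite -mulrA.
  have K : (q z - 1) * G z = h z - h (st rho i i z).
    by rewrite /G mulrA -subrX1 mulrBl mul1r qn.
  have q1' : 0 < cabs (q z - 1) by rewrite cabs_gt0 subr_eq0.
  have : cabs (q z - 1) * cabs (G z) <= M * (cabs (z - z0) * cabs (q z - 1)).
    rewrite -cabsM K -cabsM [(z - z0) * _]mulrC.
    have -> : cabs ((q z - 1) * (z - z0)) = cabs (z - st rho i i z).
      by rewrite cabs_distC; congr cabs; rewrite qE; ring.
    exact: lip.
  rewrite mulrA mulrC ler_pM2r //; move: zM; rewrite ltr_pdivlMr // mulrC.
  lra.
apply: filterS3 (coord_near ic fixed) (dom_near ic) (map_near hrho (dom_near irc)).
by move=> y + iy ry; rewrite (coordK iy) => E; exact: (coord_inj ry iy E).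
Qed.

Lemma half_turn_orbit c (A : set X) : form_zeros w c ->
  (forall y, A y -> exists2 tau, half_turn w tau & tau y = y) -> finite_set A.
Proof.
(* A derivative between two points depends on the charts; fixing the chart at the image makes [mult]
   a number attached to [tau], comparable for half-turns with the same [tau c]. *)
move=> wc HA; have ic := chart_atP c; set i := chart_at c in ic.
pose mult tau := dz (st tau i (chart_at (tau c))) (coord i c).
pose D y : set C := [set d | exists tau, [/\ half_turn w tau, tau c = y & mult tau = d]].
pose B y (d : C) : set X := [set z | exists tau,
  [/\ half_turn w tau, tau c = y, mult tau = d & tau z = z]].
apply: (@sub_finite_set _ _ (\bigcup_(y in form_zeros w) \bigcup_(d in D y) B y d)).
  move=> y /HA[tau ht ty]; exists (tau c); first exact: (half_turn_zeros ht).
  by exists (mult tau); exists tau.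
apply: bigcup_finite; first exact: form_zeros_finite.
move=> y _; apply: bigcup_finite.
  have [n [a [n0 Ha]]] := half_turn_multiplier ic (chart_atP y).
  apply: sub_finite_set (finite_power_roots a n0) => d [tau [ht ty <-]] /=.
  by rewrite /mult ty; exact: Ha.
move=> d [tau [ht ty td]].
apply: sub_finite_set (half_turn_fixed ht) => z [tau' [ht' ty' td' zz]] /=.
rewrite -{2}zz; apply/esym.
apply: (@half_turn_unique i (chart_at (tau c)) c tau tau' ht ht' ic (chart_atP _)).
  by rewrite ty ty'.
by move: td'; rewrite -td /mult ty' ty.
Qed.

Lemma plane_actionD (L : 'M[R]_2) (a b : C) :
  plane_action L (a + b) = plane_action L a + plane_action L b.
Proof.
case: a b => [a1 a2] [b1 b2]; rewrite /plane_action /=.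
by congr Complex; rewrite !mulrDr addrACA.
Qed.

Lemma plane_actionN (L : 'M[R]_2) (a : C) : plane_action L (- a) = - plane_action L a.
Proof.
case: a => [a1 a2]; rewrite /plane_action /=.
by congr Complex; rewrite !mulrN -opprD.
Qed.

Variable s : X -> X.
Hypothesis hs : holomorphic_map s.
Hypothesis ss : s \o s = id.
Hypothesis s1 : s <> id.
Variable p : X -> riemann_sphere R.
Hypothesis hp : is_involution_quotient s p.

(** By [form_odd], [xi o s + zeta] has derivative 0 in a chart, hence is locally constant. *)
Lemma involution_flat U V (zeta xi : X -> C) y :
  flat_coordinate w U zeta -> flat_coordinate w V xi -> U y -> V (s y) ->
  exists a : C, \forall x \near y, xi (s x) = - zeta x + a.
Proof.
move=> fU fV Uy Vy; have [i iy] := curve_cover y; have [k ky] := curve_cover (s y).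
have near_all : \forall x \near y, [/\ dom i x, dom k (s x), U x & V (s x)].
  have H : \forall x \near y, dom i x /\ dom k (s x).
    exact: filterI (dom_near iy) (map_near hs (dom_near ky)).
  have H' : \forall x \near y, U x /\ V (s x).
    exact: filterI (flat_near fU Uy) (map_near hs (flat_near fV Vy)).
  by apply: filterS2 H H' => x [? ?] [? ?]; split.
pose D z := xi (s (inv i z)) + zeta (inv i z).
have dD x : [/\ dom i x, dom k (s x), U x & V (s x)] -> cder D (coord i x) 0.
  move=> [ix kx Ux Vx]; have d1 := flat_cder fU Ux ix; have d2 := flat_cder fV Vx kx.
  have E : coord k (s x) = st s i k (coord i x) by rewrite (coordK ix).
  rewrite [X in cder _ X]E in d2; have := cderD (cder_comp (map_cder hs ix kx) d2) d1.
  rewrite (form_odd hX hs ss s1 hp w ix kx) addNr; apply: near_cder.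
  by apply: nearS (map_inv_near hs ix kx) => z [_ _ kz]; rewrite /D (coordK kz).
have cD : ccont D (coord i y) := cder_cont (dD y (nbhs_singleton near_all)).
have H : \forall z \near coord i y, z != coord i y -> cder D z 0.
  by apply: nearS (inv_near iy near_all) => z [_ zE /dD]; rewrite zE.
exists (D (coord i y)).
apply: filterS2 (coord_near iy (punctured_constant cD H)) (dom_near iy) => x + ix.
by rewrite {1}/D (coordK ix) => <-; rewrite addrC addrK.
Qed.

Lemma conjugate_half_turn f g : affine_map w f -> continuous g -> cancel f g ->
  cancel g f -> (forall y, form_zeros w y -> form_zeros w (s y)) ->
  half_turn w (fun y => f (s (g y))).
Proof.
move=> [[cf _] fZ [L _ fL]] cg fK gK sZ; have [cs _] := hs.
have ssK := involutionK ss.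
have fz y : form_zeros w y -> form_zeros w (f y) by move=> yz; rewrite -fZ; exists y.
have gz y : form_zeros w y -> form_zeros w (g y).
  by rewrite -{1}fZ => -[x xz <-]; rewrite fK.
have gn y : ~ form_zeros w y -> ~ form_zeros w (g y).
  by move=> yn /fz; rewrite gK.
have sn y : ~ form_zeros w y -> ~ form_zeros w (s y).
  by move=> yn /sZ; rewrite ssK.
split.
- move=> y; apply: (@continuous_comp _ _ _ (fun y => s (g y)) f); last exact: cf.
  by apply: (@continuous_comp _ _ _ g s); [exact: cg|exact: cs].
- by apply/funext => y; rewrite /= fK ssK gK.
- by move=> y /gz/sZ/fz.
- move=> U V zeta xi fU fV y Uy Vy.
  have wy : ~ form_zeros w y by have [_ H _ _] := fU; exact: H.
  have [U1 [zeta1 [fU1 Uy1]]] := flat_exists (gn _ wy).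
  have [U2 [zeta2 [fU2 Uy2]]] := flat_exists (sn _ (gn _ wy)).
  have Ufg : U (f (g y)) by rewrite gK.
  have [a1 H1] := fL _ _ _ _ fU1 fU (g y) Uy1 Ufg.
  have [a2 H2] := fL _ _ _ _ fU2 fV (s (g y)) Uy2 Vy.
  have [a3 H3] := involution_flat fU1 fU2 Uy1 Uy2.
  (* With [L] acting linearly, [xi (f (s (g x))) = L (- zeta1 (g x) + a3) + a2] and
     [L (zeta1 (g x)) = zeta x - a1]; additivity collects the constants. *)
  exists (a1 + plane_action L a3 + a2).
  have G1 : \forall x \near y, zeta (f (g x)) = plane_action L (zeta1 (g x)) + a1 := cg y _ H1.
  have G3 : \forall x \near y, zeta2 (s (g x)) = - zeta1 (g x) + a3 := cg y _ H3.
  have G2 : \forall x \near y, xi (f (s (g x))) = plane_action L (zeta2 (s (g x))) + a2.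
    exact: cg y _ (map_near hs H2).
  apply: filterS3 G1 G2 G3 => x + -> ->; rewrite gK => ->.
  by rewrite plane_actionD plane_actionN; ring.
apply: (@sub_finite_set _ _ (f @` [set y | s y = y])).
  move=> y /= yE; exists (g y) => //=; apply: (can_inj fK).
  by rewrite yE gK.
exact/finite_image/(fixed_finite hX hs ss s1).
Qed.

End HalfTurns.

Unset Implicit Arguments.

Theorem theorem2p8 (R : realType) (X : complex_curve R) (w : one_form X)
    (s : X -> X) (hX : translation_surface w)
    (hs : hyperelliptic_involution w s) (hgen : generated_by_torsion w)
    (x : X) (hx : weierstrass_point x) :
  periodic_point w x.
Proof.
have [hcrs w0] := hX; have [hols ss s1 [_ sZ _] [p hp]] := hs.
have [sx [c wc]] := weierstrass_fixed hcrs hols ss s1 hp w0 hx.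
apply: (half_turn_orbit hcrs w0 wc) => y [f fa ->].
have [[_ [g [cg fK gK]]] _ _] := fa.
exists (fun y => f (s (g y))); last by rewrite fK sx.
apply: (conjugate_half_turn hcrs hols ss s1 hp fa cg fK gK) => z wz.
by rewrite -sZ; exists z.
Qed.
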